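(* For every integer $n\ge2$, the following two statements are equivalent: (a) $\bm{U}_n\overset{D}{=}\bm{V}_n$, i.e. the vector of last swap times of the oriented swap process on $n$ particles and the point-to-line last passage percolation vector with i.i.d. rate-$1$ exponential weights have the same joint distribution; (b) the identity $$\sum_{t\in \mathrm{SYT}(\delta_n)} f_t(x_1,\ldots,x_{n-1})\, \sigma_t = \sum_{s\in \mathrm{SN}_n} g_s(x_1,\ldots,x_{n-1})\, \pi_s$$ holds in the free vector space generated by the elements of the symmetric group $S_{n-1}$ over the field of rational functions $\mathbb{C}(x_1,\dots,x_{n-1})$ (equivalently, for every $\gamma\in S_{n-1}$, $\sum_{t\in\mathrm{SYT}(\delta_n):\,\sigma_t=\gamma} f_t=\sum_{s\in\mathrm{SN}_n:\,\pi_s=\gamma}g_s$).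
   Context: Oriented swap process (OSP) on $n$ particles: at time $0$, particle $j$ is in position $j$, $j=1,\dots,n$. Each pair of adjacent positions $(k,k+1)$, $1\le k\le n-1$, carries an independent rate-$1$ Poisson clock. When it rings, the particles with labels $i,j$ currently at positions $k,k+1$ swap if $i<j$, and nothing happens otherwise. Define $\bm{U}_n=(U_n(1),\dots,U_n(n-1))$ with $U_n(k):=$ the last time at which a (successful) swap occurs between positions $k$ and $k+1$. Last passage vector: let $(X_{i,j})_{i,j\ge1}$ be i.i.d. exponential of rate $1$, $L(i,j)=\max\{L(i-1,j),L(i,j-1)\}+X_{i,j}$ for $i,j\ge1$, with $L(i,j)=0$ if $i=0$ or $j=0$. Define $\bm{V}_n=(V_n(1),\dots,V_n(n-1))$ with $V_n(k):=L(n-k,k)$. (Equivalently, $V_n(k)$ is the time at which box $(n-k,k)$ is added in the growth process of Young diagrams inside $\delta_n$ started from the empty diagram, in which each box of $\delta_n$ that can be added so as to leave a Young diagram is added at rate $1$, independently.) Let $N=n(n-1)/2$ and let $\delta_n=(n-1,n-2,\dots,1)$ be the staircase Young diagram, with boxes $(i,j)$ ($i$ = row, $j$ = column, English convention). $\mathrm{SYT}(\delta_n)$ is the set of standard Young tableaux $t=(t_{i,j})$ of shape $\delta_n$. For $t\in \mathrm{SYT}(\delta_n)$: - $\mathrm{cor}_t:=(t_{n-1,1},t_{n-2,2},\dots,t_{1,n-1})$; - $\sigma_t\in S_{n-1}$ is the permutation such that $\sigma_t(j)<\sigma_t(k)$ if and only if $\mathrm{cor}_t(j)<\mathrm{cor}_t(k)$,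 for all $j,k$; - $\overline{\mathrm{cor}}_t$ is the increasing rearrangement of $\mathrm{cor}_t$, and $\overline{\mathrm{cor}}_t(0):=0$; - for $0\le k\le N-1$, $\lambda^{(k)}$ is the Young diagram consisting of the boxes $(i,j)$ with $t_{i,j}\le k$, and $\deg_t(k)$ is the number of boxes $(i,j)\in\delta_n\setminus\lambda^{(k)}$ such that $\lambda^{(k)}\cup\{(i,j)\}$ is a Young diagram; - $\displaystyle f_t(x_1,\dots,x_{n-1}):=\prod_{k=1}^{n-1}\ \prod_{\overline{\mathrm{cor}}_t(k-1)<j\le\overline{\mathrm{cor}}_t(k)}\frac{1}{x_k+\deg_t(j-1)}$. A sorting network of order $n$ is a sequence $s=(s_1,\dots,s_N)$ with $1\le s_j<n$ such that $\tau_{s_N}\cdots\tau_{s_2}\tau_{s_1}$ is the reverse permutation $(n,n-1,\dots,1)$, where $\tau_j=(j\ \ j+1)\in S_n$. $\mathrm{SN}_n$ is the set of sorting networks of order $n$. For $s\in\mathrm{SN}_n$: - $\mathrm{last}_s=(\mathrm{last}_s(1),\dots,\mathrm{last}_s(n-1))$ with $\mathrm{last}_s(k):=\max\{1\le j\le N: s_j=k\}$; - $\pi_s\in S_{n-1}$ is the permutation such that $\pi_s(j)<\pi_s(k)$ if and only if $\mathrm{last}_s(j)<\mathrm{last}_s(k)$, for all $j,k$; - $\overline{\mathrm{last}}_s$ is the increasing rearrangement of $\mathrm{last}_s$, and $\overline{\mathrm{last}}_s(0):=0$; - for $0\le k\le N-1$, $\nu^{(k)}=(\nu^{(k)}(1),\dots,\nu^{(k)}(n))$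 is the arrangement obtained from $(1,2,\dots,n)$ by successively, for $i=1,\dots,k$, swapping the entries in positions $s_i$ and $s_i+1$, and $\deg_s(k):=|\{1\le j\le n-1:\nu^{(k)}(j)<\nu^{(k)}(j+1)\}|$; - $\displaystyle g_s(x_1,\dots,x_{n-1}):=\prod_{k=1}^{n-1}\ \prod_{\overline{\mathrm{last}}_s(k-1)<j\le\overline{\mathrm{last}}_s(k)}\frac{1}{x_k+\deg_s(j-1)}$. *)

(* Defs.v *)
From HB Require Import structures.
From mathcomp Require Import all_boot all_order all_algebra all_fingroup.
From mathcomp Require Import fraction.
From mathcomp Require Import all_classical all_reals all_analysis.
From mathcomp Require Import -(notations) mpoly.
From mathcomp Require Import -(notations) complex.

Set Implicit Arguments.
Unset Strict Implicit.
Unset Printing Implicit Defensive.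

Import Order.TTheory GRing.Theory Num.Theory.

Local Open Scope ring_scope.

(* Positions, labels and indices in {1, ..., n} or {1, ..., n-1} are encoded as
   elements of 'I_n or 'I_n.-1 shifted down by one, so that k : 'I_n.-1 stands
   for k+1. Only the boxes of Young diagrams keep their 1-based coordinates. *)

Section Arrangements.
Context {n : nat}.

Lemma succ_pos_subproof (k : 'I_n.-1) : (k.+1 < n)%N.
Proof. by case: n k => [|m] [k] //=. Qed.

(* The two positions of the adjacent pair k. *)
Definition lpos (k : 'I_n.-1) : 'I_n := widen_ord (leq_pred n) k.
Definition rpos (k : 'I_n.-1) : 'I_n := Ordinal (succ_pos_subproof k).

Definition adj (k : 'I_n.-1) : 'S_n := tperm (lpos k) (rpos k).

Definition rev_perm : 'S_n := perm (@rev_ord_inj n).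

(* An arrangement c : 'S_n maps each position to the entry (label) in it.
   Since (a * c)%g p = c (a p), multiplying by adj k on the left exchanges the
   entries in the positions lpos k and rpos k. *)
Definition swap_at (k : 'I_n.-1) (c : 'S_n) : 'S_n := (adj k * c)%g.

Definition ascent (c : 'S_n) (k : 'I_n.-1) : bool := (c (lpos k) < c (rpos k))%N.

End Arrangements.

Section OrientedSwapProcess.
Context {R : realType} {n : nat}.

(* [w k r] is the waiting time between the r-th and the (r+1)-st ring of the
   clock of the adjacent pair k (for r = 0: the time until the first ring). *)
Variable w : 'I_n.-1 -> nat -> R.

Definition ring_time (k : 'I_n.-1) (r : nat) : R := \sum_(i < r.+1) w k i.

(* State between two consecutive rings of the superposition of all clocks:
   the number of past rings of each clock, and the current arrangement. *)
Record osp_state := OspState {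
  rings : 'I_n.-1 -> nat;
  labels : 'S_n }.

Definition next_ring (st : osp_state) (k : 'I_n.-1) : R :=
  ring_time k (rings st k).

(* The clock that rings next; it is unique unless two clocks ring at the same
   time, which is a null event for Poisson clocks. *)
Definition next_clock (st : osp_state) : option 'I_n.-1 :=
  [pick k | [forall l, next_ring st k <= next_ring st l]].

Definition osp_step (st : osp_state) : osp_state :=
  if next_clock st is Some k then
    OspState (fun l => (rings st l + (l == k))%N)
             (if ascent (labels st) k then swap_at k (labels st) else labels st)
  else st.

Definition osp_after (r : nat) : osp_state :=
  iter r osp_step (OspState (fun=> 0%N) 1%g).

Definition swap_times (k : 'I_n.-1) : set R :=
  [set t | exists r, [/\ next_clock (osp_after r) = Some k,
                         ascent (labels (osp_after r)) k
                       & t = next_ring (osp_after r) k]]%classic.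

(* [swap_times k] is always finite, because a swap decreases the number of
   ascending pairs of labels; so the supremum is the last swap time. *)
Definition last_swap_times : n.-1.-tuple R :=
  [tuple sup (swap_times k) | k < n.-1].

End OrientedSwapProcess.

(* [x i j] is the weight X_{i+1,j+1} of the box (i+1, j+1). *)
Fixpoint last_passage {R : realType} (x : nat -> nat -> R) (i : nat) : nat -> R :=
  if i is i'.+1 then
    fix row j := if j is j'.+1
                 then Num.max (last_passage x i' j) (row j') + x i' j'
                 else 0
  else fun=> 0.

Definition point_to_line {R : realType} (n : nat) (x : nat -> nat -> R) :
    n.-1.-tuple R :=
  [tuple last_passage x (n - k.+1) k.+1 | k < n.-1].

Section Probability.
Context {R : realType}.

Definition mutually_independent d (T : measurableType d) (P : probability T R)
    (I : eqType) (X : I -> {RV P >-> R}) : Prop :=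
  forall (s : seq I) (B : I -> set R), uniq s ->
    (forall i, measurable (B i)) ->
    P (\bigcap_(i in [set` s]) (X i @^-1` B i))%classic =
    (\prod_(i <- s) P (X i @^-1` B i)%classic)%E.

Definition iid_exponential d (T : measurableType d) (P : probability T R)
    (I : eqType) (X : I -> {RV P >-> R}) : Prop :=
  (forall i (B : set R), measurable B ->
     distribution P (X i) B = exponential_prob 1 B) /\
  mutually_independent X.

Definition eq_in_distribution d1 d2 d (T1 : measurableType d1)
    (T2 : measurableType d2) (T : measurableType d)
    (P : probability T1 R) (Q : probability T2 R)
    (U : T1 -> T) (V : T2 -> T) : Prop :=
  forall B : set T, measurable B -> pushforward P U B = pushforward Q V B.

End Probability.

Section Standardization.
Context {m : nat}.
Variable v : 'I_m -> nat.

(* The permutation ordered as v; it exists, and is unique, when v is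
   injective. *)
Definition order_perm : 'S_m :=
  odflt 1%g [pick s : 'S_m | [forall j, forall k, (s j < s k)%N == (v j < v k)%N]].

(* Increasing rearrangement of v, preceded by the entry 0 of index 0. *)
Definition increasing (k : nat) : nat :=
  nth 0%N (0%N :: sort leq [seq v k | k : 'I_m]) k.

End Standardization.

(* C(x_1, ..., x_m), with C realized as the complex numbers over R. *)
Definition ratfun (R : realType) (m : nat) : fieldType :=
  {fraction (mpoly.mpoly m (complex R))}.

Definition rvar {R : realType} {m : nat} (k : 'I_m) : ratfun R m :=
  tofrac (@mpolyX m (complex R) (mnm1 k)).

(* The inner index j is one less than in
   prod_(v'(k-1) < j <= v'(k)) 1 / (x_k + deg (j-1)). *)
Definition rate_product (R : realType) {m : nat} (v : 'I_m -> nat)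
    (deg : nat -> nat) : ratfun R m :=
  \prod_(k < m) \prod_(increasing v k <= j < increasing v k.+1)
     (rvar k + (deg j)%:R)^-1.

(* Free vector space generated by S_m over C(x_1, ..., x_m). *)
Definition free_space (R : realType) (m : nat) : lmodType (ratfun R m) :=
  {ffun 'S_m -> (ratfun R m)^o}.

Definition basis_vec (R : realType) {m : nat} (s : 'S_m) : free_space R m :=
  [ffun u => (u == s)%:R].

Definition nbox (n : nat) : nat := (n * n.-1)./2.

Section StaircaseTableaux.
Context {n : nat}.

Definition box : Type := 'I_n.+1 * 'I_n.+1.

Definition staircase : {set box} :=
  [set b : box | [&& (0 < b.1)%N, (0 < b.2)%N & (b.1 + b.2 <= n)%N]].

Definition is_diagram (D : {set box}) : bool :=
  [forall b in D, [&& (0 < b.1)%N, (0 < b.2)%N &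
    [forall c : box, [&& (0 < c.1)%N, (0 < c.2)%N, (c.1 <= b.1)%N
                       & (c.2 <= b.2)%N] ==> (c \in D)]]].

(* Fillings of the staircase are extended by 0 outside of it. *)
Definition filling := {ffun box -> 'I_(nbox n).+1}.

Definition is_syt (t : filling) : bool :=
  [&& [forall b, (b \in staircase) == (0 < t b)%N],
      [forall b in staircase, forall c in staircase, (t b == t c) ==> (b == c)],
      [forall b in staircase, forall c in staircase,
         (b.1 == c.1) && (b.2 < c.2)%N ==> (t b < t c)%N]
    & [forall b in staircase, forall c in staircase,
         (b.2 == c.2) && (b.1 < c.1)%N ==> (t b < t c)%N]].

Definition SYT : {set filling} := [set t | is_syt t].

Definition cor (t : filling) (k : 'I_n.-1) : nat :=
  t (inord (n - k.+1), inord k.+1).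

Definition syt_perm (t : filling) : 'S_n.-1 := order_perm (cor t).

Definition subdiagram (t : filling) (k : nat) : {set box} :=
  [set b in staircase | (t b <= k)%N].

Definition syt_deg (t : filling) (k : nat) : nat :=
  #|[set b in staircase :\: subdiagram t k | is_diagram (b |: subdiagram t k)]|.

Definition syt_gf (R : realType) (t : filling) : ratfun R n.-1 :=
  rate_product R (cor t) (syt_deg t).

End StaircaseTableaux.

Section SortingNetworks.
Context {n : nat}.

Definition swap_seq := (nbox n).-tuple 'I_n.-1.

(* Products of permutations are composed from left to right in the library,
   whence the order of the factors. *)
Definition SN : {set swap_seq} :=
  [set s : swap_seq | (\prod_(k <- s) adj k)%g == rev_perm].

Definition last_swap (s : swap_seq) (k : 'I_n.-1) : nat :=
  \max_(j < nbox n | tnth s j == k) j.+1.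

Definition sn_perm (s : swap_seq) : 'S_n.-1 := order_perm (last_swap s).

Definition arrangement (s : swap_seq) (k : nat) : 'S_n :=
  foldl (fun c i => swap_at i c) 1%g (take k s).

Definition sn_deg (s : swap_seq) (k : nat) : nat :=
  #|[set j | ascent (arrangement s k) j]|.

Definition sn_gf (R : realType) (s : swap_seq) : ratfun R n.-1 :=
  rate_product R (last_swap s) (sn_deg s).

End SortingNetworks.

Arguments SYT n : clear implicits.
Arguments SN n : clear implicits.

(* Main.v *)
(** Fix a permutation [c] and natural numbers [y r]. For a random vector [v]
    consider the expectation of
      [1 (v is ordered as c) * exp (- sum_r y r * (v_(r) - v_(r-1)))],
    where [v_(1) < v_(2) < ...] are the sorted entries and [v_(0) = 0].
    In a continuous-time Markov chain whose paths perform a fixed number [N] of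
    jumps, each at rate 1, a given sequence [w] of jumps occurs, jointly with
    independent exponential holding times, with density
      [prod_j exp (- deg j * h_j)].
    If the k-th entry of [v] is the time of the jump number [last w k], the gap
    number [r] is the sum of the holding times [h_j] with [j] in the r-th stage,
    and the expectation is the sum over the words [w] with [last w] ordered as
    [c] of [prod_j 1 / (y (stage j) + deg j)]. For the swap process the words are
    the sorting networks, for the growth process they are the standard tableaux,
    so that these expectations are the two sides of (b) evaluated at the natural
    point [y].
    Natural points determine a rational function without poles there. They
    also determine the law of [v]: polynomials in the [exp (- gap)] approximate
    the indicators of the upper boxes in the gaps, and the case [y = 0] shows that
    ties have probability 0. *)

Require Import Defs.
From HB Require Import structures.
From mathcomp Require Import all_boot all_order all_algebra all_fingroup.
From mathcomp Require Import fraction.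
From mathcomp Require Import -(notations) mpoly.
From mathcomp Require Import -(notations) complex.
From mathcomp Require Import ring lra zify.
From mathcomp Require Import all_classical all_reals all_analysis.
From mathcomp Require Import measurable_realfun.

Set Implicit Arguments.
Unset Strict Implicit.
Unset Printing Implicit Defensive.

Import Order.TTheory GRing.Theory Num.Theory.
Import numFieldNormedType.Exports.

Local Open Scope ring_scope.

(** * Exponential laws and independent clocks *)

(** Both processes are instances of one abstract chain driven by clocks. The links to
    [last_swap_times] and [last_passage] are made path by path, on every configuration whose run
    terminates, rather than through laws. Two obstacles shape this chain. In the swap process every
    clock runs all the time, so the number of ineffective rings between two swaps is unbounded;
    hence the distinction between [active] and [effective] clocks, and expectations that are
    computed for at most [m] rings before [m] tends to infinity. In the growth process a clock
    starts only when its box becomes addable, so the waiting times of idle clocks must stay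
    untouched while time advances. Almost sure termination is not proved separately: at zero
    discount the weights of the complete words are the path probabilities of the jump chain and sum
    to 1, and this total mass forces the lower bounds coming from terminated runs to be exact. *)

Definition mfun_of d1 d2 (T1 : measurableType d1) (T2 : measurableType d2)
    (f : T1 -> T2) (mf : measurable_fun setT f) : {mfun T1 >-> T2} :=
  HB.pack f (isMeasurableFun.Build _ _ _ _ f mf).

Definition image_measure d1 d2 (T1 : measurableType d1) (T2 : measurableType d2)
    (R : realType) (m : {measure set T1 -> \bar R}) (f : T1 -> T2)
    (mf : measurable_fun setT f) : {measure set T2 -> \bar R} :=
  measure_function_pushforward__canonical__measure_function_Measure m mf.

Lemma ge0_integral_mrestr d (T : measurableType d) (R : realType)
    (m : {measure set T -> \bar R}) (D : set T) (mD : measurable D)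
    (f : T -> \bar R) :
  measurable_fun setT f -> (forall x, (0 <= f x)%E) ->
  (\int[mrestr m mD]_x f x = \int[m]_(x in D) f x)%E.
Proof.
move=> mf f0; have mC := measurableC mD.
rewrite -(setvU D) ge0_integral_setU//; last 2 first.
- by rewrite setvU.
- by rewrite disj_set2E setICl.
rewrite [X in (X + _)%E]null_set_integral ?add0e//.
- by apply: eq_measure_integral => A mA AD; rewrite /= /mrestr setIidl.
- exact: measurable_funTS.
- by rewrite /= /mrestr setICl measure0.
Qed.

Section ExponentialLaw.
Context {R : realType}.
Local Open Scope classical_set_scope.
Local Open Scope ereal_scope.

(* [exponential_prob] is a measure on [measurableTypeR R], whose measurable
   sets are those of [R] although the two structures are not unifiable. *)
Definition expo (A : set R) : \bar R := exponential_prob 1 A.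

Let expo_measureTypeR : probability (measurableTypeR R) R :=
  exponential_distribution_exponential_prob__canonical__probability_measure_Probability
    (@ltr01 R).

Let expo0 : expo set0 = 0.
Proof. exact: (@measure0 _ _ _ expo_measureTypeR). Qed.

Let expo_ge0 A : 0 <= expo A.
Proof. exact: (@measure_ge0 _ _ _ expo_measureTypeR). Qed.

Let expo_sigma_additive : semi_sigma_additive expo.
Proof. exact: (@measure_semi_sigma_additive _ _ _ expo_measureTypeR). Qed.

HB.instance Definition _ :=
  isMeasure.Build _ R R expo expo0 expo_ge0 expo_sigma_additive.

Let expo_setT : expo setT = 1%E.
Proof. exact: (@probability_setT _ _ _ expo_measureTypeR). Qed.

HB.instance Definition _ := Measure_isProbability.Build _ R R expo expo_setT.

Lemma expo_itv0y : expo `[0%R, +oo[ = 1.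
Proof.
rewrite -(@integral_exponential_pdf R 1 ltr01) /expo /exponential_prob.
rewrite [LHS]integral_mkcond; apply: eq_integral => x _.
rewrite patchE; case: ifPn => //; rewrite notin_setE /= in_itv /= andbT.
by move/negP; rewrite -ltNge => x0; rewrite lt0_exponential_pdf.
Qed.

Lemma expo_itv_ge0 (a : R) : (0 <= a)%R -> expo `]a, +oo[ = (expR (- a))%:E.
Proof.
move=> a_ge0; have := expo_itv0y.
rewrite (@itv_bndbnd_setU _ _ _ (BRight a))//.
rewrite measureU//; last first.
  rewrite -subset0 => x [/=]; rewrite !in_itv/= => /andP[_ xa].
  by rewrite andbT ltNge xa.
rewrite /=; have -> : expo `[0%R, a] = (1 - expR (- a))%:E.
  move: a_ge0; rewrite le_eqVlt => /predU1P[<-|a0].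
    rewrite oppr0 expR0 subrr set_itv1 /expo /exponential_prob.
    by rewrite integral_set1.
  by rewrite /expo exponential_prob_itv0c// mulN1r.
have : expo `]a, +oo[ \is a fin_num by apply: fin_num_measure.
case: (expo _) => // r _; rewrite -EFinD => -[] h.
by congr EFin; lra.
Qed.

(** Both sides are finite measures in [B], so it is enough to compare them on the half-lines []y,
    +oo[]. There the condition [u < x] replaces [y] by the maximum of [y] and 0, and the claim is
    the functional equation of the exponential. *)
Lemma expo_shift (u : R) (B : set R) : (0 <= u)%R -> measurable B ->
  expo [set x | u < x /\ B (x - u)]%R = (expR (- u))%:E * expo (`]0%R, +oo[ `&` B).
Proof.
move=> u0 mB.
have mshift : measurable_fun setT (fun x : R => x - u)%R.
  by apply: measurable_funB.
have m0 : measurable (`]0%R, +oo[ : set R) by [].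
have eu0 : (0 <= expR (- u))%R by exact: expR_ge0.
pose m1 : {measure set R -> \bar R} :=
  mrestr (distribution expo (mfun_of mshift)) m0.
pose m2 : {measure set R -> \bar R} :=
  mscale (NngNum eu0) (mrestr expo m0).
suff -> : expo [set x | u < x /\ B (x - u)]%R = m1 B.
  transitivity (m2 B); last by rewrite /m2 /= /mscale /= /mrestr setIC.
  apply: (measure_unique (@RGenOInfty.G R) (fun n => `](- n%:R)%R, +oo[)) => //.
  - exact: RGenOInfty.measurableE.
  - move=> _ _ [x ->] [y ->]; exists (Num.max x y).
    apply/seteqP; split=> z /=; rewrite !in_itv/= !andbT gt_max.
      by move=> [-> ->].
    by move/andP.
  - by move=> n; exists (- n%:R)%R.
  - apply/seteqP; split => // x _; exists (Num.bound `|- x|%R) => //=.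
    rewrite in_itv/= andbT ltrNl; apply: (le_lt_trans (ler_norm _)).
    by apply: archi_boundP.
  - move=> _ [x ->].
    rewrite /m1 /m2 /= /mscale/= /mrestr /distribution /pushforward /=.
    have I x' y : (`]x', +oo[ `&` `]y, +oo[ = `](Num.max x' y), +oo[ :> set R).
      apply/seteqP; split=> z /=; rewrite !in_itv/= !andbT gt_max.
        by move=> [-> ->].
      by move/andP.
    rewrite I; set a := Num.max x 0%R.
    have a0 : (0 <= a)%R by rewrite le_max lexx orbT.
    rewrite (_ : _ @^-1` _ = `](u + a)%R, +oo[); last first.
      by apply/seteqP; split => z /=; rewrite !in_itv/= !andbT ltrBrDl.
    by rewrite !expo_itv_ge0 ?addr_ge0// -EFinM -expRD opprD.
  - move=> k; apply: (@le_lt_trans _ _ 1); last by rewrite ltry.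
    by rewrite /m1 /mrestr; apply: probability_le1; exact: measurableI.
rewrite /m1 /= /mrestr /distribution /pushforward /=; congr expo.
by apply/seteqP; split=> x /=; rewrite in_itv/= andbT subr_gt0 => -[].
Qed.

Lemma expo_itv_setI (B : set R) : measurable B -> expo (`]0%R, +oo[ `&` B) = expo B.
Proof.
move=> mB; have m0 : measurable (`]0%R, +oo[ : set R) by [].
have e1 : expo `]0%R, +oo[ = 1 by rewrite expo_itv_ge0// oppr0 expR0.
have mC : measurable (~` `]0%R, +oo[ : set R) by exact: measurableC.
rewrite [RHS](measureDI expo mB m0) setIC [X in X + _](_ : _ = 0) ?add0e//.
apply/eqP; rewrite eq_le measure_ge0 andbT.
apply: (@le_trans _ _ (expo (~` `]0%R, +oo[))).
  by apply: le_measure; rewrite ?inE; [exact: measurableD|exact: mC|move=> x []].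
by rewrite probability_setC//= e1 subee.
Qed.

Lemma expo_memoryless (u : R) (B : set R) : (0 <= u)%R -> measurable B ->
  expo [set x | u < x /\ B (x - u)]%R = (expR (- u))%:E * expo B.
Proof. by move=> u0 mB; rewrite expo_shift// expo_itv_setI. Qed.

(** The law is defined by integrating a density over sets. To pass to integrals of functions, the
    Radon-Nikodym derivative is used for the change of variables and then identified almost
    everywhere with [exponential_pdf]. *)
Let integral_expo_density (f : R -> \bar R) : (forall x, 0 <= f x) ->
  measurable_fun setT f ->
  \int[expo]_x f x =
  \int[lebesgue_measure]_x (f x * (exponential_pdf 1 x)%:E).
Proof.
move=> f0 mf.
have dom : expo_measureTypeR `<< (@lebesgue_measure R).
  apply/null_content_dominatesP => A mA A0.
  by rewrite /= /exponential_prob; apply: null_set_integral => //;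
    apply/measurable_EFinP/measurable_funTS; exact: measurable_exponential_pdf.
have mpdf : measurable_fun setT (fun x : measurableTypeR R => (exponential_pdf 1 x)%:E).
  by apply/measurable_EFinP; exact: measurable_exponential_pdf.
have iRN := Radon_Nikodym_SigmaFinite.f_integrable dom.
have mRN := measurable_int _ iRN.
have mid : measurable_fun setT (idfun : measurableTypeR R -> R).
  by move=> _ B mB; rewrite setTI.
transitivity (\int[distribution expo_measureTypeR (mfun_of mid)]_x f x).
  by apply: eq_measure_integral.
rewrite ge0_integral_pushforward// preimage_setT.
rewrite -(Radon_Nikodym_SigmaFinite.change_of_variables dom)//.
apply: ge0_ae_eq_integral => //.
- exact: emeasurable_funM.
- exact: emeasurable_funM.
- by move=> x _; rewrite mule_ge0// Radon_Nikodym_SigmaFinite.f_ge0.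
- by move=> x _; rewrite mule_ge0// lee_fin exponential_pdf_ge0.
have : ae_eq lebesgue_measure setT (Radon_Nikodym_SigmaFinite.f expo_measureTypeR lebesgue_measure)
   (fun x : measurableTypeR R => (exponential_pdf 1 x)%:E).
  apply: integral_ae_eq => //.
  by move=> E _ mE; rewrite -Radon_Nikodym_SigmaFinite.f_integral.
by apply: filterS => x /= h /h ->.
Qed.

(** Exponential tilting: multiplied by exp(-c x), the density of rate 1 becomes 1/(1+c) times the
    density of rate 1+c, which has integral 1. *)
Lemma integral_expo_expR (c : R) : (0 <= c)%R ->
  \int[expo]_x (expR (- (c * x)))%:E = ((1 + c)^-1)%:E.
Proof.
move=> c0; have c1 : (0 < 1 + c)%R by rewrite ltr_pwDl.
rewrite integral_expo_density; last 2 first.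
- by move=> x; rewrite lee_fin expR_ge0.
- apply/measurable_EFinP; apply: measurableT_comp => //.
  by apply: measurableT_comp => //; apply: measurable_funM.
transitivity (\int[lebesgue_measure]_x ((1 + c)^-1%:E * (exponential_pdf (1 + c) x)%:E)).
  apply: eq_integral => x _; rewrite -!EFinM; congr EFin.
  have [x0|x0] := ltP x 0%R; first by rewrite !lt0_exponential_pdf// !mulr0.
  rewrite !exponential_pdfE// mul1r [RHS]mulrA mulVf ?gt_eqF// !mul1r -expRD.
  by congr expR; ring.
rewrite ge0_integralZl//.
- by rewrite integral_exponential_pdf// mule1.
- by apply/measurable_EFinP; exact: measurable_exponential_pdf.
- by move=> x _; rewrite lee_fin exponential_pdf_ge0// ltW.
- by rewrite lee_fin invr_ge0 ltW.
Qed.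

End ExponentialLaw.

(** * The product sigma-algebra and i.i.d. laws on configurations *)

Section Configurations.
Context {R : realType}.
Local Open Scope classical_set_scope.
Local Open Scope ereal_scope.

Definition cylinder (I : eqType) (s : seq I) (B : I -> set R) : set (I -> R) :=
  [set x | forall i, i \in s -> B i (x i)].

Definition cylinders (I : eqType) : set (set (I -> R)) :=
  [set A | exists s B, (forall i, measurable (B i)) /\ A = cylinder s B].

(** A named copy of the function type, so that the sigma-algebra generated by the cylinders can be
    attached to it as a canonical structure. *)
Definition config (I : Type) : Type := I -> R.

HB.instance Definition _ (I : Type) := gen_eqMixin (config I).
HB.instance Definition _ (I : Type) := gen_choiceMixin (config I).
HB.instance Definition _ (I : Type) := isPointed.Build (config I) (fun=> 0%R).

Let sigma_cylindersC (I : eqType) (A : set (config I)) :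
  <<s @cylinders I >> A -> <<s @cylinders I >> (~` A).
Proof. by move=> sA; rewrite -setTD; exact: sigma_algebraCD. Qed.

HB.instance Definition _ (I : eqType) :=
  @isMeasurable.Build (sigma_display (@cylinders I)) (config I)
    <<s @cylinders I >> (@sigma_algebra0 _ setT _) (@sigma_cylindersC I)
    (@sigma_algebra_bigcup _ setT _).

Definition iid_law (I : eqType) (M : set (config I) -> \bar R) :=
  forall s B, uniq s -> (forall i, measurable (B i)) ->
    M (cylinder s B) = \prod_(i <- s) expo (B i).

Lemma cylinders_setI (I : eqType) : setI_closed (@cylinders I).
Proof.
move=> _ _ [s [B [mB ->]]] [s' [B' [mB' ->]]].
exists (s ++ s'), (fun i => (if i \in s then B i else setT) `&`
                            (if i \in s' then B' i else setT)); split.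
  by move=> i; apply: measurableI; case: ifP.
apply/seteqP; split=> x /=.
  move=> [h h'] i; rewrite mem_cat => _.
  by split; case: ifP => // si; [apply: h|apply: h'].
move=> h; split=> i si; have := h i; rewrite mem_cat si ?orbT => /(_ isT)[].
  by [].
by [].
Qed.

Lemma cylinder_undup (I : eqType) s (B : I -> set R) :
  cylinder (undup s) B = cylinder s B.
Proof.
by apply/seteqP; split=> x /= h i; have := h i; rewrite mem_undup.
Qed.

Lemma measurable_cylinder (I : eqType) s (B : I -> set R) :
  (forall i, measurable (B i)) -> measurable (cylinder s B : set (config I)).
Proof. by move=> mB; apply: sub_sigma_algebra; exists s, B. Qed.

Lemma measurable_coord (I : eqType) (i : I) :
  measurable_fun setT (fun x : config I => x i).
Proof.
move=> _ B mB; rewrite setTI.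
rewrite (_ : _ @^-1` _ = cylinder [:: i] (fun=> B)); last first.
  by apply/seteqP; split=> x /=; [move=> ? j; rewrite inE => /eqP->|apply; rewrite inE].
exact: measurable_cylinder.
Qed.

Lemma measurable_to_config d (T : measurableType d) (I : eqType)
    (f : T -> config I) :
  (forall i, measurable_fun setT (fun t => f t i)) -> measurable_fun setT f.
Proof.
move=> mf; apply: (@measurability _ _ _ (config I) _ _ (@cylinders I)) => //.
move=> _ [_ [s [B [mB ->]]] <-]; rewrite setTI.
rewrite (_ : _ @^-1` _ = \bigcap_(i in [set` s]) ((fun t => f t i) @^-1` B i)).
  apply: fin_bigcap_measurable; first exact: finite_seq.
  by move=> i _; rewrite -[X in measurable X]setTI; exact: mf.
by apply/seteqP; split => x /= h i; exact: h.
Qed.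

Lemma cylinderT (I : eqType) : cylinder [::] (fun=> setT) = [set: I -> R].
Proof. by apply/seteqP; split=> // x _ i; rewrite in_nil. Qed.

Lemma cylinder_measure_unique (I : eqType)
    (M1 M2 : {measure set (config I) -> \bar R}) :
  (forall s B, uniq s -> (forall i, measurable (B i)) ->
     M1 (cylinder s B) = M2 (cylinder s B)) ->
  M1 setT < +oo -> forall A, measurable A -> M1 A = M2 A.
Proof.
move=> h foo A mA.
apply: (@measure_unique _ _ (config I) (@cylinders I) (fun=> setT)) => //.
- exact: cylinders_setI.
- by move=> _; exists [::], (fun=> setT); rewrite cylinderT.
- by apply/seteqP; split => // x _; exists 0%N.
- move=> _ [s [B [mB ->]]]; rewrite -cylinder_undup.
  by rewrite h ?undup_uniq.
Qed.

Lemma iid_law_comp (I J : eqType) (phi : J -> I) (M : set (config I) -> \bar R) :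
  injective phi -> iid_law M ->
  iid_law (pushforward M (fun x : config I => (x \o phi : config J))).
Proof.
move=> phi_inj hM s B us mB; rewrite /pushforward.
(* [phi] comes without an inverse on its image, so the side belonging to [phi j] is found by its
   place in the list; the default is the whole line. *)
pose B' i := nth setT (map B s) (index i (map phi s)).
have B'E j : j \in s -> B' (phi j) = B j.
  by move=> js; rewrite /B' index_map// (nth_map j) ?index_mem// nth_index.
have mB' i : measurable (B' i).
  have [h|h] := ltnP (index i (map phi s)) (size (map B s)).
    have /mapP[j _ e] : B' i \in map B s by apply: mem_nth.
    by rewrite e.
  by rewrite /B' nth_default.
rewrite (_ : _ @^-1` _ = cylinder (map phi s) B').
  rewrite hM ?map_inj_uniq// big_map !big_seq; apply: eq_bigr => j js.
  by rewrite B'E.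
apply/seteqP; split=> x /= h.
  by move=> _ /mapP[j js ->]; rewrite B'E//; exact: h.
by move=> j js; have := h (phi j); rewrite map_f// B'E//; exact.
Qed.

Definition config_of (I : eqType) d (T : measurableType d) (P : probability T R)
  (X : I -> {RV P >-> R}) (w : T) : config I := fun i => X i w.

Lemma measurable_config_of (I : eqType) d (T : measurableType d)
  (P : probability T R) (X : I -> {RV P >-> R}) :
  measurable_fun setT (config_of X).
Proof. by apply: measurable_to_config => i; exact: measurable_funPT. Qed.

Lemma iid_law_of (I : eqType) d (T : measurableType d)
  (P : probability T R) (X : I -> {RV P >-> R}) :
  iid_exponential X -> iid_law (pushforward P (config_of X)).
Proof.
move=> [eX iX] s B us mB; rewrite /pushforward.
rewrite (_ : _ @^-1` _ = \bigcap_(i in [set` s]) (X i @^-1` B i)).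
  by rewrite iX//; apply: eq_bigr => i _; exact: eX.
by apply/seteqP; split => x /= h i; exact: h.
Qed.

End Configurations.

(** * Memorylessness and the first ring among independent clocks *)

Section Clocks.
Context {R : realType} {K : finType}.
Local Open Scope classical_set_scope.
Local Open Scope ereal_scope.

Local Notation S := (@config R (K * nat)%type).

Definition refresh (k : K) (x : S) : S := fun p => x (p.1, p.2 + (p.1 == k))%N.

Definition age (A : {set K}) (u : R) (x : S) : S :=
  fun p => (if (p.1 \in A) && (p.2 == 0%N) then x p - u else x p)%R.

(* [x (k, 0)] is the time left until the next ring of the clock [k], and
   [x (k, r.+1)] are its further waiting times. [advance A k] moves to the moment
   at which [k] rings, while only the clocks in [A] are running. *)
Definition advance (A : {set K}) (k : K) (x : S) : S :=
  age (A :\ k) (x (k, 0%N)) (refresh k x).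

Definition later (A : {set K}) (u : R) (x : S) : bool :=
  [forall l in A, u < x (l, 0%N)]%R.

Definition rings_first (A : {set K}) (k : K) (x : S) : bool :=
  (0 < x (k, 0%N))%R && later (A :\ k) (x (k, 0%N)) x.

Lemma measurable_refresh k : measurable_fun setT (refresh k).
Proof. by apply: measurable_to_config => p; exact: measurable_coord. Qed.

Lemma measurable_age2 A :
  measurable_fun setT (fun z : R * S => age A z.1 z.2).
Proof.
apply: measurable_to_config => p; rewrite /age.
have mp : measurable_fun setT (fun z : R * S => z.2 p).
  by apply: (measurableT_comp (measurable_coord p)).
by case: (_ && _) => //; apply: measurable_funB.
Qed.

Lemma measurable_age A u : measurable_fun setT (age A u).
Proof.
apply: measurable_to_config => p; rewrite /age.
by case: (_ && _); [apply: measurable_funB => //|]; exact: measurable_coord.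
Qed.

Lemma measurable_later2 A :
  measurable_fun setT (fun z : R * S => later A z.1 z.2).
Proof.
rewrite (_ : (fun _ => _) =
  fun z : R * S => all (fun l => (z.1 < z.2 (l, 0%N))%R) (enum A)); last first.
  apply/funext => z; apply/forall_inP/allP => h l; have := h l;
    by rewrite mem_enum.
elim: (enum A) => [|l s IH] /=; first exact: measurable_cst.
apply: measurable_and => //; apply: measurable_fun_ltr => //.
exact: (measurableT_comp (measurable_coord (l, 0%N))).
Qed.

Lemma measurable_natr_bool d (T : measurableType d) (b : T -> bool) :
  measurable_fun setT b -> measurable_fun setT (fun t => (b t)%:R : R).
Proof.
move=> mb; apply: (@measurableT_comp _ _ _ _ _ _ (fun c : bool => c%:R : R)) => //.
Qed.

Lemma measurable_advance A k : measurable_fun setT (advance A k).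
Proof.
apply: (@measurableT_comp _ _ _ _ _ _ (fun z : R * S => age (A :\ k) z.1 z.2)
  _ (fun x : S => (x (k, 0%N), refresh k x))).
  exact: measurable_age2.
by apply: measurable_fun_pair; [exact: measurable_coord|exact: measurable_refresh].
Qed.

Lemma measurable_rings_first A k : measurable_fun setT (rings_first A k).
Proof.
apply: measurable_and.
  by apply: measurable_fun_ltr => //; exact: measurable_coord.
apply: (@measurableT_comp _ _ _ _ _ _ (fun z : R * S => later (A :\ k) z.1 z.2)
  _ (fun x : S => (x (k, 0%N), x))).
  exact: measurable_later2.
by apply: measurable_fun_pair => //; exact: measurable_coord.
Qed.

Let shift_index (k : K) (p : K * nat) : K * nat := (p.1, p.2 + (p.1 == k))%N.

Let shift_index_inj k : injective (shift_index k).
Proof.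
move=> [a i] [b j] [->]; rewrite /= => /eqP; rewrite eqn_add2r.
by move/eqP => ->.
Qed.

Variables (M : probability S R) (iidM : iid_law M).

(** [refresh k] reads the coordinates in the image of [shift_index k], which is injective and misses
    [(k, 0)]. The two conditions thus concern disjoint sets of coordinates, and the refreshed
    configuration is again i.i.d. *)
Lemma clock_independent_refresh (k : K) (D : set R) (s : seq (K * nat)) B :
  measurable D -> uniq s -> (forall i, measurable (B i)) ->
  M [set x | D (x (k, 0%N)) /\ cylinder s B (refresh k x)] =
  expo D * M (cylinder s B).
Proof.
move=> mD us mB; rewrite [in RHS]iidM//.
pose B' i := if i == (k, 0%N) then D else
  nth setT (map B s) (index i (map (shift_index k) s)).
have k0 j : (shift_index k j == (k, 0%N)) = false.
  apply/negbTE/eqP => -[->]; rewrite eqxx addn1.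
  by [].
have B'E j : j \in s -> B' (shift_index k j) = B j.
  move=> js; rewrite /B' k0 index_map; last exact: shift_index_inj.
  by rewrite (nth_map j) ?index_mem// nth_index.
have mB' i : measurable (B' i).
  rewrite /B'; case: ifP => // _.
  set m := index _ _; have [h|h] := ltnP m (size (map B s)).
    by have /mapP[j _ ->] := mem_nth setT h.
  by rewrite nth_default.
have kn : (k, 0%N) \notin map (shift_index k) s.
  by apply/mapP => -[j _ /esym/eqP]; rewrite k0.
transitivity (M (cylinder ((k, 0%N) :: map (shift_index k) s) B')).
  congr (M _); apply/seteqP; split=> x /=.
    move=> [Dx h] i; rewrite inE => /predU1P[->|/mapP[j js ->]].
      by rewrite /B' eqxx.
    by rewrite B'E//; exact: h.
  move=> h; split; first by have := h (k, 0%N); rewrite inE eqxx /B' eqxx; exact.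
  move=> j js; have := h (shift_index k j).
  by rewrite inE map_f ?orbT// B'E//; exact.
rewrite iidM//=; last by rewrite kn map_inj_uniq//; exact: shift_index_inj.
rewrite big_cons /B' eqxx; congr (_ * _).
by rewrite big_map !big_seq; apply: eq_bigr => j js; rewrite -/(B' _) B'E.
Qed.

Let clock_and_refresh k (x : S) : R * S := (x (k, 0%N), refresh k x).

Let measurable_clock_and_refresh k : measurable_fun setT (clock_and_refresh k).
Proof.
by apply: measurable_fun_pair; [exact: measurable_coord|exact: measurable_refresh].
Qed.

(** Two uniqueness arguments extend the previous lemma: from cylinders to all measurable sets of
    configurations, with the condition on the clock fixed, and from rectangles to all measurable
    sets of the product. *)
Lemma law_clock_and_refresh k (X : set (R * S)) : measurable X ->
  M (clock_and_refresh k @^-1` X) = (expo \x M) X.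
Proof.
move=> mX.
rewrite (@product_measure_unique _ _ _ _ _ expo M
  (distribution M (mfun_of (measurable_clock_and_refresh k))))//.
move=> D B mD mB.
have mD' : measurable [set x : S | D (x (k, 0%N))].
  by rewrite -[X in measurable X]setTI; exact: measurable_coord.
have fD : (0 <= fine (expo D))%R by exact: fine_ge0.
have expoD : (fine (expo D))%:E = expo D by rewrite fineK// fin_num_measure.
transitivity (image_measure (mrestr M mD') (measurable_refresh k) B).
  rewrite /= /distribution /pushforward/= /mrestr; congr (M _).
  by apply/seteqP; split=> x /= [].
transitivity (mscale (NngNum fD) M B); last by rewrite /= /mscale/= expoD.
apply: cylinder_measure_unique => //.
  move=> s C us mC; rewrite /= /mscale/= expoD -(clock_independent_refresh k mD us mC).
  by congr (M _); apply/seteqP; split=> x /= [].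
apply: (@le_lt_trans _ _ 1); last by rewrite ltry.
by rewrite /= /pushforward /mrestr preimage_setT setTI; exact: probability_le1.
Qed.

Lemma measurable_laterP A u : measurable [set x : S | later A u x].
Proof.
rewrite -[X in measurable X]setTI.
have : measurable_fun setT (fun x : S => later A u x).
  apply: (@measurableT_comp _ _ _ _ _ _ (fun z : R * S => later A z.1 z.2)
    _ (fun x : S => (u, x))); first exact: measurable_later2.
  by apply: measurable_fun_pair.
by move=> /(_ measurableT [set true] I).
Qed.

(** Each clock in [A] survives the time [u] with probability exp(-u) and is then as good as new,
    independently of the others. On cylinders this is a product of one-dimensional instances of
    [expo_memoryless]; the general case follows by uniqueness. *)
Lemma age_memoryless (A : {set K}) (u : R) (B : set S) : (0 <= u)%R ->
  measurable B ->
  M [set x | later A u x /\ B (age A u x)] =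
  (expR (- (#|A|%:R * u)))%:E * M B.
Proof.
move=> u0 mB.
have ge0 : (0 <= expR (- (#|A|%:R * u)))%R by exact: expR_ge0.
transitivity (image_measure (mrestr M (measurable_laterP A u))
    (measurable_age A u) B).
  by congr (M _); apply/seteqP; split=> x /= [].
transitivity (mscale (NngNum ge0) M B); last by rewrite /= /mscale.
apply: cylinder_measure_unique => //; last first.
  apply: (@le_lt_trans _ _ 1); last by rewrite ltry.
  rewrite /= /pushforward /mrestr preimage_setT setTI.
  by apply: probability_le1; exact: measurable_laterP.
move=> s C us mC; rewrite /= /mscale/=.
pose P (i : K * nat) := (i.1 \in A) && (i.2 == 0%N).
(* Adding the coordinates [(l, 0)] for all [l] in [A], with the whole line as their side in [C'],
   turns the event [later A u] into part of a cylinder. *)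
pose s' := undup (s ++ [seq (l, 0%N) | l <- enum A]).
pose C' i := if i \in s then C i else setT.
have us' : uniq s' by exact: undup_uniq.
have mC' i : measurable (C' i) by rewrite /C'; case: ifP.
pose D i := if P i then [set y | u < y /\ C' i (y - u)]%R else C' i.
have mD i : measurable (D i).
  rewrite /D; case: ifP => // _.
  rewrite (_ : [set _ | _] = `]u, +oo[ `&` (fun y => y - u)%R @^-1` C' i); last first.
    by apply/seteqP; split=> y /=; rewrite in_itv/= andbT.
  apply: measurableI => //; rewrite -[X in measurable X]setTI.
  have mf : measurable_fun setT (fun y : R => y - u)%R by apply: measurable_funB.
  exact: mf.
have -> : M (cylinder s C) = M (cylinder s' C').
  congr (M _); apply/seteqP; split=> x /= h i.
    by rewrite /C'; case: ifPn => // si _; exact: h.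
  move=> si; have := h i; rewrite mem_undup mem_cat si /C' si; exact.
have -> : pushforward (mrestr M (measurable_laterP A u)) (age A u)
    (cylinder s C) = M (cylinder s' D).
  congr (M _); apply/seteqP; split=> x /=.
    move=> [h /forall_inP l] i _; rewrite /D /P /C'.
    case: i => a r /=; case: ifPn => [/andP[aA /eqP ->]|Pi].
      split; first exact: l.
      by case: ifPn => // /h; rewrite /age /= aA eqxx.
    by case: ifPn => // /h; rewrite /age /= (negbTE Pi).
  move=> h; split.
    move=> i si; have := h i; rewrite mem_undup mem_cat si => /(_ isT).
    by rewrite /D /age -/(P i); case: ifPn => _ ; rewrite /C' si // => -[].
  apply/forall_inP => l lA; have := h (l, 0%N).
  rewrite mem_undup mem_cat map_f ?mem_enum ?orbT// => /(_ isT).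
  by rewrite /D /P /= lA => -[].
rewrite !iidM//.
have DE i : expo (D i) = (if P i then expR (- u) else 1%R)%:E * expo (C' i).
  by rewrite /D; case: ifPn => _; rewrite ?mul1e// expo_memoryless.
under eq_bigr do rewrite DE.
rewrite big_split /=; congr (_ * _).
rewrite prodEFin; congr EFin; rewrite -big_mkcond/= -big_filter.
rewrite (perm_big [seq (l, 0%N) | l <- enum A])/=; last first.
  apply: uniq_perm; first exact: filter_uniq.
    by rewrite map_inj_uniq ?enum_uniq// => a b [].
  move=> [a r]; rewrite mem_filter mem_undup mem_cat /P /=.
  apply/idP/idP.
    by move=> /andP[/andP[aA /eqP ->] _]; rewrite map_f// mem_enum.
  move=> h; rewrite h orbT andbT; move/mapP: h => [l].
  by rewrite mem_enum => lA [-> ->]; rewrite lA.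
rewrite big_map big_enum/= prodr_const -expRM_natl; congr expR.
by rewrite mulrN.
Qed.

(** The Markov property at the first ring. Conditionally on the ring time u of [k], the other clocks
    of [A] survive with probability exp(-(#|A|-1) u) and the advanced configuration has law [M]
    again. Integrating exp(-(#|A|-1+y) u) against the exponential law gives 1/(#|A|+y). *)
Lemma integral_rings_first (A : {set K}) (k : K) (y : R) (Phi : S -> \bar R) :
  k \in A -> (0 <= y)%R -> measurable_fun setT Phi -> (forall x, 0 <= Phi x) ->
  \int[M]_x (((rings_first A k x)%:R * expR (- (y * x (k, 0%N))))%:E
             * Phi (advance A k x)) =
  ((#|A|%:R + y)^-1)%:E * \int[M]_x Phi x.
Proof.
move=> kA y0 mPhi Phi0.
pose w (z : R * S) : \bar R :=
  (((0 < z.1)%R && later (A :\ k) z.1 z.2)%:R * expR (- (y * z.1)))%:E.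
pose F (z : R * S) : \bar R := w z * Phi (age (A :\ k) z.1 z.2).
have F0 z : 0 <= F z.
  by rewrite mule_ge0// lee_fin mulr_ge0 ?expR_ge0.
have mF : measurable_fun setT F.
  apply: emeasurable_funM; last first.
    by apply: (measurableT_comp mPhi); exact: measurable_age2.
  apply/measurable_EFinP; apply: measurable_funM.
    apply: measurable_natr_bool; apply: measurable_and.
      by apply: measurable_fun_ltr.
    exact: measurable_later2.
  apply: measurableT_comp => //; apply: measurableT_comp => //.
  by apply: measurable_funM.
transitivity (\int[M]_x (F \o clock_and_refresh k) x).
  apply: eq_integral => x _; congr (_ * _).
  congr (((_ && _)%:R * _)%:E); apply: eq_forallb_in => l /setD1P[lk _].
  by rewrite /clock_and_refresh /refresh /= (negbTE lk).
transitivity (\int[distribution M (mfun_of (measurable_clock_and_refresh k))]_z F z).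
  by rewrite ge0_integral_pushforward// preimage_setT.
transitivity (\int[expo \x M]_z F z).
  by apply: eq_measure_integral => X mX _; exact: law_clock_and_refresh.
rewrite fubini_tonelli1//.
pose a : R := (#|A|.-1%:R + y)%R.
have cA : #|A :\ k| = #|A|.-1 by rewrite (cardsD1 k A) kA.
have fE (u : R) : (0 < u)%R -> fubini_F M F u = (expR (- (a * u)))%:E * \int[M]_x Phi x.
  move=> u0; rewrite /fubini_F /F.
  pose m1 := image_measure (mrestr M (measurable_laterP (A :\ k) u))
    (measurable_age (A :\ k) u).
  have ge0 : (0 <= expR (- (#|A|.-1%:R * u)))%R by exact: expR_ge0.
  have -> : expR (- (a * u)) =
      (expR (- (y * u)) * expR (- (#|A|.-1%:R * u)))%R.
    by rewrite -expRD /a; congr expR; ring.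
  rewrite EFinM -muleA -(ge0_integral_mscale _ measurableT (NngNum ge0))//.
  rewrite [X in _ * X](eq_measure_integral m1); last first.
    move=> X mX _; have := age_memoryless (A :\ k) (ltW u0) mX.
    rewrite cA /= /mscale /= => <-; rewrite /pushforward /mrestr.
    by congr (M _); apply/seteqP; split=> x /= [].
  rewrite /m1 ge0_integral_pushforward//; last exact: measurable_age.
  have mPu : measurable_fun setT (Phi \o age (A :\ k) u).
    by apply: measurableT_comp => //; exact: measurable_age.
  have mDu := measurable_laterP (A :\ k) u.
  have Pu0 x : 0 <= (Phi \o age (A :\ k) u) x by exact: Phi0.
  rewrite preimage_setT ge0_integral_mrestr//.
  rewrite -ge0_integralZl//; last exact: measurable_funTS.
  rewrite [RHS]integral_mkcond.
  apply: eq_integral => x _; rewrite /w /= u0 /= patchE.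
  case: ifPn; first by rewrite inE/= => ->; rewrite mul1r.
  by rewrite notin_setE/= => /negP/negbTE->; rewrite mul0r mul0e.
have m0 : measurable (`]0%R, +oo[ : set R) by [].
have E0 : expo (~` `]0%R, +oo[ : set R) = 0.
  by rewrite probability_setC//= expo_itv_ge0// oppr0 expR0 subee.
(* [fE] covers only positive [u]; the remaining half-line is null for [expo]. *)
transitivity (\int[expo]_u ((expR (- (a * u)))%:E * \int[M]_x Phi x)).
  apply: ge0_ae_eq_integral => //.
  - exact: measurable_fun_fubini_tonelli_F.
  - apply: emeasurable_funM => //; apply/measurable_EFinP.
    by apply: measurableT_comp => //; apply: measurableT_comp => //;
      apply: measurable_funM.
  - by move=> u _; apply: integral_ge0.
  - by move=> u _; rewrite mule_ge0 ?lee_fin ?expR_ge0// integral_ge0.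
  exists (~` `]0%R, +oo[); split=> //; first exact: measurableC.
  move=> u /= h; rewrite in_itv/= andbT => u0; apply: h => _.
  exact: fE.
rewrite ge0_integralZr//; last 2 first.
- by apply/measurable_EFinP; apply: measurableT_comp => //;
    apply: measurableT_comp => //; apply: measurable_funM.
- exact: integral_ge0.
have A0 : (0 < #|A|)%N by apply/card_gt0P; exists k.
rewrite integral_expo_expR ?addr_ge0//; congr (_^-1%:E * _).
by rewrite /a -[in RHS](prednK A0) -[in RHS]add1n natrD addrA.
Qed.

End Clocks.

(** * Markov chains driven by clocks *)

Lemma cvg_sumr (R : realType) (I : eqType) (r : seq I) (P : pred I)
    (u : I -> nat -> R) (l : I -> R) :
  (forall i, i \in r -> P i -> (u i m @[m --> \oo] --> l i)%classic) ->
  (\sum_(i <- r | P i) u i m @[m --> \oo] --> \sum_(i <- r | P i) l i)%classic.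
Proof.
elim: r => [|i r IH] h.
  under eq_fun do rewrite big_nil.
  by rewrite big_nil; exact: cvg_cst.
have {}IH : (\sum_(i <- r | P i) u i m @[m --> \oo] --> \sum_(i <- r | P i) l i)%classic.
  by apply: IH => j jr; apply: h; rewrite inE jr orbT.
rewrite big_cons; under eq_fun do rewrite big_cons.
case: ifPn => // Pi; apply: cvgD => //.
by apply: h => //; rewrite inE eqxx.
Qed.

Section Runs.
Context {R : realType} {K : finType} {St : Type}.
(* In the state [s] the clocks in [active s] are running, but only the rings of
   those in [effective s] change the state. *)
Variables (active effective : St -> {set K}) (jump : St -> K -> St).
Variable rk : St -> nat.
Hypothesis effective_active : forall s, effective s \subset active s.
Hypothesis jump_ineffective : forall s k,
  k \in active s -> k \notin effective s -> jump s k = s.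
Hypothesis rk_jump : forall s k, k \in effective s -> (rk (jump s k)).+1 = rk s.
Hypothesis rk_eq0 : forall s, (rk s == 0%N) = (effective s == finset.set0).

Local Notation S := (@config R (K * nat)%type).

Fixpoint complete_word (s : St) (w : seq K) : bool :=
  if w is k :: w' then (k \in effective s) && complete_word (jump s k) w'
  else effective s == finset.set0.

Fixpoint words_of_length (r : nat) (s : St) : seq (seq K) :=
  if r is r'.+1 then
    [seq k :: w | k <- enum (effective s), w <- words_of_length r' (jump s k)]
  else [:: [::]].

Definition words (s : St) : seq (seq K) := words_of_length (rk s) s.

Lemma mem_words s w : (w \in words s) = complete_word s w.
Proof.
rewrite /words; move: {2}(rk s) (erefl (rk s)) => r.
elim: r s w => [|r IH] s w rs; rewrite rs.
  have /eqP E0 : effective s == finset.set0 by rewrite -rk_eq0 rs.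
  by case: w => [|k w] /=; rewrite E0 ?eqxx// !inE.
have En0 : effective s == finset.set0 = false by rewrite -rk_eq0 rs.
apply/allpairsPdep/idP => [[k [w' [kE w'r ->]]]|] /=.
  rewrite mem_enum in kE; rewrite kE /=.
  have rk' : rk (jump s k) = r by have := rk_jump kE; rewrite rs => -[].
  by rewrite -IH// rk'.
case: w => [|k w] /=; first by rewrite En0.
move=> /andP[kE cw]; exists k, w; rewrite mem_enum kE; split => //.
have rk' : rk (jump s k) = r by have := rk_jump kE; rewrite rs => -[].
by move: cw; rewrite -IH// rk'.
Qed.

Lemma size_complete_word s w : complete_word s w -> size w = rk s.
Proof.
elim: w s => [|k w IH] s /=; first by rewrite -rk_eq0 => /eqP ->.
by move=> /andP[/rk_jump <- /IH ->].
Qed.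

Lemma words_uniq s : uniq (words s).
Proof.
rewrite /words; move: (rk s) => r; elim: r s => [|r IH] s //=.
apply: allpairs_uniq_dep => //; first exact: enum_uniq.
by move=> [k w] [k' w'] /= _ _ [-> ->].
Qed.

Definition word_weight (s : St) (w : seq K) (z : nat -> R) : R :=
  \prod_(j < size w) (z j + #|effective (foldl jump s (take j w))|%:R)^-1.

Lemma word_weight_cons s k w z :
  word_weight s (k :: w) z =
  (z 0%N + #|effective s|%:R)^-1 * word_weight (jump s k) w (fun j => z j.+1).
Proof. by rewrite /word_weight /= big_ord_recl. Qed.

(** At zero discount each factor is the probability of one transition of the jump chain, which
    chooses uniformly among the effective clocks; the weights are therefore the probabilities of the
    complete paths. *)
Lemma sum_word_weight0 s : \sum_(w <- words s) word_weight s w (fun=> 0) = 1.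
Proof.
rewrite /words; move: {2}(rk s) (erefl (rk s)) => r.
elim: r s => [|r IH] s rs; rewrite rs /=.
  by rewrite big_seq1 /word_weight big_ord0.
have En0 : effective s == finset.set0 = false by rewrite -rk_eq0 rs.
rewrite big_allpairs_dep /= big_enum /=.
rewrite (eq_bigr (fun=> (#|effective s|%:R)^-1)); last first.
  move=> k kE; under eq_bigr do rewrite word_weight_cons add0r.
  have rk' : rk (jump s k) = r by have := rk_jump kE; rewrite rs => -[].
  by rewrite -mulr_sumr -[X in words_of_length X]rk' IH ?rk'// mulr1.
rewrite sumr_const -[LHS]mulr_natr mulVf// pnatr_eq0 -lt0n card_gt0.
by rewrite En0.
Qed.

(* The indicator that the effective rings among the first [m] rings begin with
   the word [w], times the discount for the holding times; see
   [path_functionalE] for complete words. *)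
Fixpoint path_functional (m : nat) (s : St) (w : seq K) (z : nat -> R) (x : S)
    : R :=
  if w is e :: w' then
    if m is m'.+1 then
      \sum_(k <- enum (active s))
        (rings_first (active s) k x)%:R * expR (- (z 0%N * x (k, 0%N))) *
        (let x' := advance (active s) k x in
         if k \in effective s then
           if k == e then path_functional m' (jump s k) w' (fun j => z j.+1) x'
           else 0
         else path_functional m' s w z x')
    else 0
  else 1.

(** The first-ring recursion satisfied by the expectation of [path_functional]. An ineffective ring
    leaves [s], [w] and [z] as they are, so the ineffective clocks enter only through their
    number. *)
Fixpoint path_value (m : nat) (s : St) (w : seq K) (z : nat -> R) : R :=
  if w is e :: w' then
    if m is m'.+1 then
      (#|active s|%:R + z 0%N)^-1 *
      ((if e \in effective s
        then path_value m' (jump s e) w' (fun j => z j.+1) else 0) +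
       #|active s :\: effective s|%:R * path_value m' s w z)
    else 0
  else 1.

Lemma path_functional_ge0 m s w z x : 0 <= path_functional m s w z x.
Proof.
elim: m s w z x => [|m IH] s [|e w] z x //=.
rewrite sumr_ge0// => k _; rewrite mulr_ge0 ?mulr_ge0 ?expR_ge0//.
by case: ifP => // _; case: ifP.
Qed.

Lemma measurable_path_functional m s w z :
  measurable_fun setT (path_functional m s w z).
Proof.
elim: m s w z => [|m IH] s [|e w] z //=; try exact: measurable_cst.
apply: measurable_sum => k.
apply: measurable_funM.
  apply: measurable_funM.
    by apply: measurable_natr_bool; exact: measurable_rings_first.
  apply: measurableT_comp => //; apply: measurableT_comp => //.
  by apply: measurable_funM => //; exact: measurable_coord.
case: (k \in effective s); last first.
  by apply: (measurableT_comp (IH _ _ _)); exact: measurable_advance.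
case: (k == e); last exact: measurable_cst.
by apply: (measurableT_comp (IH _ _ _)); exact: measurable_advance.
Qed.

Section Expectation.
Variables (M : probability S R) (iidM : iid_law M).
Local Open Scope ereal_scope.

(** By [integral_rings_first] the configuration after the first ring has the law [M] again, so the
    induction hypothesis applies under the same measure. Effective clocks other than the first
    letter of the word contribute 0. *)
Lemma integral_path_functional m s w z : (forall j, 0 <= z j)%R ->
  \int[M]_x (path_functional m s w z x)%:E = (path_value m s w z)%:E.
Proof.
elim: m s w z => [|m IH] s [|e w] z z0 /=.
- by rewrite integral_cst//= mul1e probability_setT.
- by rewrite integral0.
- by rewrite integral_cst//= mul1e probability_setT.
pose G k x := if k \in effective s then
    if k == e then path_functional m (jump s k) w (fun j => z j.+1) x else 0%R
  else path_functional m s (e :: w) z x.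
have G0 k x : (0 <= G k x)%R.
  by rewrite /G; case: ifP => _; [case: ifP => // _|]; exact: path_functional_ge0.
have mG k : measurable_fun setT (G k).
  rewrite /G; case: (k \in effective s); last exact: measurable_path_functional.
  by case: (k == e) => //; exact: measurable_path_functional.
have IG k : \int[M]_x (G k x)%:E =
  (if k \in effective s then
    if k == e then path_value m (jump s k) w (fun j => z j.+1) else 0%R
  else path_value m s (e :: w) z)%:E.
  rewrite /G; case: (k \in effective s); last exact: IH.
  by case: (k == e); [exact: IH|rewrite integral0].
pose W k (x : S) := ((rings_first (active s) k x)%:R *
   expR (- (z 0%N * x (k, 0%N))))%R.
transitivity (\sum_(k <- enum (active s))
  \int[M]_x ((W k x)%:E * (G k (advance (active s) k x))%:E)).
  rewrite -ge0_integral_sum//; last 2 first.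
  - move=> k; apply/measurable_EFinP; apply: measurable_funM.
      apply: measurable_funM.
        by apply: measurable_natr_bool; exact: measurable_rings_first.
      apply: measurableT_comp => //; apply: measurableT_comp => //.
      by apply: measurable_funM => //; exact: measurable_coord.
    by apply: (measurableT_comp (mG k)); exact: measurable_advance.
  - by move=> k x _; rewrite mule_ge0// lee_fin// mulr_ge0 ?expR_ge0.
  by apply: eq_integral => x _; rewrite sumEFin.
rewrite big_enum/= (eq_bigr (fun k => ((#|active s|%:R + z 0%N)^-1 *
  (if k \in effective s then
    if k == e then path_value m (jump s k) w (fun j => z j.+1) else 0%R
  else path_value m s (e :: w) z))%:E)); last first.
  move=> k kA; rewrite EFinM -IG -(integral_rings_first iidM kA (z0 0%N))//.
    by apply/measurable_EFinP; exact: mG.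
  by move=> x; rewrite lee_fin.
rewrite sumEFin -mulr_sumr; congr ((_ * _)%:E).
rewrite (finset.big_setID (effective s)) /=; congr (_ + _)%R.
  rewrite (finset.setIidPr (effective_active s)).
  under eq_bigr => k kE do rewrite kE.
  rewrite -big_mkcondr /=; case: ifPn => eE.
    rewrite (big_pred1 e)// => k /=; case: (eqVneq k e) => [->|_]; last by rewrite andbF.
    by rewrite eE.
  by rewrite big1// => k /andP[kE /eqP ke]; rewrite -ke kE in eE.
rewrite (eq_bigr (fun=> path_value m s (e :: w) z)); last first.
  by move=> k /setDP[_ /negbTE ->].
by rewrite sumr_const mulr_natl.
Qed.

End Expectation.

Lemma path_value_ge0 m s w z : (forall j, 0 <= z j) -> 0 <= path_value m s w z.
Proof.
elim: m s w z => [|m IH] s [|e w] z z0 //=.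
rewrite mulr_ge0 ?invr_ge0 ?addr_ge0//; last by rewrite mulr_ge0// IH.
by case: ifP => // _; exact: IH.
Qed.

Lemma path_value_nondecreasing m s w z : (forall j, 0 <= z j) ->
  path_value m s w z <= path_value m.+1 s w z.
Proof.
elim: m s w z => [|m IH] s [|e w] z z0 //.
  exact: (path_value_ge0 1).
rewrite [leLHS]/= [leRHS]/=.
rewrite ler_wpM2l ?invr_ge0 ?addr_ge0//.
apply: lerD; last by rewrite ler_wpM2l//; exact: IH.
by case: ifP => // _; exact: IH.
Qed.

Lemma card_active s :
  #|active s| = (#|effective s| + #|active s :\: effective s|)%N.
Proof.
by rewrite cardsD (finset.setIidPr (effective_active s)) subnKC// subset_leq_card.
Qed.

(** Here the ineffective rings disappear. With d effective and b ineffective clocks, the values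
    satisfy u(m+1) = (v(m) + b u(m)) / (d + b + z 0). They increase and are bounded by the fixed
    point [l] = v' / (z 0 + d), where v' is the limit of v; their limit solves the fixed point
    equation, whose solution is unique because d is positive. *)
Lemma cvg_path_value s w z : (forall j, 0 <= z j) -> complete_word s w ->
  (path_value m s w z @[m --> \oo] --> word_weight s w z)%classic.
Proof.
elim: w s z => [|e w IH] s z z0.
  move=> _; rewrite /word_weight big_ord0.
  by rewrite (_ : (fun _ => _) = fun=> 1); [exact: cvg_cst|apply/funext; case].
move=> /= /andP[eE cw].
have {cw IH} := IH _ (fun j => z j.+1) (fun j => z0 j.+1) cw.
rewrite word_weight_cons.
set v := fun m => path_value m (jump s e) w _.
set v' := word_weight (jump s e) w _ => vv'.
set u := fun m => path_value m s (e :: w) z.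
pose a : R := #|active s|%:R; pose b : R := #|active s :\: effective s|%:R.
pose d : R := #|effective s|%:R.
have abd : a = d + b by rewrite /a card_active natrD.
have d0 : 0 < d by rewrite ltr0n; apply/card_gt0P; exists e.
have b0 : 0 <= b by [].
have zz := z0 0%N.
have uS m : u m.+1 = (a + z 0%N)^-1 * (v m + b * u m) by rewrite /u /= eE.
have u0 m : 0 <= u m by exact: path_value_ge0.
have ndv : nondecreasing_seq v.
  by apply/nondecreasing_seqP => m; exact: path_value_nondecreasing.
have vle m : v m <= v'.
  have cv : cvgn v by apply: cvgP vv'.
  by have := nondecreasing_cvgn_le ndv cv m; rewrite (cvg_lim (@Rhausdorff R) vv').
set l := (_^-1 * v'); have lE : l = (a + z 0%N)^-1 * (v' + b * l).
  rewrite /l -/d abd; field; apply/andP; split; apply/lt0r_neq0; lra.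
have ule m : u m <= l.
  elim: m => [|m IHm].
    rewrite /u /= /l mulr_ge0// ?invr_ge0 ?addr_ge0//.
    by apply: le_trans (vle 0%N); exact: path_value_ge0.
  rewrite uS lE ler_wpM2l ?invr_ge0 ?addr_ge0//.
  by rewrite lerD// ler_wpM2l.
have ndu : nondecreasing_seq u.
  by apply/nondecreasing_seqP => m; exact: path_value_nondecreasing.
have cu : cvgn u.
  apply: nondecreasing_is_cvgn => //; exists l => _ [m _ <-]; exact: ule.
have uS_lim : (u m.+1 @[m --> \oo] --> limn u)%classic by rewrite cvg_shiftS.
have : (u m.+1 @[m --> \oo] --> (a + z 0%N)^-1 * (v' + b * limn u))%classic.
  rewrite (_ : (fun _ => _) = fun m => (a + z 0%N)^-1 * (v m + b * u m)); last first.
    by apply/funext => m; rewrite uS.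
  apply: cvgMl_tmp; apply: cvgD => //; exact: cvgMl_tmp.
move=> /(cvg_unique _ uS_lim) => /(_ (@Rhausdorff R)) limE.
suff <- : limn u = l by [].
have az : 0 < a + z 0%N by lra.
have : (a + z 0%N) * limn u = v' + b * limn u.
  by rewrite {1}limE mulrA mulfV ?gt_eqF// mul1r.
rewrite abd => h; rewrite /l -/d.
have dz : z 0%N + d != 0 by apply: lt0r_neq0; lra.
apply: (mulfI dz); rewrite mulrA mulfV// mul1r; lra.
Qed.

(** The time spent until an ineffective ring is credited to the holding time of the next effective
    one. *)
Definition delay (t : R) (p : seq (K * R)) : seq (K * R) :=
  if p is (k, h) :: p' then (k, t + h) :: p' else [::].

(* The effective rings and the times between them; [m] bounds the number of all
   rings, and the result is [None] if they do not suffice or if at some step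
   no clock rings strictly first. *)
Fixpoint run (m : nat) (s : St) (x : S) : option (seq (K * R)) :=
  if effective s == finset.set0 then Some [::] else
  if m is m'.+1 then
    if [pick k in active s | rings_first (active s) k x] is Some k then
      let x' := advance (active s) k x in
      if k \in effective s
      then omap (cons (k, x (k, 0%N))) (run m' (jump s k) x')
      else omap (delay (x (k, 0%N))) (run m' s x')
    else None
  else None.

Lemma unzip_delay t p : unzip1 (delay t p) = unzip1 p.
Proof. by case: p => [|[]]. Qed.

Lemma rings_first_inj (A : {set K}) k l (x : S) : k \in A -> l \in A ->
  rings_first A k x -> rings_first A l x -> k = l.
Proof.
move=> kA lA /andP[_ /forall_inP kx] /andP[_ /forall_inP lx].
have [//|kl] := eqVneq k l.
have := kx l; rewrite !inE eq_sym kl lA => /(_ isT) h.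
have := lx k; rewrite !inE kl kA => /(_ isT) h'.
by have := lt_trans h h'; rewrite ltxx.
Qed.

Lemma run_complete m s x p : run m s x = Some p -> complete_word s (unzip1 p).
Proof.
elim: m s x p => [|m IH] s x p /=; first by case: ifP => // E0 [<-].
case: ifP => [E0 [<-] //|En0].
case: pickP => // k /andP[kA _].
case: ifPn => kE.
  case: (run m _ _) (IH (jump s k) (advance (active s) k x)) => //= q /(_ q erefl).
  by move=> cq [<-] /=; rewrite kE.
case: (run m _ _) (IH s (advance (active s) k x)) => //= q /(_ q erefl).
by move=> cq [<-]; rewrite unzip_delay.
Qed.

Lemma run_gt0 m s x p : run m s x = Some p -> forall h, h \in unzip2 p -> 0 < h.
Proof.
elim: m s x p => [|m IH] s x p /=; first by case: ifP => // E0 [<-].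
case: ifP => [E0 [<-] //|En0].
case: pickP => // k /andP[kA /andP[x0 _]].
case: ifPn => kE.
  case: (run m _ _) (IH (jump s k) (advance (active s) k x)) => //= q /(_ q erefl).
  by move=> hq [<-] /= h; rewrite inE => /predU1P[->//|]; exact: hq.
case: (run m _ _) (IH s (advance (active s) k x)) => //= q /(_ q erefl).
move=> hq [<-] h; case: q hq => [|[e t] q] hq //=; rewrite inE => /predU1P[->|hq'].
  by rewrite addr_gt0// hq// inE eqxx.
by rewrite hq// inE hq' orbT.
Qed.

Definition discount (z : nat -> R) (p : seq (K * R)) : R :=
  expR (- \sum_(j < size p) z j * nth 0 (unzip2 p) j).

Lemma discount_cons z k h p :
  discount z ((k, h) :: p) = expR (- (z 0%N * h)) * discount (fun j => z j.+1) p.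
Proof. by rewrite /discount /= big_ord_recl /= opprD expRD. Qed.

Lemma discount_delay z t p : p != [::] ->
  discount z (delay t p) = expR (- (z 0%N * t)) * discount z p.
Proof.
by case: p => [|[k h] p] // _; rewrite !discount_cons mulrA -expRD mulrDr opprD.
Qed.

(** No two clocks ring strictly first, so the sum over clocks has at most one nonzero term, that of
    the clock picked by [run]. Completeness of [w] makes the end of the word coincide with the end
    of the run. *)
Lemma path_functionalE m s w z x : complete_word s w ->
  path_functional m s w z x =
  if run m s x is Some p then (unzip1 p == w)%:R * discount z p else 0.
Proof.
elim: m s w z x => [|m IH] s [|e w] z x.
- by move=> /= E0; rewrite E0 /discount big_ord0 oppr0 expR0 mulr1.
- by move=> /= /andP[eE _]; case: ifP eE => // /eqP ->; rewrite inE.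
- by move=> /= E0; rewrite E0 /discount big_ord0 oppr0 expR0 mulr1.
move=> cw; have /= /andP[eE cw'] := cw.
have -> : effective s == finset.set0 = false.
  by apply/negP => /eqP E0; rewrite E0 inE in eE.
case: pickP => [k /andP[kA kx]|no]; last first.
  rewrite big_enum/= big1// => k kA.
  by have := no k; rewrite kA /= => ->; rewrite !mul0r.
rewrite big_enum/= (bigD1 k)//= big1 ?addr0; last first.
  move=> l /andP[lA lk]; case: (boolP (rings_first _ l x)) => lx; last by rewrite !mul0r.
  by rewrite (rings_first_inj kA lA kx lx) eqxx in lk.
rewrite kx mul1r; case: ifPn => kE.
  have [->|ke] := eqVneq k e.
    rewrite IH//; case: (run m _ _) => [q|] /=; last by rewrite mulr0.
    by rewrite discount_cons eqseq_cons eqxx mulrCA.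
  rewrite mulr0; case: (run m _ _) => [q|] //=.
  by rewrite eqseq_cons (negbTE ke) mul0r.
rewrite IH//; case rE: (run m _ _) => [q|] /=; last by rewrite mulr0.
rewrite unzip_delay; case: eqP => [qw|]; last by rewrite !mul0r mulr0.
by rewrite !mul1r discount_delay//; case: (q) qw.
Qed.

(** A terminated run spells exactly one complete word. The expectation of this sum is thus the
    probability of termination within [m] rings. *)
Lemma sum_path_functional0 m s x :
  \sum_(w <- words s) path_functional m s w (fun=> 0) x = (run m s x != None)%:R.
Proof.
rewrite big_seq (eq_bigr (fun w => if run m s x is Some p then
  (unzip1 p == w)%:R else 0)); last first.
  move=> w; rewrite mem_words => cw; rewrite path_functionalE//.
  case: (run m s x) => // p; rewrite /discount big1 ?oppr0 ?expR0 ?mulr1//.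
  by move=> i _; rewrite mul0r.
rewrite -big_seq; case rE: (run m s x) => [p|]; last by rewrite big1.
have pw : unzip1 p \in words s by rewrite mem_words (run_complete rE).
rewrite (bigD1_seq (unzip1 p))//= ?words_uniq// eqxx big1 ?addr0// => w /negbTE.
by rewrite eq_sym => ->.
Qed.

Section ExpectationOfRuns.
Variables (M : probability S R) (iidM : iid_law M).

(** A squeeze that includes almost sure termination. [G m] agrees with [F] where the run terminates
    within [m] rings and is 0 elsewhere, and [H m] is the indicator of that event. Hence [G m <= F]
    and, since [F <= 1], also [F + H m <= 1 + G m]. The integrals of [H m] tend to 1 by
    [sum_word_weight0], so both bounds for the integral of [F] tend to the limit of the integrals of
    [G m]. *)
Lemma integral_run (s : St) (F : S -> R) (sel : pred (seq K))
    (z : seq K -> nat -> R) :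
  measurable_fun setT F -> (forall x, 0 <= F x <= 1) ->
  (forall w j, 0 <= z w j) ->
  (forall m x p, run m s x = Some p ->
     F x = (sel (unzip1 p))%:R * discount (z (unzip1 p)) p) ->
  (\int[M]_x (F x)%:E =
   (\sum_(w <- words s | sel w) word_weight s w (z w))%:E)%E.
Proof.
move=> mF F01 z0 FE.
pose G m x : R := \sum_(w <- words s | sel w) path_functional m s w (z w) x.
pose H m x : R := \sum_(w <- words s) path_functional m s w (fun=> 0) x.
pose g m : R := \sum_(w <- words s | sel w) path_value m s w (z w).
pose h m : R := \sum_(w <- words s) path_value m s w (fun=> 0).
have IP m (P : pred (seq K)) (y : seq K -> nat -> R) : (forall w j, 0 <= y w j) ->
   (\int[M]_x (\sum_(w <- words s | P w) path_functional m s w (y w) x)%:E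
   = (\sum_(w <- words s | P w) path_value m s w (y w))%:E)%E.
  move=> y0; rewrite -[in RHS]big_filter -sumEFin.
  under eq_bigr do rewrite -(integral_path_functional iidM _ _ _ (y0 _)).
  rewrite -ge0_integral_sum//.
  - by apply: eq_integral => x _; rewrite sumEFin big_filter.
  - by move=> w; apply/measurable_EFinP; exact: measurable_path_functional.
  - by move=> w x _; rewrite lee_fin path_functional_ge0.
have mG m : measurable_fun setT (G m).
  rewrite /G; under eq_fun do rewrite -big_filter.
  by apply: measurable_sum => w; exact: measurable_path_functional.
have mH m : measurable_fun setT (H m).
  by apply: measurable_sum => w; exact: measurable_path_functional.
have G0 m x : 0 <= G m x by apply: sumr_ge0 => w _; exact: path_functional_ge0.
have H0 m x : 0 <= H m x by apply: sumr_ge0 => w _; exact: path_functional_ge0.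
have GE m x : G m x = if run m s x is Some _ then F x else 0.
  rewrite /G big_seq_cond (eq_bigr (fun w => if run m s x is Some p then
    (unzip1 p == w)%:R * discount (z w) p else 0)); last first.
    by move=> w /andP[+ _]; rewrite mem_words => cw; rewrite path_functionalE.
  rewrite -big_seq_cond.
  case rE: (run m s x) => [p|]; last by rewrite big1.
  have pw : unzip1 p \in words s by rewrite mem_words (run_complete rE).
  rewrite big_mkcond (bigD1_seq (unzip1 p))//= ?words_uniq// eqxx big1 ?addr0.
    by rewrite (FE _ _ _ rE); case: (sel _); rewrite ?mul1r ?mul0r.
  by move=> w; rewrite eq_sym => /negbTE ->; rewrite mul0r; case: (sel w).
have HE m x : H m x = (run m s x != None)%:R by exact: sum_path_functional0.
have mEF : measurable_fun setT (fun x => (F x)%:E) by apply/measurable_EFinP.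
have F0 x : 0 <= F x by case/andP: (F01 x).
have [a aE] : exists a : R, (\int[M]_x (F x)%:E = a%:E)%E.
  exists (fine (\int[M]_x (F x)%:E)); rewrite fineK// ge0_fin_numE; last first.
    by apply: integral_ge0 => x _; rewrite lee_fin.
  apply: (@le_lt_trans _ _ (\int[M]_x (1%:E)))%E; last first.
    by rewrite integral_cst//= mul1e probability_setT ltry.
  apply: ge0_le_integral => //.
    by move=> x _; rewrite lee_fin.
  by move=> x _; rewrite lee_fin; case/andP: (F01 x).
have ga m : g m <= a.
  rewrite -lee_fin -aE -IP//; apply: ge0_le_integral => //.
  - by move=> x _; rewrite lee_fin G0.
  - by apply/measurable_EFinP; exact: mG.
  - by move=> x _; rewrite lee_fin -/(G m x) GE; case: (run m s x).
have ah m : a + h m <= 1 + g m.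
  have e1 : (\int[M]_x (F x + H m x)%:E = (a + h m)%:E)%E.
    under eq_integral do rewrite EFinD.
    rewrite ge0_integralD//.
    - by rewrite aE (IP m xpredT (fun=> fun=> 0)).
    - by move=> x _; rewrite lee_fin.
    - by move=> x _; rewrite lee_fin.
    - by apply/measurable_EFinP; exact: mH.
  have e2 : (\int[M]_x (1 + G m x)%:E = (1 + g m)%:E)%E.
    under eq_integral do rewrite EFinD.
    rewrite ge0_integralD//.
    - by rewrite integral_cst//= mul1e probability_setT (IP m sel z).
    - by move=> x _; rewrite lee_fin.
    - by apply/measurable_EFinP; exact: mG.
  rewrite -lee_fin -e1 -e2; apply: ge0_le_integral => //.
  - by move=> x _; rewrite lee_fin addr_ge0.
  - by apply/measurable_EFinP; apply: measurable_funD.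
  - by apply/measurable_EFinP; apply: measurable_funD.
  - move=> x _; rewrite lee_fin GE HE; case: (run m s x) => [p|] /=.
      by rewrite addrC.
    by rewrite !addr0; case/andP: (F01 x).
have gl : (g m @[m --> \oo] -->
    \sum_(w <- words s | sel w) word_weight s w (z w))%classic.
  by apply: cvg_sumr => w; rewrite mem_words => cw _; exact: cvg_path_value.
have hl : (h m @[m --> \oo] --> (1 : R))%classic.
  rewrite -(sum_word_weight0 s).
  by apply: cvg_sumr => w; rewrite mem_words => cw _; exact: cvg_path_value.
rewrite aE; congr EFin; apply/eqP; rewrite eq_le; apply/andP; split; last first.
  by apply: (cvgr_to_le gl); apply: nearW.
rewrite -(lerD2l 1) addrC.
apply: (ler_cvg_to (cvgD (cvg_cst a) hl) (cvgD (cvg_cst (1:R)) gl)).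
by apply: nearW.
Qed.

End ExpectationOfRuns.

End Runs.

(** * The law of a vector from its Laplace transforms *)

(** A permutation is determined by its order: its value at [k] is the number of indices with a
    smaller value. *)
Lemma perm_order_inj m (s t : 'S_m) :
  (forall j k, (s j < s k)%N = (t j < t k)%N) -> s = t.
Proof.
have cardE (u : 'S_m) k : #|[set j | (u j < u k)%N]| = u k.
  rewrite -(card_imset _ (@perm_inj _ u)).
  have -> : [set u x | x in [set j | (u j < u k)%N]] = [set i : 'I_m | (i < u k)%N].
    apply/setP => i; rewrite inE; apply/imsetP/idP => [[j]|ik].
      by rewrite inE => ? ->.
    by exists (u^-1%g i); rewrite ?inE permKV.
  rewrite -sum1_card; under eq_bigl do rewrite inE.
  by rewrite (big_ord_narrow (ltnW (ltn_ord (u k)))) sum1_card card_ord.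
move=> h; apply/permP => k; apply: val_inj; rewrite /= -(cardE s) -(cardE t).
by apply: eq_card => j; rewrite !inE h.
Qed.

Section Chambers.
Context {R : realType} {m : nat}.
Implicit Types (c : 'S_m) (v : m.-tuple R).

(** The strict comparisons exclude ties. Positivity of the entries makes the gap of index 0, which
    is the smallest entry itself, positive like the others. *)
Definition chamber c v : bool :=
  [forall i, 0 < tnth v i] &&
  [forall i, forall j, (c i < c j)%N == (tnth v i < tnth v j)].

Definition ordered_value c v (r : nat) : R :=
  nth 0 (0 :: [seq tnth v (c^-1%g i) | i : 'I_m]) r.

Definition gap c v (r : nat) : R := ordered_value c v r.+1 - ordered_value c v r.

Lemma ordered_valueE c v r :
  ordered_value c v r = if r is r'.+1 then
    oapp (fun i : 'I_m => tnth v (c^-1%g i)) 0 (insub r') else 0.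
Proof.
case: r => // r; rewrite /ordered_value /=.
have [rm|rm] := ltnP r m.
  rewrite insubT/= (nth_map (Ordinal rm)) ?size_enum_ord//.
  by congr (tnth v (c^-1%g _)); apply: val_inj; rewrite /= nth_enum_ord.
by rewrite insubF ?ltnNge ?rm// nth_default// size_map size_enum_ord.
Qed.

Lemma chamber_inj c c' v : chamber c v -> chamber c' v -> c = c'.
Proof.
move=> /andP[_ /forallP h] /andP[_ /forallP h']; apply: perm_order_inj => j k.
by rewrite (eqP (forallP (h j) k)) (eqP (forallP (h' j) k)).
Qed.

Lemma gap_gt0 c v (r : 'I_m) : chamber c v -> 0 < gap c v r.
Proof.
move=> /andP[/forallP v0 /forallP vc]; rewrite /gap subr_gt0 !ordered_valueE.
case: r => r rm; rewrite insubT /=; case: r rm => [|r] rm //=.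
by rewrite (insubT (fun i => i < m)%N (ltnW rm)) /= -(eqP (forallP (vc _) _)) !permKV /=.
Qed.

Lemma sum_gap c v (r : nat) : \sum_(q < r) gap c v q = ordered_value c v r.
Proof.
elim: r => [|r IH]; first by rewrite big_ord0.
by rewrite big_ord_recr /= IH /gap addrC subrK.
Qed.

Definition laplace c (y : nat -> R) v : R :=
  (chamber c v)%:R * expR (- \sum_(r < m) y r * gap c v r).

Lemma laplace01 c y v : (forall r, 0 <= y r) -> 0 <= laplace c y v <= 1.
Proof.
move=> y0; rewrite /laplace; case: (boolP (chamber c v)) => cv; last by rewrite mul0r lexx ler01.
rewrite mul1r expR_ge0 -expR0 ler_expR oppr_le0 /=.
by apply: sumr_ge0 => r _; rewrite mulr_ge0// ltW// gap_gt0.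
Qed.

Lemma measurable_forall d (T : measurableType d) (I : finType)
    (b : I -> T -> bool) :
  (forall i, measurable_fun setT (b i)) ->
  measurable_fun setT (fun x => [forall i, b i x]).
Proof.
move=> mb; rewrite (_ : (fun _ => _) = fun x => all (fun i => b i x) (enum I)).
  elim: (enum I) => [|i s IH] /=; first exact: measurable_cst.
  exact: measurable_and.
apply/funext => x; apply/forallP/allP => h i; last by apply: h; rewrite mem_enum.
by move=> _; exact: h.
Qed.

Lemma measurable_chamber c : measurable_fun setT (chamber c).
Proof.
apply: measurable_and; apply: measurable_forall => i.
  by apply: measurable_fun_ltr => //; exact: measurable_tnth.
apply: measurable_forall => j.
apply: (@measurableT_comp _ _ _ _ _ _ (fun b : bool => (c i < c j)%N == b)) => //.
by apply: measurable_fun_ltr; exact: measurable_tnth.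
Qed.

Lemma measurable_ordered_value c r :
  measurable_fun setT (fun v => ordered_value c v r).
Proof.
under eq_fun do rewrite ordered_valueE.
case: r => [|r]; first exact: measurable_cst.
case: insubP => [i _ _|_] /=; last exact: measurable_cst.
exact: measurable_tnth.
Qed.

Lemma measurable_gap c r : measurable_fun setT (fun v => gap c v r).
Proof. by apply: measurable_funB; exact: measurable_ordered_value. Qed.

Lemma measurable_laplace c y : measurable_fun setT (laplace c y).
Proof.
apply: measurable_funM.
  by apply: measurable_natr_bool; exact: measurable_chamber.
apply: measurableT_comp => //; apply: measurableT_comp => //.
apply: measurable_sum => r; apply: measurable_funM => //.
exact: measurable_gap.
Qed.

End Chambers.

(** * Indicators of half-lines as limits of exponential polynomials *)

Section Cutoff.
Context {R : realType}.
Implicit Types (theta d c : R).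

(* A polynomial in [expR (- d)] which tends to the indicator of [theta < d],
   boundary included. *)
Definition cutoff theta (N : nat) d : R :=
  (1 - expR (- (N%:R * d))) ^+ (Num.truncn (N%:R * expR (N%:R * theta))).+1.

(** Squaring 1 + x <= exp(x) at x = N c / 2 gives quadratic growth of exp(N c). The constant comes
    from N + 1 <= (1 + 2/c) (1 + N c / 2). *)
Lemma expR_linear_le c (N : nat) : 0 < c ->
  N.+1%:R * expR (- (N%:R * c)) <= (1 + 2 / c) ^+ 2 * N.+1%:R^-1.
Proof.
move=> c0; set K := 1 + 2 / c.
have K0 : 0 < K by rewrite addr_gt0// divr_gt0.
have N0 : 0 < N.+1%:R :> R by rewrite ltr0n.
have NK : N.+1%:R <= K * (1 + N%:R * c / 2).
  rewrite -natr1 /K.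
  have -> : (1 + 2 / c) * (1 + N%:R * c / 2) =
    N%:R + 1 + (2 / c + N%:R * c / 2) by field; rewrite gt_eqF.
  by rewrite lerDl addr_ge0// ?divr_ge0// ?mulr_ge0// ltW.
have e2 : (1 + N%:R * c / 2) ^+ 2 <= expR (N%:R * c).
  have -> : N%:R * c = 2%:R * (N%:R * c / 2) by field.
  have h0 : 0 <= 1 + N%:R * c / 2 by rewrite addr_ge0// divr_ge0// mulr_ge0// ltW.
  rewrite expRM_natl [in leLHS](_ : 2%:R * (N%:R * c / 2) = N%:R * c); last by field.
  by rewrite lerXn2r ?nnegrE ?expR_ge0 ?expR_ge1Dx.
rewrite expRN ler_pdivrMr ?expR_gt0// mulrAC ler_pdivlMr//.
apply: (@le_trans _ _ ((K * (1 + N%:R * c / 2)) ^+ 2)).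
  by rewrite -expr2 lerXn2r// nnegrE ltW// (lt_le_trans N0).
by rewrite exprMn ler_wpM2l// exprn_ge0// ltW.
Qed.

Lemma bernoulli_ineq (t : R) n : 0 <= t <= 1 -> 1 - n%:R * t <= (1 - t) ^+ n.
Proof.
move=> /andP[t0 t1]; elim: n => [|n IH]; first by rewrite mul0r subr0 expr0.
rewrite exprS; apply: (@le_trans _ _ ((1 - t) * (1 - n%:R * t))).
  have -> : (1 - t) * (1 - n%:R * t) = 1 - n.+1%:R * t + n%:R * t ^+ 2.
    by rewrite -natr1; ring.
  by rewrite lerDl mulr_ge0// sqr_ge0.
by rewrite ler_wpM2l// subr_ge0.
Qed.

Lemma expR_itv (N : nat) d : 0 <= d -> 0 <= expR (- (N%:R * d)) <= 1.
Proof.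
by move=> d0; rewrite expR_ge0 -expR0 ler_expR oppr_le0 mulr_ge0.
Qed.

Lemma cutoff_itv theta N d : 0 <= d -> 0 <= cutoff theta N d <= 1.
Proof.
move=> d0; have /andP[e0 e1] := expR_itv N d0.
by rewrite exprn_ge0 ?subr_ge0// exprn_ile1 ?subr_ge0// lerBlDr lerDl.
Qed.

(** Put t = exp(-N d) and let M be the exponent in [cutoff], so that N exp(N theta) < M <= N exp(N
    theta) + 1. If theta < d, Bernoulli gives (1-t)^M >= 1 - M t, and M t tends to 0. If d <= theta,
    then (1-t)^M <= exp(-M t) <= exp(-N); the factor N in the exponent is what settles the boundary
    case d = theta. *)
Lemma cvg_cutoff theta d : 0 < d ->
  (cutoff theta N d @[N --> \oo] --> ((theta < d)%R%:R : R))%classic.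
Proof.
move=> d0; have ed N := expR_itv N (ltW d0).
have harm (C : R) : (C * N.+1%:R^-1 @[N --> \oo] --> (0 : R))%classic.
  by rewrite -[X in (_ --> X)%classic](mulr0 C); apply: cvgMl_tmp; exact: cvg_harmonic.
have M1 N : N%:R * expR (N%:R * theta) <
    (Num.truncn (N%:R * expR (N%:R * theta))).+1%:R.
  by have /andP[] := truncn_itv (mulr_ge0 (ler0n R N) (expR_ge0 (N%:R * theta))).
have M2 N : (Num.truncn (N%:R * expR (N%:R * theta)))%:R <= N%:R * expR (N%:R * theta).
  by have /andP[] := truncn_itv (mulr_ge0 (ler0n R N) (expR_ge0 (N%:R * theta))).
have [td|dt] := ltP theta d.
  (* The two summands bound the contribution of N exp(N theta) and that of the extra 1 from rounding
     up the exponent. *)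
  pose C := (1 + 2 / (d - theta)) ^+ 2 + (1 + 2 / d) ^+ 2.
  have dt0 : 0 < d - theta by rewrite subr_gt0.
  apply: (@squeeze_cvgr _ _ _ _ (fun N => 1 - C * N.+1%:R^-1) (fun=> 1)).
  - apply: nearW => N; have /andP[_ ->] := cutoff_itv theta N (ltW d0).
    rewrite andbT; apply: le_trans (bernoulli_ineq _ (ed N)).
    rewrite lerD2l lerN2 -natr1 mulrDl mul1r /C [leRHS]mulrDl.
    apply: lerD.
      apply: le_trans (expR_linear_le N dt0).
      apply: (@le_trans _ _ (N%:R * expR (N%:R * theta) * expR (- (N%:R * d)))).
        by rewrite ler_wpM2r// expR_ge0.
      rewrite -mulrA -expRD -mulrBr -mulrN opprB.
      by rewrite ler_wpM2r ?expR_ge0// ler_nat.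
    apply: le_trans (expR_linear_le N d0).
    by rewrite ler_peMl ?expR_ge0// ler1n.
  - rewrite -[X in (_ --> X)%classic]subr0; apply: cvgB; [exact: cvg_cst|exact: harm].
  - exact: cvg_cst.
apply: (@squeeze_cvgr _ _ _ _ (fun=> 0) (fun N => 1 * N.+1%:R^-1)).
- apply: nearW => N; have /andP[-> _] := cutoff_itv theta N (ltW d0).
  rewrite /cutoff /=; set t := expR _; set n := _.+1.
  have /andP[t0 t1] : 0 <= t <= 1 by exact: ed.
  apply: (@le_trans _ _ (expR (- N%:R))).
    apply: (@le_trans _ _ (expR (n%:R * - t))).
      rewrite expRM_natl lerXn2r ?nnegrE ?expR_ge0 ?subr_ge0//.
      exact: expR_ge1Dx.
    rewrite ler_expR mulrN lerN2.
    apply: (@le_trans _ _ (N%:R * expR (N%:R * theta) * t)).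
      rewrite /t -mulrA -expRD -mulrBr ler_peMr// -expR0 ler_expR.
      by rewrite mulr_ge0// subr_ge0.
    by rewrite ler_wpM2r// ltW.
  rewrite mul1r expRN lef_pV2 ?posrE ?expR_gt0 ?ltr0n//.
  by rewrite -nat1r; exact: expR_ge1Dx.
- exact: cvg_cst.
- exact: harm.
Qed.

End Cutoff.

Lemma cvg_prodr (R : realType) (I : eqType) (r : seq I) (u : I -> nat -> R)
    (l : I -> R) :
  (forall i, i \in r -> (u i m @[m --> \oo] --> l i)%classic) ->
  (\prod_(i <- r) u i m @[m --> \oo] --> \prod_(i <- r) l i)%classic.
Proof.
elim: r => [|i r IH] h.
  under eq_fun do rewrite big_nil.
  by rewrite big_nil; exact: cvg_cst.
have {}IH : (\prod_(i <- r) u i m @[m --> \oo] --> \prod_(i <- r) l i)%classic.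
  by apply: IH => j jr; apply: h; rewrite inE jr orbT.
rewrite big_cons; under eq_fun do rewrite big_cons.
apply: cvgM => //.
by apply: h => //; rewrite inE eqxx.
Qed.

Section ExponentialPolynomials.
Context {R : realType} {m : nat}.
Implicit Types (c : 'S_m) (v : m.-tuple R).

Definition expsum c (L : seq (R * (nat -> nat))) v : R :=
  \sum_(p <- L) p.1 * expR (- \sum_(r < m) (p.2 r)%:R * gap c v r).

(** The exponents are natural numbers, so integrals of these functions over a chamber are linear
    combinations of Laplace transforms at natural parameters; closure under products is what admits
    [cutoff]. *)
Definition expoly c (f : m.-tuple R -> R) : Prop := exists L, f =1 expsum c L.

Lemma expoly1 c : expoly c (fun=> 1).
Proof.
exists [:: (1, fun=> 0%N)] => v; rewrite /expsum big_seq1 /= big1 ?oppr0 ?expR0 ?mulr1//.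
by move=> r _; rewrite mul0r.
Qed.

Lemma expoly_expR c (r : 'I_m) (N : nat) :
  expoly c (fun v => expR (- (N%:R * gap c v r))).
Proof.
exists [:: (1, fun q : nat => if q == r :> nat then N else 0%N)] => v.
rewrite /expsum big_seq1 /= mul1r (bigD1 r)//= eqxx big1 ?addr0// => q qr.
by rewrite ifN ?mul0r.
Qed.

Lemma expolyB c f g : expoly c f -> expoly c g -> expoly c (fun v => f v - g v).
Proof.
move=> [L fL] [L' gL]; exists (L ++ [seq (- p.1, p.2) | p <- L']) => v.
rewrite fL gL /expsum big_cat big_map /= -sumrN; congr (_ + _).
by apply: eq_bigr => p _; rewrite mulNr.
Qed.

Lemma expolyM c f g : expoly c f -> expoly c g -> expoly c (fun v => f v * g v).
Proof.
move=> [L fL] [L' gL].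
exists [seq (p.1 * q.1, fun r => (p.2 r + q.2 r)%N) | p <- L, q <- L'] => v.
rewrite fL gL /expsum big_allpairs_dep /= mulr_suml; apply: eq_bigr => p _.
rewrite mulr_sumr; apply: eq_bigr => q _.
rewrite mulrACA -expRD; congr (_ * expR _).
rewrite -opprD -big_split /=; congr (- _); apply: eq_bigr => r _.
by rewrite natrD mulrDl.
Qed.

Lemma expolyX c f k : expoly c f -> expoly c (fun v => f v ^+ k).
Proof.
move=> cf; elim: k => [|k IH]; first exact: expoly1.
by have [L hL] := expolyM cf IH; exists L => v; rewrite exprS -hL.
Qed.

Lemma expoly_prod c (I : Type) (s : seq I) (f : I -> m.-tuple R -> R) :
  (forall i, expoly c (f i)) -> expoly c (fun v => \prod_(i <- s) f i v).
Proof.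
move=> cf; elim: s => [|i s IH].
  by have [L hL] := expoly1 c; exists L => v; rewrite big_nil -hL.
by have [L hL] := expolyM (cf i) IH; exists L => v; rewrite big_cons -hL.
Qed.

Lemma expoly_cutoff c theta N (r : 'I_m) :
  expoly c (fun v => cutoff theta N (gap c v r)).
Proof. by apply: expolyX; apply: expolyB; [exact: expoly1|exact: expoly_expR]. Qed.

End ExponentialPolynomials.

(** * Upper boxes as a generating pi-system for tuples *)

Section TupleBoxes.
Context {R : realType} {m : nat}.
Local Open Scope classical_set_scope.

Definition upper_box (theta : 'I_m -> R) : set (m.-tuple R) :=
  [set v | forall r, theta r < tnth v r].

Definition upper_boxes : set (set (m.-tuple R)) :=
  [set B | exists theta, B = upper_box theta].

Lemma measurable_upper_box theta : measurable (upper_box theta).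
Proof.
rewrite (_ : upper_box theta = [set v | [forall r, theta r < tnth v r]]).
  rewrite -[X in measurable X]setTI.
  have mb : measurable_fun setT
      (fun v : m.-tuple R => [forall r, theta r < tnth v r]).
    apply: measurable_forall => r; apply: measurable_fun_ltr => //.
    exact: measurable_tnth.
  exact: (mb measurableT [set true] I).
by apply/seteqP; split=> v /= /forallP.
Qed.

Lemma tuple_lower_bound (v : m.-tuple R) : exists n : nat, forall r, - n%:R < tnth v r.
Proof.
exists (\sum_r Num.bound `|tnth v r|)%N => r.
rewrite ltrNl; apply: (@le_lt_trans _ _ `|tnth v r|); first by rewrite -normrN ler_norm.
apply: (@lt_le_trans _ _ (Num.bound `|tnth v r|)%:R); last first.
  by rewrite ler_nat (bigD1 r)//= leq_addr.
exact: archi_boundP.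
Qed.

(** A ray in the single coordinate [i] is the countable union of the upper boxes whose other
    thresholds are -n. *)
Lemma measurable_tuple_boxes : @measurable _ (m.-tuple R) = <<s upper_boxes >>.
Proof.
apply/seteqP; split; last first.
  apply: smallest_sub; first exact: sigma_algebra_measurable.
  by move=> _ [theta ->]; exact: measurable_upper_box.
apply: smallest_sub; first exact: smallest_sigma_algebra.
move=> X; rewrite -bigcup_seq/= => -[i _ [B mB <-]].
suff /(_ B mB) : measurable `<=` image_set_system setT (fun v : m.-tuple R => tnth v i)
    <<s upper_boxes >> by [].
have sa : sigma_algebra setT (image_set_system setT (fun v : m.-tuple R => tnth v i)
    <<s upper_boxes >>).
  exact/sigma_algebra_image/smallest_sigma_algebra.
rewrite [X in X `<=` _](RGenOInfty.measurableE R).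
apply: smallest_sub => // _ [a ->]; rewrite /image_set_system /= setTI.
rewrite (_ : _ @^-1` _ = \bigcup_n upper_box (fun r => if r == i then a else - n%:R)).
  apply: sigma_algebra_bigcup => n; apply: sub_sigma_algebra.
  by exists (fun r => if r == i then a else - n%:R).
apply/seteqP; split=> v /=; rewrite in_itv/= andbT.
  move=> av; have [n hn] := tuple_lower_bound v; exists n => // r.
  by case: eqP => [->|_].
by move=> [n _ /(_ i)]; rewrite eqxx.
Qed.

Lemma tuple_measure_unique (m1 m2 : {measure set (m.-tuple R) -> \bar R}) :
  (forall theta, m1 (upper_box theta) = m2 (upper_box theta)) ->
  (m1 setT < +oo)%E -> forall A, measurable A -> m1 A = m2 A.
Proof.
move=> m12 foo A mA.
apply: (@measure_unique _ _ _ upper_boxes (fun n => upper_box (fun=> - n%:R))) => //.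
- exact: measurable_tuple_boxes.
- move=> _ _ [t1 ->] [t2 ->]; exists (fun r => Num.max (t1 r) (t2 r)).
  apply/seteqP; split => v /=.
    by move=> [h1 h2] r; rewrite gt_max h1 h2.
  by move=> h; split=> r; have := h r; rewrite gt_max => /andP[].
- by move=> n; exists (fun=> - n%:R).
- apply/seteqP; split=> // v _; have [n hn] := tuple_lower_bound v.
  by exists n.
- by move=> _ [theta ->].
- move=> n; apply: le_lt_trans foo; apply: le_measure; rewrite ?inE//.
  exact: measurable_upper_box.
Qed.

End TupleBoxes.

Section LawFromLaplace.
Context {R : realType} {m : nat}.
Local Open Scope ereal_scope.
Local Open Scope classical_set_scope.
Variables mu nu : probability (m.-tuple R) R.

Hypothesis laplace_eq : forall (c : 'S_m) (y : nat -> nat),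
  \int[mu]_v (laplace c (fun r => (y r)%:R%R) v)%:E =
  \int[nu]_v (laplace c (fun r => (y r)%:R%R) v)%:E.

Let integrable_laplace (P : probability (m.-tuple R) R) c (y : nat -> nat) :
  P.-integrable setT (fun v => (laplace c (fun r => (y r)%:R%R) v)%:E).
Proof.
apply: (@le_integrable _ _ _ _ _ _ _ (fun=> 1%:E)) => //.
- by apply/measurable_EFinP; exact: measurable_laplace.
- move=> v _; rewrite /= lee_fin normr1.
  by have /andP[l0 l1] := @laplace01 R m c (fun r => (y r)%:R%R) v (fun=> ler0n _ _);
    rewrite ger0_norm.
- exact: finite_measure_integrable_cst.
Qed.

Let integral_expsum (P : probability (m.-tuple R) R) c L :
  \int[P]_v ((chamber c v)%:R * expsum c L v)%:E =
  \sum_(p <- L) p.1%:E * \int[P]_v (laplace c (fun r => (p.2 r)%:R%R) v)%:E.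
Proof.
transitivity (\int[P]_v \sum_(p <- L) (p.1%:E * (laplace c (fun r => (p.2 r)%:R%R) v)%:E)).
  apply: eq_integral => v _; rewrite /expsum mulr_sumr -sumEFin.
  by apply: eq_bigr => p _; rewrite -EFinM /laplace mulrCA.
rewrite integral_sum//; last by move=> p; apply: integrableZl => //; exact: integrable_laplace.
by apply: eq_bigr => p _; rewrite integralZl//; exact: integrable_laplace.
Qed.

Let integral_expoly c f : expoly c f ->
  \int[mu]_v ((chamber c v)%:R * f v)%:E = \int[nu]_v ((chamber c v)%:R * f v)%:E.
Proof.
move=> [L fL]; under eq_integral do rewrite fL.
under [RHS]eq_integral do rewrite fL.
by rewrite !integral_expsum; apply: eq_bigr => p _; rewrite laplace_eq.
Qed.

Let corner c (theta : 'I_m -> R) : set (m.-tuple R) :=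
  [set v | chamber c v /\ forall r : 'I_m, (theta r < gap c v r)%R].

Let measurable_corner c theta : measurable (corner c theta).
Proof.
rewrite (_ : corner c theta = [set v | chamber c v && [forall r : 'I_m, (theta r < gap c v r)%R]]).
  rewrite -[X in measurable X]setTI.
  have mb : measurable_fun setT (fun v : m.-tuple R =>
      chamber c v && [forall r : 'I_m, (theta r < gap c v r)%R]).
    apply: measurable_and; first exact: measurable_chamber.
    apply: measurable_forall => r; apply: measurable_fun_ltr => //.
    exact: measurable_gap.
  exact: (mb measurableT [set true] I).
apply/seteqP; split=> v /=.
  by rewrite /corner /= => -[-> h]; apply/forallP.
by rewrite /corner /= => /andP[-> /forallP].
Qed.

(** Dominated convergence with the constant bound 1. On the chamber all gaps are positive, as
    [cvg_cutoff] requires; off the chamber every term vanishes. *)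
Let corner_limit (P : probability (m.-tuple R) R) c theta :
  \int[P]_v ((chamber c v)%:R * \prod_(r < m) cutoff (theta r) N (gap c v r))%:E
    @[N --> \oo] --> P (corner c theta).
Proof.
rewrite -[corner c theta]setIT -(integral_indic P measurableT (measurable_corner c theta)).
apply: (@dominated_cvg _ _ _ _ _ _ _ _ (fun=> 1%:E)) => //.
- move=> N; apply/measurable_EFinP; apply: measurable_funM.
    by apply: measurable_natr_bool; exact: measurable_chamber.
  apply: measurable_prod => r _.
  apply: measurable_funX; apply: measurable_funB => //.
  apply: measurableT_comp => //; apply: measurableT_comp => //.
  by apply: measurable_funM => //; exact: measurable_gap.
- move=> v _; apply/cvg_EFin; first exact: nearW.
  rewrite /comp /=.
  case: (boolP (chamber c v)) => cv; last first.
    rewrite indicE memNset ?mul0r; last by move=> [] /(negP cv).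
    by under eq_fun do rewrite mul0r; exact: cvg_cst.
  under eq_fun do rewrite mul1r.
  have -> : (\1_(corner c theta) v = \prod_(r < m) (theta r < gap c v r)%R%:R :> R)%R.
    rewrite indicE; case: (boolP [forall r : 'I_m, (theta r < gap c v r)%R]).
      move=> /forallP h; rewrite mem_set; last by split.
      by rewrite big1// => r _; rewrite h.
    rewrite negb_forall => /existsP[r hr]; rewrite memNset; last first.
      by move=> [_ /(_ r)]; apply/negP.
    by rewrite (bigD1 r)//= (negbTE hr) mul0r.
  apply: cvg_prodr => r _; apply: cvg_cutoff; exact: gap_gt0.
- exact: finite_measure_integrable_cst.
move=> N v _; rewrite /= lee_fin.
case: (boolP (chamber c v)) => cv; last by rewrite mul0r normr0.
rewrite mul1r.
have cut01 r : (0 <= cutoff (theta r) N (gap c v r) <= 1)%R.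
  by apply: cutoff_itv; apply: ltW; exact: gap_gt0.
rewrite ger0_norm; last by apply: prodr_ge0 => r _; case/andP: (cut01 r).
by apply: prodr_ile1 => r _; exact: cut01.
Qed.

Let corner_eq c theta : mu (corner c theta) = nu (corner c theta).
Proof.
apply: (cvg_unique _ (@corner_limit mu c theta)); first exact: ereal_hausdorff.
rewrite (_ : (fun N => _) = (fun N => \int[nu]_v ((chamber c v)%:R *
  \prod_(r < m) cutoff (theta r) N (gap c v r))%:E)).
  exact: corner_limit.
apply/funext => N; apply: integral_expoly.
by apply: expoly_prod => r; exact: expoly_cutoff.
Qed.

Let gaps c (v : m.-tuple R) : m.-tuple R := [tuple gap c v r | r < m].

Let measurable_gaps c : measurable_fun setT (gaps c).
Proof.
apply/measurable_fun_tnthP => r; rewrite /comp.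
under eq_fun do rewrite tnth_mktuple.
exact: measurable_gap.
Qed.

Let cumulate (c : 'S_m) (w : m.-tuple R) : m.-tuple R :=
  [tuple (\sum_(q < m | (q <= c i)%N) tnth w q)%R | i < m].

Let measurable_cumulate c : measurable_fun setT (cumulate c).
Proof.
apply/measurable_fun_tnthP => r; rewrite /comp.
under eq_fun do rewrite tnth_mktuple -big_filter.
by apply: measurable_sum => q; exact: measurable_tnth.
Qed.

(** The partial sums of the gaps telescope, and [c i] is the place at which the entry [i] appears in
    the ordered list. *)
Let gapsK c : cancel (gaps c) (cumulate c).
Proof.
move=> v; apply: eq_from_tnth => i; rewrite tnth_mktuple.
under eq_bigr do rewrite tnth_mktuple.
rewrite (big_ord_narrow_cond (ltn_ord (c i)) (P := xpredT) (F := fun q => gap c v q)).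
by rewrite sum_gap ordered_valueE valK /= permK.
Qed.

Let measurable_chamber_set c : measurable [set v : m.-tuple R | chamber c v].
Proof.
rewrite -[X in measurable X]setTI.
exact: (@measurable_chamber R m c measurableT [set true] I).
Qed.

(** In gap coordinates the corners become upper boxes, so the restrictions of the two laws to the
    chamber have the same image under [gaps c]. A set of vectors is recovered from a set of gaps
    through the left inverse [cumulate c]. *)
Let chamber_eq c B : measurable B ->
  mu (B `&` [set v | chamber c v]) = nu (B `&` [set v | chamber c v]).
Proof.
move=> mB.
have BE (P : probability (m.-tuple R) R) : P (B `&` [set v | chamber c v]) =
    image_measure (mrestr P (measurable_chamber_set c)) (measurable_gaps c)
      (cumulate c @^-1` B).
  rewrite /= /pushforward /mrestr; congr (P _).
  by apply/seteqP; split=> v /=; rewrite gapsK.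
rewrite !BE; apply: tuple_measure_unique; last first.
- by rewrite -[X in measurable X]setTI; exact: measurable_cumulate.
- rewrite /= /pushforward /mrestr preimage_setT setTI.
  by apply: (le_lt_trans (probability_le1 _ _)) => //; rewrite ltry.
- move=> theta; have := corner_eq c theta; rewrite /corner /= /pushforward /mrestr.
  rewrite (_ : [set v | _ /\ _] = gaps c @^-1` upper_box theta `&` [set v | chamber c v])//.
  apply/seteqP; split=> v /=.
    by move=> [cv h]; split => // r; rewrite tnth_mktuple.
  by move=> [h cv]; split => // r; have := h r; rewrite tnth_mktuple.
Qed.

Let chambers : set (m.-tuple R) := \bigcup_(c in [set: 'S_m]) [set v | chamber c v].

Let measurable_chambers : measurable chambers.
Proof. by apply: fin_bigcup_measurable; [exact: finite_finset|
  move=> c _; exact: measurable_chamber_set]. Qed.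

Let measure_chambers (P : probability (m.-tuple R) R) B : measurable B ->
  P (B `&` chambers) = \sum_(c : 'S_m) P (B `&` [set v | chamber c v]).
Proof.
move=> mB; rewrite setI_bigcupr measure_fin_bigcup.
- rewrite [RHS]fsbig_seq ?index_enum_uniq//; apply: eq_fsbigl.
  by apply/seteqP; split=> c //= _; rewrite mem_index_enum.
- exact: finite_finset.
- move=> c c' _ _ [v [[_ /= h] [_ /= h']]]; exact: chamber_inj h h'.
- by move=> c _; apply: measurableI.
Qed.

Hypothesis mass_mu : \sum_(c : 'S_m) \int[mu]_v (laplace c (fun=> 0%R) v)%:E = 1.
Hypothesis mass_nu : \sum_(c : 'S_m) \int[nu]_v (laplace c (fun=> 0%R) v)%:E = 1.

Lemma laplace_law_eq B : measurable B -> mu B = nu B.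
Proof.
move=> mB.
have full (P : probability (m.-tuple R) R) :
    \sum_(c : 'S_m) \int[P]_v (laplace c (fun=> 0%R) v)%:E = 1 ->
    P B = P (B `&` chambers).
  move=> massP; have P1 : P chambers = 1.
    rewrite -[chambers]setTI measure_chambers// -massP; apply: eq_bigr => c _.
    rewrite setTI -[X in P X]setIT -(integral_indic P measurableT)//.
    apply: eq_integral => v _; rewrite /laplace big1; last by move=> r _; rewrite mul0r.
    rewrite oppr0 expR0 mulr1 indicE; case: (boolP (chamber c v)) => cv.
      by rewrite mem_set.
    by rewrite memNset//; exact/negP.
  have mC : measurable (~` chambers) by exact: measurableC.
  rewrite [LHS](measureDI P mB measurable_chambers).
  rewrite [X in X + _](_ : _ = 0) ?add0e//.
  apply/eqP; rewrite eq_le measure_ge0 andbT.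
  apply: (@le_trans _ _ (P (~` chambers))).
    by apply: le_measure; rewrite ?inE; [exact: measurableD|exact: mC|move=> x []].
  by rewrite probability_setC//= P1 subee.
rewrite !full// !measure_chambers//; apply: eq_bigr => c _; exact: chamber_eq.
Qed.

End LawFromLaplace.

(** * Rational functions from their values at natural points *)

Lemma digits_inj K n (a b : 'I_n -> nat) :
  (forall i, a i < K)%N -> (forall i, b i < K)%N ->
  (\sum_(i < n) a i * K ^ i = \sum_(i < n) b i * K ^ i)%N -> a =1 b.
Proof.
elim: n a b => [|n IH] a b aK bK; first by move=> _ [].
have split_digits (c : 'I_n.+1 -> nat) :
    (\sum_(j < n.+1) c j * K ^ j =
     (\sum_(j < n) c (lift ord0 j) * K ^ j) * K + c ord0)%N.
  rewrite big_ord_recl expn0 muln1 addnC; congr (_ + _)%N.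
  by rewrite big_distrl /=; apply: eq_bigr => j _; rewrite expnSr mulnA.
rewrite !split_digits => e i.
have e0 : a ord0 = b ord0.
  by have := congr1 (modn^~ K) e; rewrite /= !modnMDl !modn_small.
have K0 : (0 < K)%N by apply: leq_ltn_trans (aK ord0).
have [j ->|->//] := unliftP ord0 i.
apply: (IH (a \o lift ord0) (b \o lift ord0)) => [l|l|]; rewrite /=; [exact: aK|exact: bK|].
move: e; rewrite e0 => /eqP; rewrite eqn_add2r => /eqP.
by move=> /eqP; rewrite eqn_pmul2r// => /eqP.
Qed.

Lemma inv_add_frac (K : fieldType) (a b n : K) : a != 0 -> b != 0 ->
  a^-1 + n / b = (b + a * n) / (a * b).
Proof. by move=> a0 b0; field; rewrite a0 b0. Qed.

Section NatPoints.
Context {F : numFieldType} {m : nat}.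
Local Notation P := (mpoly m F).

Definition nat_eval (y : 'I_m -> nat) (p : P) : F := meval (fun i => (y i)%:R) p.

(* Kronecker substitution: [x_i := t ^ (K ^ i)] maps distinct monomials of
   degree less than [K] to distinct powers of [t]. *)
Lemma mpoly_eq0_nat_points (p : P) : (forall y, nat_eval y p = 0) -> p = 0.
Proof.
move=> p0; pose K := msize p.
pose e (mm : multinom m) := (\sum_(i < m) mm i * K ^ i)%N.
have e_inj : {in msupp p &, injective e}.
  have bound mm : mm \in msupp p -> forall i, (mm i < K)%N.
    move=> /msize_mdeg_lt h i; apply: leq_ltn_trans h.
    by rewrite mdegE (bigD1 i)//= leq_addr.
  move=> a b /bound ha /bound hb /(digits_inj ha hb) ab.
  exact/mnmP.
pose q : {poly F} := \sum_(mm <- msupp p) mcoeff mm p *: 'X^(e mm).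
(* At a natural number t, [q] takes the value of [p] at the natural point with coordinates t^(K^i),
   that is 0. Having [size q] distinct roots, one more than the degree allows, forces [q] to
   vanish. *)
have q0 : q = 0.
  apply: (@roots_geq_poly_eq0 _ q [seq n%:R | n <- iota 0 (size q)]).
  - apply/allP => _ /mapP[t _ ->]; rewrite /root -(p0 (fun i => t ^ (K ^ i))%N).
    rewrite /nat_eval mevalE /q horner_sum; apply/eqP/eq_bigr => mm _.
    rewrite hornerZ hornerXn; congr (_ * _).
    rewrite /e -natrX expn_sum natr_prod; apply: eq_bigr => i _.
    by rewrite -natrX mulnC expnM.
  - rewrite map_inj_uniq ?iota_uniq// => a b /eqP; rewrite eqr_nat => /eqP //.
  - by rewrite size_map size_iota.
apply/mpolyP => mm; rewrite mcoeff0.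
have [mmp|/memN_msupp_eq0//] := boolP (mm \in msupp p).
have := congr1 (fun r : {poly F} => r`_(e mm)) q0.
rewrite /q coef_sum coef0 (bigD1_seq mm)//= ?msupp_uniq//.
rewrite coefZ coefXn eqxx mulr1 big_seq_cond big1 ?addr0// => a /andP[ap am].
rewrite coefZ coefXn; case: eqP => [/esym eam|]; last by rewrite mulr0.
by rewrite (e_inj _ _ ap mmp eam) eqxx in am.
Qed.

Context {K : fieldType} {f : {rmorphism P -> K}} (f_inj : injective f).

(** One pair [num], [den] of polynomials serves both the embedding [f] and all evaluations at once,
    and [den] has no natural zero; this makes the two kinds of sums comparable. *)
Lemma sum_inv_morphE (L : seq P) : (forall p y, p \in L -> nat_eval y p != 0) ->
  exists num den : P, [/\ forall y, nat_eval y den != 0,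
    \sum_(p <- L) (f p)^-1 = f num / f den &
    forall y, \sum_(p <- L) (nat_eval y p)^-1 = nat_eval y num / nat_eval y den].
Proof.
have neq0 p : (forall y, nat_eval y p != 0) -> f p != 0.
  move=> h; rewrite -(rmorph0 f) (inj_eq f_inj).
  apply: contraTneq (h (fun=> 0%N)) => ->.
  by rewrite /nat_eval meval0 eqxx.
elim: L => [|p L IH] h.
  exists 0, 1; split=> [y||y]; first by rewrite /nat_eval meval1 oner_eq0.
    by rewrite big_nil rmorph0 mul0r.
  by rewrite big_nil /nat_eval meval0 mul0r.
have [|num [den [den0 e1 e2]]] := IH; first by move=> q y qL; rewrite h// inE qL orbT.
have p0 y : nat_eval y p != 0 by rewrite h// inE eqxx.
exists (den + p * num), (p * den); split=> [y||y].
- by rewrite /nat_eval mevalM mulf_neq0//; [exact: p0|exact: den0].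
- by rewrite big_cons e1 rmorphD !rmorphM inv_add_frac//; exact: neq0.
- by rewrite big_cons e2 /nat_eval mevalD !mevalM inv_add_frac//; [exact: p0|exact: den0].
Qed.

(** After clearing denominators both sides express the same polynomial identity, which is detected
    by the injective [f] as well as by the natural points. *)
Lemma sum_inv_morph_eqP (L L' : seq P) :
  (forall p y, p \in L ++ L' -> nat_eval y p != 0) ->
  \sum_(p <- L) (f p)^-1 = \sum_(p <- L') (f p)^-1 <->
  forall y, \sum_(p <- L) (nat_eval y p)^-1 = \sum_(p <- L') (nat_eval y p)^-1.
Proof.
move=> h.
have [|n [d [d0 e1 e2]]] := @sum_inv_morphE L.
  by move=> p y pL; rewrite h// mem_cat pL.
have [|n' [d' [d'0 e1' e2']]] := @sum_inv_morphE L'.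
  by move=> p y pL; rewrite h// mem_cat pL orbT.
have neq0 p : (forall y, nat_eval y p != 0) -> f p != 0.
  move=> hp; rewrite -(rmorph0 f) (inj_eq f_inj).
  apply: contraTneq (hp (fun=> 0%N)) => ->.
  by rewrite /nat_eval meval0 eqxx.
have fd := neq0 _ d0; have fd' := neq0 _ d'0.
rewrite e1 e1'; split=> [e y|e].
  rewrite e2 e2'; apply/eqP; rewrite eqr_div//.
  have /f_inj /(congr1 (nat_eval y)) : f (n * d') = f (n' * d).
    by apply/eqP; rewrite !rmorphM -eqr_div// e.
  by rewrite /nat_eval !mevalM => h'; apply/eqP; exact: h'.
apply/eqP; rewrite eqr_div// -!rmorphM (inj_eq f_inj) -subr_eq0; apply/eqP.
apply: mpoly_eq0_nat_points => y; have := e y; rewrite e2 e2' => /eqP.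
rewrite eqr_div// => /eqP e3.
by rewrite /nat_eval mevalB !mevalM; apply/eqP; rewrite subr_eq0; apply/eqP.
Qed.

End NatPoints.

Section RationalFunctions.
Context {R : realType} {m : nat}.

Definition ratfun_morph : {rmorphism mpoly.mpoly m (complex R) -> ratfun R m} :=
  @tofrac (mpoly.mpoly m (complex R)).

Lemma ratfun_morph_inj : injective ratfun_morph.
Proof. by move=> p q /eqP; rewrite /ratfun_morph /= tofrac_eq => /eqP. Qed.

Definition rate_poly (v : 'I_m -> nat) (d : nat -> nat) : mpoly.mpoly m (complex R) :=
  \prod_(k < m) \prod_(increasing v k <= j < increasing v k.+1)
     (mpolyX _ (mnm1 k) + (d j)%:R).

(** Real-valued, because it has to match expectations; [rate_valueE] places it inside the complex
    numbers as the value of the rational function. *)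
Definition rate_value (v : 'I_m -> nat) (d : nat -> nat) (y : 'I_m -> nat) : R :=
  \prod_(k < m) \prod_(increasing v k <= j < increasing v k.+1)
     ((y k)%:R + (d j)%:R)^-1.

Lemma rate_productE v d : rate_product R v d = (ratfun_morph (rate_poly v d))^-1.
Proof.
rewrite /rate_product /rate_poly rmorph_prod -prodfV; apply: eq_bigr => k _.
rewrite rmorph_prod -prodfV; apply: eq_bigr => j _.
by rewrite rmorphD rmorph_nat.
Qed.

(** Positive degrees exclude poles at all natural points, the origin included. *)
Definition positive_rates (v : 'I_m -> nat) (d : nat -> nat) : Prop :=
  forall (k : 'I_m) j, (increasing v k <= j < increasing v k.+1)%N -> (0 < d j)%N.

Lemma nat_eval_rate_poly v d y :
  nat_eval y (rate_poly v d) =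
  real_complex R (\prod_(k < m) \prod_(increasing v k <= j < increasing v k.+1)
     ((y k)%:R + (d j)%:R)).
Proof.
rewrite /nat_eval /rate_poly !rmorph_prod; apply: eq_bigr => k _.
rewrite !rmorph_prod; apply: eq_bigr => j _.
by rewrite !rmorphD !rmorph_nat /= mevalXU.
Qed.

Lemma rate_valueE v d y :
  real_complex R (rate_value v d y) = (nat_eval y (rate_poly v d))^-1.
Proof.
rewrite nat_eval_rate_poly -fmorphV; congr real_complex_def.
rewrite /rate_value -prodfV; apply: eq_bigr => k _.
by rewrite -prodfV.
Qed.

Lemma nat_eval_rate_poly_neq0 v d y : positive_rates v d ->
  nat_eval y (rate_poly v d) != 0.
Proof.
move=> d0; rewrite nat_eval_rate_poly fmorph_eq0.
apply/prodf_neq0 => k _; rewrite prodf_seq_neq0; apply/allP => j.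
rewrite mem_index_iota => kj; apply/implyP => _.
by rewrite -natrD pnatr_eq0 -lt0n addn_gt0 (d0 _ _ kj) orbT.
Qed.

Lemma sum_rate_product_eqP (I J : finType) (A : pred I) (B : pred J)
    (v : I -> 'I_m -> nat) (d : I -> nat -> nat)
    (v' : J -> 'I_m -> nat) (d' : J -> nat -> nat) :
  (forall i, A i -> positive_rates (v i) (d i)) ->
  (forall j, B j -> positive_rates (v' j) (d' j)) ->
  \sum_(i | A i) rate_product R (v i) (d i) =
  \sum_(j | B j) rate_product R (v' j) (d' j) <->
  forall y, \sum_(i | A i) rate_value (v i) (d i) y =
            \sum_(j | B j) rate_value (v' j) (d' j) y.
Proof.
move=> hA hB.
under eq_bigr do rewrite rate_productE.
under [X in _ = X]eq_bigr do rewrite rate_productE.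
pose L := [seq rate_poly (v i) (d i) | i in A].
pose L' := [seq rate_poly (v' j) (d' j) | j in B].
have sumL (V : nmodType) (F : mpoly.mpoly m (complex R) -> V) :
  \sum_(i | A i) F (rate_poly (v i) (d i)) = \sum_(p <- L) F p.
  by rewrite big_image.
have sumL' (V : nmodType) (F : mpoly.mpoly m (complex R) -> V) :
  \sum_(i | B i) F (rate_poly (v' i) (d' i)) = \sum_(p <- L') F p.
  by rewrite big_image.
rewrite (sumL _ (fun p => (ratfun_morph p)^-1)) (sumL' _ (fun p => (ratfun_morph p)^-1)).
have neq0 p y : p \in L ++ L' -> nat_eval y p != 0.
  rewrite mem_cat => /orP[] /mapP[i]; rewrite mem_enum => iAB ->.
    by apply: nat_eval_rate_poly_neq0; exact: hA.
  by apply: nat_eval_rate_poly_neq0; exact: hB.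
apply: (iff_trans (sum_inv_morph_eqP ratfun_morph_inj neq0)).
split=> h y.
  apply: (@complexI R); rewrite !rmorph_sum.
  rewrite (eq_bigr (fun i => (nat_eval y (rate_poly (v i) (d i)))^-1)); last first.
    by move=> i _; rewrite -rate_valueE.
  rewrite [RHS](eq_bigr (fun i => (nat_eval y (rate_poly (v' i) (d' i)))^-1)); last first.
    by move=> i _; rewrite -rate_valueE.
  by rewrite (sumL _ (fun p => (nat_eval y p)^-1)) (sumL' _ (fun p => (nat_eval y p)^-1)).
rewrite -(sumL _ (fun p => (nat_eval y p)^-1)) -(sumL' _ (fun p => (nat_eval y p)^-1)).
have := congr1 (real_complex R) (h y); rewrite !rmorph_sum.
under eq_bigr do rewrite /= rate_valueE.
by under [in X in _ = X -> _]eq_bigr do rewrite /= rate_valueE.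
Qed.

End RationalFunctions.

(** * Jump chains with marked last times *)

Section Standardization.
Context {m : nat}.
Variable v : 'I_m -> nat.
Hypothesis v_inj : injective v.

Lemma order_permP j k : (order_perm v j < order_perm v k)%N = (v j < v k)%N.
Proof.
rewrite /order_perm; case: pickP => [s /= /forallP h|no].
  by have /eqP := forallP (h j) k.
(* If no permutation were found, the rank function of [v] would contradict this: it is injective
   along with [v] and ordered in the same way. *)
have rank_lt i : (#|[set l | (v l < v i)%N]| < m)%N.
  rewrite -[X in (_ < X)%N]card_ord -cardsT; apply: proper_card.
  by apply/properP; split; [exact: finset.subsetT|exists i; rewrite ?inE ?ltnn].
have rank_mono a b : (#|[set l | (v l < v a)%N]| < #|[set l | (v l < v b)%N]|)%N =
    (v a < v b)%N.
  have mono c d : (v c < v d)%N -> (#|[set l | (v l < v c)%N]| < #|[set l | (v l < v d)%N]|)%N.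
    move=> cd; apply: proper_card; apply/properP; split.
      by apply/fintype.subsetP => l; rewrite !inE => /ltn_trans; apply.
    by exists c; rewrite !inE ?ltnn.
  apply/idP/idP; last exact: mono.
  case: (ltngtP (v a) (v b)) => // [/mono h /(ltn_trans h)|/v_inj ->]; by rewrite ltnn.
pose f i := Ordinal (rank_lt i).
have f_inj : injective f.
  move=> a b /(congr1 val) /= e; apply: v_inj.
  have := rank_mono a b; have := rank_mono b a; rewrite e ltnn.
  by case: ltngtP.
have /forallP[] := no (perm f_inj); move=> a; apply/forallP => b.
by rewrite !permE /= rank_mono.
Qed.

Lemma increasing_order_perm (r : 'I_m) :
  increasing v r.+1 = v ((order_perm v)^-1%g r).
Proof.
rewrite /increasing /=.
have -> : sort leq [seq v k | k : 'I_m] =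
    [seq v ((order_perm v)^-1%g i) | i : 'I_m].
  apply: (sorted_eq leq_trans anti_leq); first exact: sort_sorted leq_total _.
    rewrite sorted_map; apply: (@sub_sorted _ (fun i j : 'I_m => (i < j)%N)).
      by move=> i j ij; rewrite /= leq_eqVlt -order_permP !permKV ij orbT.
    by have := iota_ltn_sorted 0 m; rewrite -val_enum_ord sorted_map.
  rewrite perm_sort; apply: uniq_perm.
  - by rewrite map_inj_uniq ?enum_uniq.
  - by rewrite map_inj_uniq ?enum_uniq// => a b /v_inj /perm_inj.
  - move=> x; apply/mapP/mapP => -[i _ ->].
      by exists (order_perm v i); rewrite ?mem_enum ?permK.
    by exists ((order_perm v)^-1%g i); rewrite ?mem_enum.
rewrite (nth_map r) ?size_enum_ord//; congr (v (_ _)).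
by apply: val_inj; rewrite /= nth_enum_ord.
Qed.

Lemma increasing_sorted k l : (k <= l <= m)%N -> (increasing v k <= increasing v l)%N.
Proof.
move=> /andP[kl lm].
have srt : sorted leq (0%N :: sort leq [seq v k | k : 'I_m]).
  have := sort_sorted leq_total [seq v k | k : 'I_m].
  by case: (sort _ _) => //= a s; rewrite leq0n.
apply: (sorted_leq_nth leq_trans leqnn 0%N srt k l _ _ kl);
  rewrite inE /= size_sort size_map size_enum_ord ltnS //.
exact: leq_trans lm.
Qed.

(** The number of entries of [v] that are at most [j], which is the index of the block of the double
    product to which the factor [j] belongs. *)
Definition stage (j : nat) : nat := find (ltn j) (sort leq [seq v k | k : 'I_m]).

Lemma stageE (k : 'I_m) j : (increasing v k <= j < increasing v k.+1)%N -> stage j = k.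
Proof.
move=> /andP[kj jk]; rewrite /stage; set s := sort _ _.
have ss : size s = m by rewrite size_sort size_map size_enum_ord.
have [lt|gt|//] := ltngtP (find (ltn j) s) k.
  have : (j < nth 0%N s (find (ltn j) s))%N.
    by apply: nth_find; rewrite has_find (ltn_trans lt)// ss.
  rewrite ltnNge; apply: contraNeq => _; apply: leq_trans kj.
  by apply: (@increasing_sorted (find (ltn j) s).+1 k); rewrite lt ltnW.
by have := before_find 0%N gt; rewrite /= -/(increasing v k.+1) jk.
Qed.

(** The blocks between consecutive sorted values are adjacent intervals, so a double product of the
    form used in [rate_product] is one product over all jumps, with the block index read off by
    [stage]. *)
Lemma big_stages (R : Type) (idx : R) (op : Monoid.law idx) (F : nat -> nat -> R) :
  \big[op/idx]_(k < m) \big[op/idx]_(increasing v k <= j < increasing v k.+1) F j k =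
  \big[op/idx]_(j < increasing v m) F j (stage j).
Proof.
transitivity (\big[op/idx]_(k < m)
    \big[op/idx]_(increasing v k <= j < increasing v k.+1) F j (stage j)).
  by apply: eq_bigr => k _; apply: eq_big_nat => j /stageE ->.
rewrite -(big_mkord xpredT (fun j => F j (stage j))).
suff H n : (n <= m)%N -> \big[op/idx]_(k < n)
    \big[op/idx]_(increasing v k <= j < increasing v k.+1) F j (stage j) =
    \big[op/idx]_(0 <= j < increasing v n) F j (stage j) by exact: H.
elim: n => [|n IH] nm; first by rewrite big_ord0 big_geq.
rewrite big_ord_recr /= IH; last exact: ltnW.
by rewrite -big_cat_nat//; apply: increasing_sorted; rewrite leqnSn.
Qed.

End Standardization.

Section LastTimes.
Context {R : realType} {m : nat}.
Variables (l : 'I_m -> nat) (N : nat).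
Hypothesis l_inj : injective l.
Hypothesis l_gt0 : forall k, (0 < l k)%N.
Hypothesis l_le : forall k, (l k <= N)%N.
Hypothesis l_max : exists k, l k = N.

Lemma increasing_last : increasing l m = N.
Proof.
have [k kN] := l_max.
have m0 : (0 < m)%N by apply: leq_ltn_trans (ltn_ord k).
have mm : (m.-1 < m)%N by rewrite prednK.
apply/eqP; rewrite eqn_leq; apply/andP; split.
  by rewrite -[X in increasing l X](prednK m0) (increasing_order_perm l_inj (Ordinal mm)) l_le.
rewrite -kN -[in leqLHS](permK (order_perm l) k) -(increasing_order_perm l_inj).
by apply: increasing_sorted => //; rewrite ltn_ord leqnn.
Qed.

Lemma laplace_last_times (h : seq R) (v : m.-tuple R) (c : 'S_m) (y : nat -> R) :
  size h = N -> (forall t, t \in h -> 0 < t) ->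
  (forall k, tnth v k = \sum_(j < l k) nth 0 h j) ->
  laplace c y v = (order_perm l == c)%:R *
    expR (- \sum_(j < N) y (stage l j) * nth 0 h j).
Proof.
move=> hN h0 vE.
(* [tau a] is the time of the jump number [a]. It increases strictly with [a] up to [N], so [v]
   inherits its order from [l], and the gaps of [v] are the increments of [tau] over the stages. *)
pose tau a := \sum_(j < a) nth 0 h j.
have tau_lt a b : (a < b <= N)%N -> tau a < tau b.
  move=> /andP[ab bN]; rewrite /tau -!(big_mkord xpredT (fun j => nth 0 h j)).
  rewrite (@big_cat_nat _ _ _ a 0 b) ?(ltnW ab)//= ltrDl big_ltn//.
  apply: ltr_wpDr; last by apply: h0; apply: mem_nth; rewrite hN (leq_trans ab).
  rewrite big_nat_cond; apply: sumr_ge0 => j /andP[/andP[_ jb] _].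
  by apply/ltW/h0/mem_nth; rewrite hN (leq_trans jb).
have tau_mono a b : (a <= N)%N -> (b <= N)%N -> (tau a < tau b) = (a < b)%N.
  move=> aN bN; case: (ltngtP a b) => [ab|ba|->]; last by rewrite ltxx.
    by rewrite tau_lt// ab.
  by apply/negbTE; rewrite -leNgt ltW// tau_lt// ba.
have tau0 : tau 0%N = 0 by rewrite /tau big_ord0.
have cv : chamber (order_perm l) v.
  apply/andP; split.
    by apply/forallP => i; rewrite vE -/(tau _) -tau0 tau_mono ?l_le// l_gt0.
  apply/forallP => i; apply/forallP => j.
  by rewrite !vE -!/(tau _) tau_mono ?l_le// order_permP.
have [<-|lc] := eqVneq (order_perm l) c; last first.
  rewrite mul0r /laplace; case: (boolP (chamber c v)) => [cv'|]; last by rewrite mul0r.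
  by rewrite (chamber_inj cv cv') eqxx in lc.
rewrite mul1r /laplace cv mul1r; congr (expR (- _)).
rewrite -increasing_last -(big_stages _ _ (fun j k => y k * nth 0 h j)).
apply: eq_bigr => k _; rewrite -mulr_sumr; congr (_ * _).
have ovE (r : nat) : (r <= m)%N -> ordered_value (order_perm l) v r = tau (increasing l r).
  case: r => [|r] rm; first by rewrite tau0.
  rewrite ordered_valueE insubT /= vE -/(tau _).
  by rewrite -(increasing_order_perm l_inj (Ordinal rm)).
rewrite /gap !ovE//; last exact: ltnW.
rewrite /tau -!(big_mkord xpredT (fun j => nth 0 h j)).
rewrite (@big_cat_nat _ _ _ (increasing l k) 0 (increasing l k.+1))//=.
  by rewrite addrAC subrr add0r.
by apply: increasing_sorted; rewrite leqnSn ltn_ord.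
Qed.

Lemma rate_value_stage (d : nat -> nat) (y : nat -> nat) :
  rate_value l d (fun k => y k) =
  \prod_(j < N) ((y (stage l j))%:R + (d j)%:R)^-1 :> R.
Proof.
by rewrite -increasing_last -(big_stages _ _ (fun j k => ((y k)%:R + (d j)%:R)^-1)).
Qed.

End LastTimes.

Section LastJumpTimes.
Context {R : realType} {K : finType} {St : Type} {m : nat}.
Variables (active effective : St -> {set K}) (jump : St -> K -> St).
Variable rk : St -> nat.
Hypothesis effective_active : forall s, effective s \subset active s.
Hypothesis rk_jump : forall s k, k \in effective s -> (rk (jump s k)).+1 = rk s.
Hypothesis rk_eq0 : forall s, (rk s == 0%N) = (effective s == finset.set0).
Local Notation S := (@config R (K * nat)%type).
Variables (s0 : St) (last : seq K -> 'I_m -> nat).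
Hypothesis last_inj : forall w, complete_word effective jump s0 w -> injective (last w).
Hypothesis last_gt0 : forall w k, complete_word effective jump s0 w -> (0 < last w k)%N.
Hypothesis last_le : forall w k, complete_word effective jump s0 w -> (last w k <= rk s0)%N.
Hypothesis last_max : forall w, complete_word effective jump s0 w ->
  exists k, last w k = rk s0.
Variable W : S -> m.-tuple R.
Hypothesis measurable_W : measurable_fun setT W.
Hypothesis W_run : forall i x p, run active effective jump i s0 x = Some p ->
  forall k, tnth (W x) k = \sum_(j < last (unzip1 p) k) nth 0 (unzip2 p) j.
Variables (M : probability S R) (iidM : iid_law M).

Definition word_degree (w : seq K) (j : nat) : nat :=
  #|effective (foldl jump s0 (take j w))|.

(** An instance of [integral_run] in which both the selection and the discount depend on the word:
    the words ordered as [c] are kept, and the discount rate of a holding time is the parameter of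
    its stage. *)
Lemma integral_laplace_run (c : 'S_m) (y : nat -> nat) :
  (\int[M]_x (laplace c (fun r => (y r)%:R%R) (W x))%:E =
   (\sum_(w <- words effective jump rk s0 | order_perm (last w) == c)
      rate_value (last w) (word_degree w) (fun k => y k))%:E)%E.
Proof.
rewrite (integral_run effective_active rk_jump rk_eq0 iidM (s := s0)
  (sel := fun w => order_perm (last w) == c)
  (z := fun w j => (y (stage (last w) j))%:R)).
- congr EFin; rewrite big_seq_cond [RHS]big_seq_cond; apply: eq_bigr => w.
  rewrite (mem_words rk_jump rk_eq0) => /andP[cw _].
  rewrite (rate_value_stage (last_inj cw) (fun k => last_le k cw) (last_max cw)).
  by rewrite /word_weight (size_complete_word rk_jump rk_eq0 cw).
- by apply: (measurableT_comp (measurable_laplace c _)).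
- by move=> x; apply: laplace01.
- by [].
- move=> i x p rp.
  have cp := run_complete rp.
  have sp : size (unzip2 p) = rk s0.
    by rewrite size_map -(size_map fst) (size_complete_word rk_jump rk_eq0 cp).
  rewrite (laplace_last_times (last_inj cp) (fun k => last_gt0 k cp)
    (fun k => last_le k cp) (last_max cp) _ _ sp (run_gt0 rp) (W_run rp)).
  by rewrite /discount -sp size_map.
Qed.

End LastJumpTimes.

Lemma integral_laplace_pushforward {R : realType} {m : nat} d1 d2
    (T1 : measurableType d1) (T2 : measurableType d2) (P : probability T1 R)
    (h : T1 -> T2) (mh : measurable_fun setT h) (W : T2 -> m.-tuple R)
    (c : 'S_m) (y : nat -> R) :
  measurable_fun setT W -> (forall r, 0 <= y r)%R ->
  (\int[distribution P (mfun_of mh)]_x (laplace c y (W x))%:E =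
   \int[P]_x (laplace c y (W (h x)))%:E)%E.
Proof.
move=> mW y0; rewrite ge0_integral_pushforward//.
- by apply/measurable_EFinP; apply: (measurableT_comp (measurable_laplace c _)).
- by move=> x _; rewrite lee_fin; case/andP: (laplace01 c (W x) y0).
Qed.

(** * The oriented swap process *)

Section SwapChain.
Context {n : nat}.
Implicit Types (c : 'S_n) (k : 'I_n.-1).

Definition swap_active (c : 'S_n) : {set 'I_n.-1} := finset.setT.

Definition swap_effective (c : 'S_n) : {set 'I_n.-1} := [set k | ascent c k].

Definition swap_jump (c : 'S_n) (k : 'I_n.-1) : 'S_n :=
  if ascent c k then swap_at k c else c.

(** Each effective swap removes exactly one of these pairs, so their number is the number of swaps
    still to come. *)
Definition coinversions c : {set 'I_n * 'I_n} :=
  [set p : 'I_n * 'I_n | (p.1 < p.2)%N && (c p.1 < c p.2)%N].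

Definition swap_rank c : nat := #|coinversions c|.

Lemma val_adj k (p : 'I_n) : val (adj k p) =
  if p == k :> nat then k.+1 else if p == k.+1 :> nat then val k else val p.
Proof.
rewrite /adj permE /=.
have -> : (p == lpos k) = (p == k :> nat) by [].
have -> : (p == rpos k) = (p == k.+1 :> nat) by [].
by case: ifP => //; case: ifP.
Qed.

Lemma adjK k : involutive (adj k).
Proof. exact: tpermK. Qed.

Lemma swap_atE k c p : swap_at k c p = c (adj k p).
Proof. by rewrite permM. Qed.

Lemma swap_atK k : involutive (@swap_at n k).
Proof. by move=> c; apply/permP => p; rewrite !swap_atE adjK. Qed.

Lemma ascent_swap_at k c : ascent (swap_at k c) k = ~~ ascent c k.
Proof.
rewrite /ascent !swap_atE /adj tpermL tpermR -leqNgt ltn_neqAle.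
by rewrite (inj_eq val_inj) (inj_eq perm_inj) -val_eqE /= neq_ltn ltnSn orbT.
Qed.

Lemma adj_lt k (i j : 'I_n) : (i < j)%N -> (i, j) != (lpos k, rpos k) ->
  (adj k i < adj k j)%N.
Proof.
rewrite xpair_eqE -!val_eqE /= !val_adj /=.
move: (nat_of_ord i) (nat_of_ord j) (nat_of_ord k) => a b d.
by case: (eqVneq a d) => ?; case: (eqVneq b d) => ?; case: (eqVneq a d.+1) => ?;
  case: (eqVneq b d.+1) => ? //=; lia.
Qed.

(** Relabelling positions by [adj k] keeps the order of every pair of positions except the swapped
    one. It therefore maps the coinversions after the swap bijectively onto those before it, apart
    from [(lpos k, rpos k)]. *)
Lemma swap_rank_swap_at k c : ascent c k -> (swap_rank (swap_at k c)).+1 = swap_rank c.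
Proof.
move=> ck; pose f (p : 'I_n * 'I_n) := (adj k p.1, adj k p.2).
have fK : involutive f by move=> [i j]; rewrite /f /= !adjK.
have -> : swap_rank c = #|(lpos k, rpos k) |: (f @: coinversions (swap_at k c))|.
  congr #|pred_of_set _|; apply/setP => -[i j]; rewrite !inE /=.
  rewrite -[X in _ || (X \in _)]fK (mem_imset _ _ (inv_inj fK)) !inE /f /= !swap_atE !adjK.
  have [[-> ->]|ijk] := eqVneq (i, j) (lpos k, rpos k).
    by rewrite /= ltnSn; exact: ck.
  case: (boolP (c i < c j)%N) => cij; rewrite ?andbF ?andbT//=.
  apply/idP/idP => [ij|ij]; first exact: adj_lt.
  rewrite -[i](adjK k) -[j](adjK k); apply: adj_lt => //.
  apply/negP => /eqP[e1 e2]; move: cij ck.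
  rewrite -[i](adjK k) -[j](adjK k) e1 e2 /ascent /adj tpermL tpermR => h1 h2.
  by have := ltn_trans h1 h2; rewrite ltnn.
rewrite cardsU1 card_imset; last exact: inv_inj.
suff -> : (lpos k, rpos k) \notin f @: coinversions (swap_at k c) by [].
apply/imsetP => -[[i j]]; rewrite inE /= => /andP[ij _] /(congr1 f).
rewrite fK /f /adj tpermL tpermR => -[e1 e2].
by move: ij; rewrite -e1 -e2 /= ltnNge leqnSn.
Qed.

Lemma swap_rank_jump c k : k \in swap_effective c ->
  (swap_rank (swap_jump c k)).+1 = swap_rank c.
Proof. by rewrite inE /swap_jump => ck; rewrite ck swap_rank_swap_at. Qed.

Lemma no_ascent_decreasing c : swap_effective c = finset.set0 ->
  forall i j, (c i < c j)%N = (j < i)%N.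
Proof.
move=> c0.
have H (j : nat) (jn : (j < n)%N) (i : 'I_n) : (i < j)%N -> (c (Ordinal jn) < c i)%N.
  elim: j jn => // j IH jn; rewrite ltnS => ij.
  have jn1 : (j < n.-1)%N by case: (n) jn.
  have cj : (c (Ordinal jn) < c (Ordinal (ltnW jn)))%N.
    have := finset.in_set0 (Ordinal jn1); rewrite -c0 inE /ascent => /negbT.
    rewrite -leqNgt leq_eqVlt (inj_eq val_inj) (inj_eq perm_inj).
    have -> : rpos (Ordinal jn1) = Ordinal jn by exact: val_inj.
    have -> : lpos (Ordinal jn1) = Ordinal (ltnW jn) by exact: val_inj.
    by rewrite -val_eqE /= eqn_leq ltnn.
  move: ij; rewrite leq_eqVlt => /predU1P[e|ij].
    by rewrite (_ : i = Ordinal (ltnW jn))//; exact: val_inj.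
  exact: ltn_trans cj (IH (ltnW jn) ij).
have H' (i j : 'I_n) : (i < j)%N -> (c j < c i)%N.
  move=> ij; rewrite [X in (c X < _)%N](_ : j = Ordinal (ltn_ord j)); first exact: H.
  exact: val_inj.
move=> i j; apply/idP/idP; last exact: H'.
case: (ltngtP (i : nat) j) => // [/H'/ltn_trans h /h|/val_inj ->]; by rewrite ltnn.
Qed.

Lemma swap_rank_eq0 c : (swap_rank c == 0%N) = (swap_effective c == finset.set0).
Proof.
rewrite cards_eq0; apply/eqP/eqP => [c0|/no_ascent_decreasing h].
  apply/setP => k; rewrite !inE; apply/negbTE/negP => ck.
  have := finset.in_set0 (lpos k, rpos k); rewrite -c0 inE /= ltnSn.
  by move: ck; rewrite /ascent => ->.
by apply/setP => -[i j]; rewrite !inE /= h; case: ltngtP.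
Qed.

Lemma swap_rank1 : swap_rank 1%g = nbox n.
Proof.
rewrite /swap_rank /nbox -bin2 -triangular_sum big_mkord -sum1_card.
rewrite (eq_bigl (fun p : 'I_n * 'I_n => (p.1 < p.2)%N)); last first.
  by move=> [i j]; rewrite inE /= !perm1 andbb.
rewrite -(pair_big_dep xpredT (fun i j : 'I_n => (i < j)%N) (fun _ _ => 1%N)) /=.
rewrite (exchange_big_dep xpredT) //=; apply: eq_bigr => j _.
by rewrite (big_ord_narrow (ltnW (ltn_ord j))) sum1_card card_ord.
Qed.

Local Notation complete := (complete_word swap_effective swap_jump).
Local Notation swaps := (foldl (fun c k => swap_at k c)).

Lemma foldl_swap_at c (w : seq 'I_n.-1) :
  swaps c w = ((\prod_(k <- w) adj k)^-1 * c)%g.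
Proof.
elim: w c => [|k w IH] c; first by rewrite big_nil invg1 mul1g.
by rewrite /= IH big_cons invMg /swap_at /adj tpermV mulgA.
Qed.

Lemma rev_permE p : rev_perm p = rev_ord p :> 'I_n.
Proof. by rewrite permE. Qed.

Lemma rev_permV : (rev_perm^-1)%g = rev_perm :> 'S_n.
Proof.
apply/permP => p; apply: (@perm_inj _ rev_perm).
by rewrite permKV !rev_permE rev_ordK.
Qed.

(** Executing the swaps multiplies on the left and yields the inverse of the product in the
    definition of [SN]; the reversal is its own inverse. *)
Lemma mem_SN (s : swap_seq) : (s \in SN n) = (swaps 1%g s == rev_perm).
Proof.
by rewrite inE foldl_swap_at mulg1 -(inj_eq invg_inj) rev_permV.
Qed.

Lemma rev_perm_lt (i j : 'I_n) : (rev_perm i < rev_perm j)%N = (j < i)%N.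
Proof.
rewrite !rev_permE /=; have := ltn_ord i; have := ltn_ord j.
by move: (nat_of_ord i) (nat_of_ord j) => a b; lia.
Qed.

Lemma swap_effective0 c : (swap_effective c == finset.set0) = (c == rev_perm).
Proof.
apply/eqP/eqP => [/no_ascent_decreasing h|->].
  by apply: perm_order_inj => i j; rewrite h rev_perm_lt.
apply/setP => k; rewrite !inE /ascent rev_perm_lt /= ltnNge leqnSn.
by [].
Qed.

Lemma complete_word_swaps c w : complete c w -> forall j,
  foldl swap_jump c (take j w) = swaps c (take j w).
Proof.
elim: w c => [|k w IH] c //= /andP[kc cw] [|j] //=.
rewrite IH//; congr (swaps _ _); rewrite /swap_jump.
by move: kc; rewrite inE => ->.
Qed.

Lemma swap_rank_foldl c w : (swap_rank c <= swap_rank (swaps c w) + size w)%N.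
Proof.
elim: w c => [|k w IH] c /=; first by rewrite addn0.
have := IH (swap_at k c); have [ck|nck] := boolP (ascent c k).
  by rewrite -(swap_rank_swap_at ck) addnS ltnS.
have ck : ascent (swap_at k c) k by rewrite ascent_swap_at.
by have := swap_rank_swap_at ck; rewrite swap_atK => <-; lia.
Qed.

(** No letter can be wasted: a letter lowers the rank by at most 1, and one that is not an ascent
    raises it, after which the remaining letters are too few to reach rank 0. *)
Lemma complete_word_rank c w :
  swap_rank (swaps c w) = 0%N -> size w = swap_rank c -> complete c w.
Proof.
elim: w c => [|k w IH] c /= r0 sw; first by rewrite -swap_rank_eq0 -sw.
rewrite inE; have [ck|nck] := boolP (ascent c k).
  rewrite /swap_jump ck; apply: IH => //.
  by apply: succn_inj; rewrite sw (swap_rank_swap_at ck).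
have ck : ascent (swap_at k c) k by rewrite ascent_swap_at.
have := swap_rank_swap_at ck; rewrite swap_atK.
by have := swap_rank_foldl (swap_at k c) w; lia.
Qed.

Lemma complete_word1 w :
  complete 1%g w = (size w == nbox n) && (swaps 1%g w == rev_perm).
Proof.
apply/idP/andP => [cw|[/eqP sw /eqP rw]].
  rewrite (size_complete_word swap_rank_jump swap_rank_eq0 cw) swap_rank1 eqxx.
  split=> //; rewrite -swap_effective0 -{1}(take_size w) -(complete_word_swaps cw).
  rewrite take_size; elim: w (1%g : 'S_n) cw => //= k w IH c /andP[_]; exact: IH.
apply: complete_word_rank; last by rewrite sw swap_rank1.
by apply/eqP; rewrite swap_rank_eq0 swap_effective0 rw.
Qed.

Lemma words_SN :
  perm_eq (words swap_effective swap_jump swap_rank 1%g)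
          [seq tval s | s in SN n].
Proof.
apply: uniq_perm.
- exact: words_uniq.
- by rewrite map_inj_uniq ?enum_uniq//; exact: val_inj.
move=> w; rewrite (mem_words swap_rank_jump swap_rank_eq0) complete_word1.
apply/andP/mapP => [[sw rw]|[s]].
  by exists (Tuple sw) => //; rewrite mem_enum mem_SN.
by rewrite mem_enum mem_SN => rs ->; rewrite size_tuple eqxx.
Qed.

Definition osp_last (w : seq 'I_n.-1) k : nat :=
  \max_(0 <= j < size w | onth w j == Some k) j.+1.

Lemma last_swapE (s : swap_seq) k : last_swap s k = osp_last s k.
Proof.
rewrite /osp_last big_mkord size_tuple /last_swap; apply: eq_bigl => j.
apply/eqP/eqP => [<-|/(onth_nth k)]; last by rewrite -tnth_nth.
by rewrite onthE (nth_map (tnth s j)) ?size_tuple// -tnth_nth.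
Qed.

Lemma sn_degE (s : swap_seq) j : s \in SN n ->
  sn_deg s j = word_degree swap_effective swap_jump 1%g s j.
Proof.
move=> sSN; rewrite /sn_deg /word_degree complete_word_swaps//.
by rewrite complete_word1 size_tuple eqxx -mem_SN.
Qed.

Section OspLast.
Variable w : seq 'I_n.-1.
Hypothesis cw : complete 1%g w.

Lemma osp_last_le k : (osp_last w k <= size w)%N.
Proof. by rewrite /osp_last big_mkord; apply/bigmax_leqP => j _; exact: ltn_ord. Qed.

Lemma le_osp_last k j : onth w j = Some k -> (j.+1 <= osp_last w k)%N.
Proof.
move=> jk; have jw : (j < size w)%N by rewrite -onthTE jk.
rewrite /osp_last big_mkord.
by rewrite (@leq_bigmax_cond _ _ (fun i : 'I_(size w) => i.+1) (Ordinal jw))//= jk.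
Qed.

Lemma osp_lastP k : k \in w -> exists2 j, osp_last w k = j.+1 & onth w j = Some k.
Proof.
move=> /onthP[i ik]; have iw : (i < size w)%N by rewrite -onthTE ik.
rewrite /osp_last big_mkord.
have [|j jk ->] := @eq_bigmax_cond _ (fun j : 'I_(size w) => onth w j == Some k)
   (fun j : 'I_(size w) => j.+1).
  by apply/card_gt0P; exists (Ordinal iw); rewrite unfold_in /= ik.
by exists j => //; apply/eqP.
Qed.

(** If [k] never occurred, no label could cross from the positions up to [k] to those beyond,
    whereas the reversal puts the largest label in the first position. *)
Lemma complete_word_mem k : k \in w.
Proof.
have /andP[_ /eqP wr] : (size w == nbox n) && (swaps 1%g w == rev_perm).
  by rewrite -complete_word1.
apply: contraT => kw.
have H (u : seq 'I_n.-1) (c : 'S_n) : k \notin u ->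
    (forall p : 'I_n, p <= k -> c p <= k)%N ->
    forall p : 'I_n, (p <= k -> swaps c u p <= k)%N.
  elim: u c => //= e u IH c; rewrite inE negb_or => /andP[ke ku] h.
  apply: IH => // p pk; rewrite swap_atE; apply: h; rewrite val_adj.
  move: ke pk; rewrite -val_eqE /=.
  move: (nat_of_ord p) (nat_of_ord k) (nat_of_ord e) => a b d.
  by case: (eqVneq a d) => ?; case: (eqVneq a d.+1) => ? //=; lia.
have n0 : (0 < n)%N.
  by apply: leq_trans (leq_pred n); apply: leq_ltn_trans (ltn_ord k).
have h1 (p : 'I_n) : (p <= k -> (1%g : 'S_n) p <= k)%N by rewrite perm1.
have := H w 1%g kw h1 (Ordinal n0) isT.
by rewrite wr rev_permE /= subn1 leqNgt ltn_ord.
Qed.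

Lemma osp_last_inj : injective (osp_last w).
Proof.
move=> k l; have [j -> jk] := osp_lastP (complete_word_mem k).
have [i -> il] := osp_lastP (complete_word_mem l).
by move=> [ji]; move: jk; rewrite ji il => -[].
Qed.

Lemma osp_last_gt0 k : (0 < osp_last w k)%N.
Proof. by have [j ->] := osp_lastP (complete_word_mem k). Qed.

Lemma osp_last_max : w != [::] -> exists k, osp_last w k = size w.
Proof.
case: (lastP w) le_osp_last osp_last_le => // u k h1 h2 _; exists k.
apply/eqP; rewrite eqn_leq h2 /= size_rcons h1//.
by rewrite -cats1 onth_cat ltnn subnn.
Qed.

End OspLast.

End SwapChain.

(** * The swap process followed along a run *)

Section OspRun.
Context {R : realType} {n : nat}.
Local Notation K := 'I_n.-1.
Local Notation S := (@config R (K * nat)%type).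
Local Open Scope classical_set_scope.
Implicit Types (x : S) (st : @osp_state n) (k : K).

Definition clocks x : K -> nat -> R := fun k r => x (k, r).

(* The configuration seen from the state [st] reached at time [tau]. *)
Definition residual x st (tau : R) : S := fun p =>
  if p.2 == 0%N then next_ring (clocks x) st p.1 - tau
  else x (p.1, rings st p.1 + p.2)%N.

Lemma residual_init x : residual x (OspState (fun=> 0%N) 1%g) 0 = x.
Proof.
apply/funext => -[k [|r]]; rewrite /residual /=; last by rewrite add0n.
by rewrite subr0 /next_ring /ring_time /= big_ord1.
Qed.

Lemma next_clock_first x st tau k :
  rings_first (swap_active (labels st)) k (residual x st tau) ->
  next_clock (clocks x) st = Some k.
Proof.
move=> /andP[_ /forall_inP h].
have lt l : l != k -> next_ring (clocks x) st k < next_ring (clocks x) st l.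
  by move=> lk; have := h l; rewrite !inE lk /residual /= ltrD2r; exact.
rewrite /next_clock; case: pickP => [l /forallP hl|/(_ k)/negbT/forallPn[l]].
  by have [->//|/lt] := eqVneq l k; rewrite ltNge hl.
by have [->|/lt/ltW ->//] := eqVneq l k; rewrite lexx.
Qed.

(** The absolute ring times of the process and the remaining waiting times of the chain agree: a
    ring of [k] moves the origin of time to that ring and, for [k] alone, brings the next waiting
    time forward. *)
Lemma advance_residual x st tau k : next_clock (clocks x) st = Some k ->
  advance (swap_active (labels st)) k (residual x st tau) =
  residual x (osp_step (clocks x) st) (next_ring (clocks x) st k).
Proof.
move=> ck; apply/funext => -[l r].
rewrite /advance /age /refresh /residual /osp_step ck /= !inE andbT.
have [->|lk] := eqVneq l k.
  case: r => [|r] /=; last by congr (x (_, _)); lia.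
  by rewrite add0n /next_ring /ring_time /= eqxx !addn1 [in RHS]big_ord_recr /= addrAC subrr add0r.
rewrite addn0; case: r => [|r] /=; last by rewrite addn0.
rewrite /next_ring /ring_time /= (negbTE lk) addn0.
by rewrite opprB addrA subrK.
Qed.

Definition swaps_from x st k : set R :=
  [set t | exists r, let st' := iter r (osp_step (clocks x)) st in
    [/\ next_clock (clocks x) st' = Some k, ascent (labels st') k
      & t = next_ring (clocks x) st' k]].

Lemma swaps_from_step x st k :
  swaps_from x st k =
  [set t | [/\ next_clock (clocks x) st = Some k, ascent (labels st) k
      & t = next_ring (clocks x) st k]] `|` swaps_from x (osp_step (clocks x) st) k.
Proof.
apply/seteqP; split=> t /=.
  by move=> [[|r]] h; [left|right; exists r; rewrite -iterSr].
by move=> [h|[r h]]; [exists 0%N|exists r.+1; rewrite iterSr].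
Qed.

Lemma labels_osp_step x st : labels (osp_step (clocks x) st) =
  if next_clock (clocks x) st is Some k then swap_jump (labels st) k else labels st.
Proof. by rewrite /osp_step; case: next_clock. Qed.

Lemma swaps_from_final x st k : swap_effective (labels st) = finset.set0 ->
  swaps_from x st k = set0.
Proof.
move=> E0; have lab r : labels (iter r (osp_step (clocks x)) st) = labels st.
  elim: r => //= r IH; rewrite labels_osp_step; case: next_clock => // l.
  have := finset.in_set0 l; rewrite -E0 inE IH /swap_jump => ->.
  by [].
rewrite -subset0 => t [r [_]]; rewrite lab => ak _.
by have := finset.in_set0 k; rewrite -E0 inE ak.
Qed.

Local Notation osp_run := (run swap_active swap_effective swap_jump).

Definition jump_times (tau : R) (p : seq (K * R)) k : set R :=
  [set t | exists i, onth (unzip1 p) i = Some k /\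
     t = tau + \sum_(j < i.+1) nth 0 (unzip2 p) j].

Lemma jump_times_nil tau k : jump_times tau [::] k = set0.
Proof. by rewrite -subset0 => t [i]; rewrite onth0n => -[]. Qed.

Lemma jump_times_cons tau l h p k :
  jump_times tau ((l, h) :: p) k =
  [set t | l = k /\ t = tau + h] `|` jump_times (tau + h) p k.
Proof.
apply/seteqP; split=> t /=.
  move=> [[|i]] [/= e ->]; [left|right].
    by case: e => ->; rewrite big_ord1.
  by exists i; rewrite big_ord_recl /= addrA.
move=> [[-> ->]|[i [e ->]]]; [exists 0%N|exists i.+1].
  by rewrite big_ord1.
by split=> //; rewrite [in RHS]big_ord_recl /= addrA.
Qed.

Lemma jump_times_delay tau u p k :
  jump_times tau (delay u p) k = jump_times (tau + u) p k.
Proof.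
by case: p => [|[l h] p] /=; rewrite ?jump_times_nil// !jump_times_cons addrA.
Qed.

(** Induction along the run: an effective ring contributes its own time, while an ineffective one
    only moves the time origin, which is what [delay] records. After the last effective ring no
    ascent is left, so later rings contribute nothing. *)
Lemma swaps_from_run m x st tau p k :
  osp_run m (labels st) (residual x st tau) = Some p ->
  swaps_from x st k = jump_times tau p k.
Proof.
have nil_case : swap_effective (labels st) == finset.set0 -> Some [::] = Some p ->
    swaps_from x st k = jump_times tau p k.
  by move=> /eqP E0 [<-]; rewrite swaps_from_final// jump_times_nil.
elim: m st tau p nil_case => [|m IH] st tau p nil_case /=.
  by case: ifP => // E0; exact: nil_case.
case: ifP => [E0|En0]; first exact: nil_case.
case: pickP => // l /andP[_ lf]; have lc := next_clock_first lf.
have res0 : residual x st tau (l, 0%N) = next_ring (clocks x) st l - tau by [].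
rewrite (advance_residual _ lc); set st' := osp_step _ st.
have labE : labels st' = swap_jump (labels st) l by rewrite labels_osp_step lc.
rewrite swaps_from_step.
have IH' q : osp_run m (labels st') (residual x st' (next_ring (clocks x) st l)) = Some q ->
    swaps_from x st' k = jump_times (next_ring (clocks x) st l) q k.
  by apply: IH => /eqP E0 [<-]; rewrite swaps_from_final// jump_times_nil.
case: ifPn => lE.
  rewrite -labE; case: (osp_run _ _ _) IH' => //= q /(_ q erefl) -> [<-].
  rewrite jump_times_cons res0 addrC subrK; congr (_ `|` _).
  apply/seteqP; split=> t /=; first by rewrite lc => -[[->] _ ->].
  by move: lE; rewrite inE => al [<- ->]; rewrite lc.
have sl : swap_jump (labels st) l = labels st.
  by move: lE; rewrite inE /swap_jump => /negbTE ->.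
rewrite -[in osp_run _ _ _]sl -labE.
case: (osp_run _ _ _) IH' => //= q /(_ q erefl) -> [<-].
rewrite jump_times_delay res0 addrC subrK -[RHS]set0U; congr (_ `|` _).
rewrite -subset0 => t /= [+ al _]; rewrite lc => -[lk].
by move: lE; rewrite inE lk al.
Qed.

(** Holding times are positive, so the supremum is attained at the last occurrence of [k]; an
    occurrence exists by assumption. *)
Lemma sup_jump_times p k : (forall t, t \in unzip2 p -> 0 < t) ->
  k \in unzip1 p ->
  sup (jump_times 0 p k) = \sum_(j < osp_last (unzip1 p) k) nth 0 (unzip2 p) j.
Proof.
move=> p0 kp; have [i iE ik] := osp_lastP kp.
have mono a b : (a <= b <= size p)%N ->
    \sum_(j < a) nth 0 (unzip2 p) j <= \sum_(j < b) nth 0 (unzip2 p) j.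
  move=> /andP[ab bp]; rewrite -!(big_mkord xpredT (fun j => nth 0 (unzip2 p) j)).
  rewrite (@big_cat_nat _ _ _ a 0 b)//= lerDl big_nat_cond; apply: sumr_ge0.
  move=> j /andP[/andP[_ jb] _]; apply/ltW/p0/mem_nth.
  by rewrite size_map (leq_trans jb).
apply/eqP; rewrite eq_le; apply/andP; split.
  apply: sup_le_ub; first by exists (0 + \sum_(j < i.+1) nth 0 (unzip2 p) j), i.
  move=> t [a [ak ->]]; rewrite add0r; apply: mono.
  by rewrite (le_osp_last ak) -[X in (_ <= X)%N](size_map fst) osp_last_le.
apply: sup_upper_bound; last by exists i; rewrite add0r iE.
split; first by exists (0 + \sum_(j < i.+1) nth 0 (unzip2 p) j), i.
exists (\sum_(j < size p) nth 0 (unzip2 p) j) => t [a [ak ->]]; rewrite add0r.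
apply: mono; rewrite leqnn andbT.
by rewrite -(size_map fst) -onthTE ak.
Qed.

Lemma last_swap_times_run m x p :
  osp_run m 1%g x = Some p -> forall k,
  tnth (last_swap_times (clocks x)) k =
  \sum_(j < osp_last (unzip1 p) k) nth 0 (unzip2 p) j.
Proof.
move=> rp k; rewrite tnth_mktuple.
rewrite -sup_jump_times; last 2 first.
- by move=> t; exact: (run_gt0 rp).
- by apply: complete_word_mem; exact: (run_complete rp).
by congr sup; rewrite -(@swaps_from_run m x (OspState (fun=> 0%N) 1%g)) ?residual_init.
Qed.

End OspRun.

Lemma measurable_exists d (T : measurableType d) (I : finType)
    (b : I -> T -> bool) :
  (forall i, measurable_fun setT (b i)) ->
  measurable_fun setT (fun x => [exists i, b i x]).
Proof.
move=> mb; rewrite (_ : (fun _ => _) = fun x => ~~ [forall i, ~~ b i x]).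
  by apply: measurable_neg; apply: measurable_forall => i; exact: measurable_neg.
by apply/funext => x; rewrite negb_forall; apply: eq_existsb => i; rewrite negbK.
Qed.

(** The choice depends on [x] only through the finite pattern of truth values [f], and each pattern
    defines a measurable event. *)
Lemma measurable_pick d (T : measurableType d) (I : finType)
    (b : I -> T -> bool) (o : option I) :
  (forall i, measurable_fun setT (b i)) ->
  measurable_fun setT (fun x => [pick i | b i x] == o).
Proof.
move=> mb; rewrite (_ : (fun _ => _) = fun x =>
    [exists f : {ffun I -> bool}, ([pick i | f i] == o) && [forall i, b i x == f i]]).
  apply: measurable_exists => f; apply: measurable_and; first exact: measurable_cst.
  apply: measurable_forall => i.
  by apply: (@measurableT_comp _ _ _ _ _ _ (fun c : bool => c == f i)).
apply/funext => x; apply/idP/existsP => [bo|[f /andP[fo /forallP bf]]].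
  exists [ffun i => b i x]; apply/andP; split; last by apply/forallP => i; rewrite ffunE.
  by rewrite (eq_pick (ffunE _)).
by rewrite (eq_pick (fun i => eqP (bf i))).
Qed.

Lemma measurable_pred_set d (T : measurableType d) (b : T -> bool) :
  measurable_fun setT b -> measurable [set x | b x]%classic.
Proof.
by move=> mb; rewrite -[X in measurable X]setTI; exact: (mb measurableT [set true]%classic I).
Qed.

(** * Measurability of the last swap times *)

Section OspMeasurable.
Context {R : realType} {n : nat}.
Local Notation K := 'I_n.-1.
Local Notation S := (@config R (K * nat)%type).
Implicit Types (x : S) (st : @osp_state n) (k : K).

Lemma measurable_next_ring st k :
  measurable_fun setT (fun x : S => next_ring (clocks x) st k).
Proof.
by rewrite /next_ring /ring_time; apply: measurable_sum => i; exact: measurable_coord.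
Qed.

Lemma measurable_next_clock st o :
  measurable_fun setT (fun x : S => next_clock (clocks x) st == o).
Proof.
apply: measurable_pick => k; apply: measurable_forall => l.
by apply: measurable_fun_ler; exact: measurable_next_ring.
Qed.

Definition clock_step (o : option K) st : @osp_state n :=
  if o is Some k then
    OspState (fun l => (rings st l + (l == k))%N)
             (if ascent (labels st) k then swap_at k (labels st) else labels st)
  else st.

(** From a given state the next one is determined by the value of [next_clock], which takes finitely
    many values; splitting over them fixes the state before the induction hypothesis is applied. *)
Lemma measurable_iter_osp_step (b : @osp_state n -> S -> bool) r st :
  (forall st', measurable_fun setT (b st')) ->
  measurable_fun setT (fun x : S => b (iter r (osp_step (clocks x)) st) x).
Proof.
move=> mb; elim: r st => [|r IH] st /=; first exact: mb.
rewrite (_ : (fun _ => _) = fun x => [exists o : option K,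
    (next_clock (clocks x) st == o) &&
    b (iter r (osp_step (clocks x)) (clock_step o st)) x]).
  apply: measurable_exists => o; apply: measurable_and; last exact: IH.
  exact: measurable_next_clock.
apply/funext => x; rewrite -iterS iterSr /osp_step -/(osp_step (clocks x)).
apply/idP/existsP => [h|[q /andP[/eqP qE h]]]; last by rewrite -qE in h.
by exists (next_clock (clocks x) st); rewrite eqxx.
Qed.

Lemma swap_rank_osp_step x st :
  (swap_rank (labels (osp_step (clocks x) st)) <= swap_rank (labels st))%N.
Proof.
rewrite labels_osp_step; case: next_clock => // k; rewrite /swap_jump.
by case: ifP => // ak; rewrite -(swap_rank_swap_at ak).
Qed.

(** Every swap lowers [swap_rank], so only finitely many occur, whatever the configuration. Some
    swap of [k] is singled out; the later ones are bounded by induction on the rank. *)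
Lemma swaps_from_bounded x st k : exists B, ubound (swaps_from x st k) B.
Proof.
move: {2}(swap_rank (labels st)).+1 (ltnSn (swap_rank (labels st))) => N.
elim: N st => // N IH st rN.
have [[r [rk ra]]|no] := pselect (exists r, let st' := iter r (osp_step (clocks x)) st in
    next_clock (clocks x) st' = Some k /\ ascent (labels st') k); last first.
  by exists 0 => t [r [rk ra _]]; case: no; exists r.
have decr i st' : (swap_rank (labels (iter i (osp_step (clocks x)) st')) <= swap_rank (labels st'))%N.
  by elim: i => //= i; apply: leq_trans; exact: swap_rank_osp_step.
have [|B hB] := IH (iter r.+1 (osp_step (clocks x)) st).
  apply: (@leq_trans (swap_rank (labels (iter r (osp_step (clocks x)) st)))).
    by rewrite /= labels_osp_step rk /swap_jump ra swap_rank_swap_at.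
  by apply: leq_trans (decr _ _) _.
(* Arbitrary configurations may contain negative waiting times, for which ring times need not
   increase; absolute values cover this case too. *)
exists (`|B| + \sum_(i < r.+1) `|next_ring (clocks x) (iter i (osp_step (clocks x)) st) k|).
move=> t [i [ik ia ->]]; have [ir|ri] := ltnP i r.+1.
  rewrite (bigD1 (Ordinal ir))//= addrCA.
  apply: (le_trans (ler_norm _)); rewrite lerDl addr_ge0//.
  by apply: sumr_ge0.
apply: (@le_trans _ _ `|B|); last by rewrite lerDl; apply: sumr_ge0.
apply: le_trans (ler_norm _); apply: hB; exists (i - r.+1)%N.
by rewrite -iterD subnK.
Qed.

Lemma measurable_last_swap_times :
  measurable_fun setT (fun x : S => last_swap_times (clocks x)).
Proof.
apply/measurable_fun_tnthP => k; rewrite /comp.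
under eq_fun do rewrite tnth_mktuple.
apply: (@measurability _ _ _ R _ _ (@RGenOInfty.G R)); first exact: RGenOInfty.measurableE.
move=> _ [_ [a ->] <-]; rewrite setTI.
pose st0 := @OspState n (fun=> 0%N) 1%g.
pose b0 st x := (next_clock (clocks x) st == Some k) && ascent (labels st) k.
pose b1 st x := b0 st x && (a < next_ring (clocks x) st k).
have mb0 st : measurable_fun setT (b0 st).
  apply: measurable_and; last exact: measurable_cst.
  exact: measurable_next_clock.
have mb1 st : measurable_fun setT (b1 st).
  apply: measurable_and => //; apply: measurable_fun_ltr => //.
  exact: measurable_next_ring.
have m0 r := measurable_pred_set (@measurable_iter_osp_step b0 r st0 mb0).
have m1 r := measurable_pred_set (@measurable_iter_osp_step b1 r st0 mb1).
set A0 := (fun r => [set x | b0 (iter r (osp_step (clocks x)) st0) x]%classic) in m0.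
set A1 := (fun r => [set x | b1 (iter r (osp_step (clocks x)) st0) x]%classic) in m1.
(* The supremum exceeds [a] when some swap time does. If [k] never swaps, the supremum of the empty
   set is 0, which exceeds [a] exactly when [a < 0]. *)
rewrite (_ : (_ @^-1` _)%classic = (\bigcup_r A1 r `|`
    (if a < 0 then ~` (\bigcup_r A0 r) else set0))%classic).
  apply: measurableU; first by apply: bigcup_measurable => r _; exact: m1.
  case: ifP => // _; apply: measurableC.
  by apply: bigcup_measurable => r _; exact: m0.
apply/seteqP; split=> x /=; rewrite in_itv/= andbT.
  have [[r rA0]|no] := pselect (exists r, A0 r x); last first.
    rewrite (_ : swap_times (clocks x) k = set0) ?sup0; last first.
      rewrite -subset0 => t [r [rk ra _]]; apply: no; exists r.
      by rewrite /A0 /= /b0 ra andbT; apply/eqP.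
    by move=> a0; right; rewrite a0 => -[r _ rA0]; apply: no; exists r.
  move=> asup; left.
  have ne : (swap_times (clocks x) k !=set0)%classic.
    by case/andP: rA0 => /eqP rk ra; eexists; exists r; split; [exact: rk|exact: ra|].
  have [t [i [ik ia ->]] at_] : exists2 t, swap_times (clocks x) k t & a < t.
    by apply: sup_gt.
  by exists i => //; rewrite /A1 /= /b1 /b0 ia andbT at_ andbT; apply/eqP.
move=> [[r _ /andP[/andP[/eqP rk ra] ar]]|].
  apply: (lt_le_trans ar); apply: sup_upper_bound; last by exists r.
  split; first by eexists; exists r; split; [exact: rk|exact: ra|].
  exact: (swaps_from_bounded x st0 k).
case: ifP => // a0 no; rewrite (_ : swap_times (clocks x) k = set0) ?sup0//.
rewrite -subset0 => t [r [rk ra _]]; apply: no; exists r => //.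
by rewrite /A0 /= /b0 ra andbT; apply/eqP.
Qed.

End OspMeasurable.

Section OspLaplace.
Context {R : realType} {n : nat}.
Hypothesis n2 : (2 <= n)%N.
Local Notation S := (@config R ('I_n.-1 * nat)%type).
Variables (M : probability S R) (iidM : iid_law M).

Lemma integral_laplace_osp (c : 'S_n.-1) (y : nat -> nat) :
  (\int[M]_x (laplace c (fun r => (y r)%:R%R) (last_swap_times (clocks x)))%:E =
  (\sum_(s in SN n | sn_perm s == c)
     rate_value (last_swap s) (sn_deg s) (fun k => y k))%:E)%E.
Proof.
have sz w : complete_word swap_effective swap_jump (1%g : 'S_n) w ->
    size w = swap_rank (1%g : 'S_n).
  exact: (size_complete_word swap_rank_jump swap_rank_eq0).
rewrite (@integral_laplace_run R _ _ n.-1 swap_active swap_effective swap_jump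
  swap_rank (fun s => finset.subsetT _) swap_rank_jump swap_rank_eq0 1%g osp_last _ _ _ _
  (fun x => last_swap_times (clocks x)) measurable_last_swap_times _ M iidM c y).
- congr EFin.
  rewrite (perm_big _ words_SN) big_map big_enum_cond /=.
  apply: eq_big => s.
    case: (boolP (s \in SN n)) => //= sSN; congr (_ == c).
    by congr order_perm; apply/funext => k; rewrite last_swapE.
  move=> /andP[sSN _]; congr rate_value.
    by apply/funext => k; rewrite last_swapE.
  by apply/funext => j; rewrite sn_degE.
- by move=> w cw; exact: osp_last_inj.
- by move=> w k cw; exact: osp_last_gt0.
- by move=> w k cw; rewrite -(sz _ cw); exact: osp_last_le.
- move=> w cw; rewrite -(sz _ cw); apply: osp_last_max.
  apply/eqP => w0; have := sz _ cw; rewrite w0 swap_rank1 /= /nbox.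
  by case: (n) n2 => [|[|m]] // _; rewrite mulSn /= ; lia.
- by move=> i x p rp k; exact: (last_swap_times_run rp).
Qed.

End OspLaplace.

(** * The growth process and last passage percolation *)

Section GrowthChain.
Context {n : nat}.
Local Notation box := (@box n).
Implicit Types (D : {set box}) (b c k : box).

Let inDE := (finset.in_setD, finset.in_setU1, finset.in_set1).

Definition northwest c b : bool := (c.1 <= b.1)%N && (c.2 <= b.2)%N.

(* On Young diagrams [D] these are the boxes that can be added to [D]; the
   definition is such that it is nonempty for every [D] not covering the
   staircase. *)
Definition addable (D : {set box}) : {set box} :=
  [set b in staircase | (b \notin D) &&
    [forall c in staircase, northwest c b && (c != b) ==> (c \in D)]].

Definition add_box (D : {set box}) (b : box) : {set box} := b |: D.

Definition missing D : nat := #|staircase :\: D|.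

Lemma addableP D b : reflect
  [/\ b \in staircase, b \notin D &
      forall c, c \in staircase -> northwest c b -> c != b -> c \in D]
  (b \in addable D).
Proof.
apply: (iffP idP) => [/finset.setIdP[bs /andP[bD /forall_inP h]]|[bs bD h]].
  by split=> // c cs cb cb'; have := h c cs; rewrite cb cb'; exact.
apply/finset.setIdP; split=> //; rewrite bD /=.
by apply/forall_inP => c cs; apply/implyP => /andP[]; exact: h.
Qed.

Lemma missing_add_box D b : b \in addable D -> (missing (add_box D b)).+1 = missing D.
Proof.
move=> /addableP[bs bD _]; rewrite /missing /add_box (cardsD1 b (staircase :\: D)).
rewrite finset.in_setD bD bs add1n; congr _.+1; apply: eq_card => c.
by rewrite !inDE negb_or -andbA.
Qed.

Lemma northwest_lt c b : northwest c b -> c != b -> (c.1 + c.2 < b.1 + b.2)%N.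
Proof.
case: c b => [c1 c2] [b1 b2]; rewrite /northwest xpair_eqE -!val_eqE /=.
by move: (nat_of_ord c1) (nat_of_ord c2) (nat_of_ord b1) (nat_of_ord b2) => *; lia.
Qed.

Lemma missing_eq0 D : (missing D == 0%N) = (addable D == finset.set0).
Proof.
rewrite cards_eq0; apply/eqP/eqP => h.
  apply/setP => b; rewrite finset.in_set0; apply/negP => /addableP[bs bD _].
  by have := finset.in_set0 b; rewrite -h !inDE bD bs.
apply/setP => b; rewrite finset.in_set0; apply/negP => bD.
(* A missing box with the least sum of coordinates is addable, since every other box northwest of it
   has a smaller sum. *)
have [a aD amin] := @arg_minnP _ b (mem (staircase :\: D)) (fun c => c.1 + c.2)%N bD.
have := finset.in_set0 a; rewrite -h => /negP; apply; apply/addableP.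
move: aD; rewrite /= !inDE => /andP[aD sa]; split=> //.
move=> c cs ca ca'; apply: contraT => cD.
by have := amin c; rewrite /= !inDE cD cs => /(_ isT); rewrite leqNgt northwest_lt.
Qed.

Local Notation complete := (complete_word addable add_box).

Lemma foldl_add_box D w b : (b \in foldl add_box D w) = (b \in D) || (b \in w).
Proof.
elim: w D => [|k w IH] D /=; first by rewrite orbF.
by rewrite IH /add_box !inDE inE orbCA orbA.
Qed.

Lemma complete_word_mem_box D w b : complete D w ->
  (b \in w) = (b \in staircase) && (b \notin D).
Proof.
elim: w D => [|k w IH] D /=.
  rewrite -missing_eq0 cards_eq0 => /eqP h.
  by have := finset.in_set0 b; rewrite -h !inDE andbC in_nil.
move=> /andP[/addableP[ks kD _] cw]; rewrite inE (IH _ cw) /add_box !inDE negb_or.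
by have [->|bk] //= := eqVneq b k; rewrite ks kD.
Qed.

Lemma complete_word_uniq D w : complete D w -> uniq w.
Proof.
elim: w D => [|k w IH] D //= /andP[_ cw]; rewrite (IH _ cw) andbT.
by rewrite (complete_word_mem_box _ cw) /add_box !inDE eqxx andbF.
Qed.

Lemma complete_word_northwest D w b c : complete D w -> b \in w -> c \in staircase ->
  northwest c b -> c != b -> c \notin D -> (index c w < index b w)%N.
Proof.
elim: w D => [|k w IH] D //= /andP[/addableP[ks kD kmin] cw].
have [<-|kb] := eqVneq k b.
  by move=> _ cs cb cnb cD; rewrite (kmin c) in cD.
rewrite inE eq_sym (negbTE kb) /= => bw cs cb cnb cD.
have [_ //|kc] := eqVneq k c.
rewrite ltnS; apply: (IH _ cw) => //.
by rewrite /add_box !inDE negb_or eq_sym kc.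
Qed.

(** Together with [complete_word_northwest] this identifies the complete words with the linear
    extensions of the northwest order on the missing boxes. *)
Lemma linear_extension_complete D w : uniq w ->
  (forall b, (b \in w) = (b \in staircase) && (b \notin D)) ->
  (forall b c, b \in w -> c \in staircase -> northwest c b -> c != b ->
     c \notin D -> (index c w < index b w)%N) ->
  complete D w.
Proof.
elim: w D => [|k w IH] D /=.
  move=> _ h _; rewrite -missing_eq0 cards_eq0; apply/eqP/setP => b.
  by have := h b; rewrite !inDE finset.in_set0 in_nil andbC => <-.
move=> /andP[kw uw] mw hw.
have /andP[ks kD] : (k \in staircase) && (k \notin D) by rewrite -mw inE eqxx.
apply/andP; split.
  apply/addableP; split=> // c cs ck cnk; apply: contraT => cD.
  by have := hw k c; rewrite inE eqxx ltn0 => /(_ isT cs ck cnk cD).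
apply: IH => // [b|b c bw cs cb cnb].
  have := mw b; rewrite inE /add_box !inDE negb_or; have [->|bk] //= := eqVneq b k.
  by rewrite (negbTE kw) andbF.
rewrite /add_box !inDE negb_or => /andP[ck cD].
have := hw b c; rewrite inE bw orbT => /(_ isT cs cb cnb cD).
rewrite eq_sym (negbTE ck); case: eqP => // kb.
Qed.

(** The pairs of positions a < b correspond to the boxes (a+1, b-a), which carries the count over
    from [swap_rank1]. *)
Lemma card_staircase : #|@staircase n| = nbox n.
Proof.
rewrite -swap_rank1 /swap_rank.
pose g (p : 'I_n * 'I_n) : box := (inord p.1.+1, inord (p.2 - p.1)%N).
rewrite -(card_in_imset (f := g)); last first.
  move=> [a b] [a' b']; rewrite !inE !perm1 /= !andbb => ab ab' [].
  move=> /(congr1 val) /=; rewrite !inordK ?ltnS// => -[e1].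
  move=> /(congr1 val) /=; rewrite !inordK ?ltnS; last 2 first.
  - by apply: leq_trans (ltnW (ltn_ord b')); exact: leq_subr.
  - by apply: leq_trans (ltnW (ltn_ord b)); exact: leq_subr.
  move=> e2; congr (_, _); apply: val_inj => //=.
  by move: e1 e2 ab ab'; move: (nat_of_ord a) (nat_of_ord b) (nat_of_ord a') (nat_of_ord b'); lia.
apply: eq_card => -[i j]; apply/idP/imsetP => [|[[a b]]].
  rewrite inE /= => /and3P[i0 j0 ij].
  have i1 : (i.-1 < n)%N by lia.
  have j1 : ((i + j).-1 < n)%N by lia.
  exists (Ordinal i1, Ordinal j1); first by rewrite inE !perm1 /= andbb; lia.
  rewrite /g /=; congr (_, _); apply: val_inj; rewrite /= inordK; lia.
rewrite inE !perm1 /= andbb => ab [-> ->]; rewrite inE /=.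
have bn := ltn_ord b; rewrite !inordK; lia.
Qed.

Lemma missing0 : missing finset.set0 = nbox n.
Proof. by rewrite /missing finset.setD0 card_staircase. Qed.

End GrowthChain.

Lemma last_passageS (R : realType) (x : nat -> nat -> R) i j :
  last_passage x i.+1 j.+1 =
  Num.max (last_passage x i j.+1) (last_passage x i.+1 j) + x i j.
Proof. by []. Qed.

Lemma last_passage0 (R : realType) (x : nat -> nat -> R) i : last_passage x i 0 = 0.
Proof. by case: i. Qed.

(** * Last passage times along a run of the growth process *)

Section LastPassageRun.
Context {R : realType} {n : nat}.
Local Notation box := (@box n).
Local Notation S := (@config R (box * nat)%type).
Implicit Types (D : {set box}) (b c k : box) (x : S).

Let inDE := (finset.in_setD, finset.in_setU1, finset.in_set1).

Definition box_weight x (i j : nat) : R := x ((inord i.+1, inord j.+1), 0%N).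

Definition passage x b : R := last_passage (box_weight x) b.1 b.2.

Lemma staircaseP b : (b \in staircase) = [&& (0 < b.1)%N, (0 < b.2)%N & (b.1 + b.2 <= n)%N].
Proof. by rewrite finset.in_set. Qed.

Lemma passageE x b : b \in staircase -> passage x b =
  Num.max (last_passage (box_weight x) b.1.-1 b.2)
          (last_passage (box_weight x) b.1 b.2.-1) + x (b, 0%N).
Proof.
rewrite staircaseP /passage => /and3P[b1 b2 _].
rewrite -{1}(prednK b1) -{1}(prednK b2) last_passageS !prednK//; congr (_ + _).
by rewrite /box_weight !prednK// !inord_val -surjective_pairing.
Qed.

(** The recursion only looks at the upper and the left neighbour of [b]. If no other box lies
    between [c] and [b], then [c] must be one of these two, so the maximum in the recursion is
    attained there. In the second alternative [b] is the box (1, 1). *)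
Lemma passage_max x b (tau : R) : b \in staircase -> 0 <= tau ->
  (forall c, c \in staircase -> northwest c b -> c != b -> passage x c <= tau) ->
  (exists2 c, [&& c \in staircase, northwest c b & c != b] &
     passage x c = tau /\ forall d, d \in staircase -> northwest c d -> northwest d b ->
       d != b -> d = c) \/
  (tau = 0 /\ forall c, c \in staircase -> northwest c b -> c = b) ->
  passage x b = tau + x (b, 0%N).
Proof.
move=> bs tau0 le_tau h; rewrite (passageE _ bs); congr (_ + _).
pose up : box := (inord b.1.-1, b.2); pose left : box := (b.1, inord b.2.-1).
have /and3P[b1 b2 bn] : [&& (0 < b.1)%N, (0 < b.2)%N & (b.1 + b.2 <= n)%N].
  by rewrite -staircaseP.
have up1 : val up.1 = b.1.-1 by rewrite /= inordK//; lia.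
have left2 : val left.2 = b.2.-1 by rewrite /= inordK//; lia.
have upE : last_passage (box_weight x) b.1.-1 b.2 = passage x up.
  by rewrite /passage -up1.
have leftE : last_passage (box_weight x) b.1 b.2.-1 = passage x left.
  by rewrite /passage -left2.
have neq c : (val c.1 != b.1 :> nat) || (val c.2 != b.2 :> nat) -> c != b.
  by apply: contraTneq => ->; rewrite !eqxx.
have upP : (1 < b.1)%N -> [/\ up \in staircase, northwest up b & up != b].
  move=> b11; split; last by apply: neq; rewrite up1; apply/orP; left; lia.
    by rewrite staircaseP up1 /=; lia.
  by rewrite /northwest up1 /=; lia.
have leftP : (1 < b.2)%N -> [/\ left \in staircase, northwest left b & left != b].
  move=> b21; split; last by apply: neq; rewrite left2; apply/orP; right; lia.
    by rewrite staircaseP left2 /=; lia.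
  by rewrite /northwest left2 /=; lia.
have up_le : last_passage (box_weight x) b.1.-1 b.2 <= tau.
  have [/upP[? ? ?]|b11] := ltnP 1 b.1; first by rewrite upE; exact: le_tau.
  by rewrite (_ : b.1.-1 = 0%N)//=; lia.
have left_le : last_passage (box_weight x) b.1 b.2.-1 <= tau.
  have [/leftP[? ? ?]|b21] := ltnP 1 b.2; first by rewrite leftE; exact: le_tau.
  by rewrite (_ : b.2.-1 = 0%N) ?last_passage0//; lia.
apply/eqP; rewrite eq_le ge_max up_le left_le /= le_max.
case: h => [[c /and3P[cs cb cnb] [ct cmin]]|[-> bmin]].
  have [c1|c1] := ltnP c.1 b.1.
    have b11 : (1 < b.1)%N.
      by move: cs; rewrite staircaseP => /andP[c10 _]; exact: leq_ltn_trans c10 c1.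
    have [us ub unb] := upP b11.
    have cu : northwest c up.
      by move: cb; rewrite /northwest up1 /= => /andP[_ ->]; rewrite andbT -ltnS prednK.
    by rewrite upE (cmin up us cu ub unb) ct lexx.
  have c2 : (c.2 < b.2)%N.
    rewrite ltnNge; apply: contra cnb => c2; move: cb => /andP[cb1 cb2].
    by rewrite -pair_eqE /pair_eq -!val_eqE /= !eqn_leq cb1 cb2 c1 c2.
  have b21 : (1 < b.2)%N.
    by move: cs; rewrite staircaseP => /and3P[_ c20 _]; exact: leq_ltn_trans c20 c2.
  have [ls lb lnb] := leftP b21.
  have cl : northwest c left.
    by move: cb; rewrite /northwest left2 /= => /andP[-> _] /=; rewrite -ltnS prednK.
  by rewrite leftE (cmin left ls cl lb lnb) ct lexx orbT.
have b11 : b.1.-1 = 0%N.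
  have [/upP[us ub]|] := ltnP 1 b.1; last lia.
  by rewrite (bmin up us ub) eqxx.
by rewrite b11 /= lexx.
Qed.

(** Here [x] holds the original weights and [x'] the waiting times seen at time [tau], when the
    diagram is [D]. An addable box has used up part of its weight; the clock of a box further out
    has not started, so its weight is intact. *)
Record growth_invariant (D : {set box}) (x x' : S) (tau : R) : Prop := {
  growth_ge0 : 0 <= tau;
  growth_closed : forall b c, b \in D -> c \in staircase -> northwest c b -> c \in D;
  growth_added : forall b, b \in D -> passage x b <= tau;
  growth_addable : forall b, b \in addable D -> passage x b = tau + x' (b, 0%N);
  growth_fresh : forall b, b \in staircase -> b \notin D -> b \notin addable D ->
    x' (b, 0%N) = x (b, 0%N) }.

Lemma growth_invariant0 x : growth_invariant finset.set0 x x 0.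
Proof.
split=> // [b c|b|b /addableP[bs _ h]]; rewrite ?finset.in_set0//.
apply: passage_max => // [c cs cb cnb|].
  by have := h c cs cb cnb; rewrite finset.in_set0.
right; split=> // c cs cb; apply/eqP; apply: contraT => cnb.
by have := h c cs cb cnb; rewrite finset.in_set0.
Qed.

Lemma growth_invariant_step D x x' tau k :
  growth_invariant D x x' tau -> k \in addable D ->
  rings_first (addable D) k x' ->
  growth_invariant (add_box D k) x (advance (addable D) k x') (tau + x' (k, 0%N)).
Proof.
move=> [tau0 cl le_tau eq_tau fresh] kA /andP[k0 _].
have /addableP[ks kD kmin] := kA.
have x''E b : b != k -> advance (addable D) k x' (b, 0%N) =
    if b \in addable D then x' (b, 0%N) - x' (k, 0%N) else x' (b, 0%N).
  move=> bk; rewrite /advance /age /refresh /= !inDE bk (negbTE bk) addn0 andbT.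
  by [].
have addk b : b \in addable D -> b != k -> b \in addable (add_box D k).
  move=> /addableP[bs bD h] bk; apply/addableP; split=> //.
    by rewrite /add_box !inDE negb_or bk.
  by move=> c cs cb cnb; rewrite /add_box !inDE (h c cs cb cnb) orbT.
have le_tau' b : b \in add_box D k -> passage x b <= tau + x' (k, 0%N).
  rewrite /add_box !inDE => /predU1P[->|bD]; first by rewrite eq_tau.
  by apply: (le_trans (le_tau _ bD)); rewrite lerDl ltW.
split=> //.
- by rewrite addr_ge0// ltW.
- move=> b c; rewrite /add_box !inDE => /predU1P[->|bD] cs cb.
    by have [//|ck] := eqVneq c k; rewrite kmin.
  by rewrite (cl b)// orbT.
- move=> b bA; have /addableP[bs] := bA; rewrite /add_box !inDE negb_or => /andP[bk bD] bmin.
  rewrite x''E//; case: ifPn => [bA'|nbA]; first by rewrite eq_tau//; ring.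
  rewrite (fresh _ bs bD nbA); apply: passage_max => //.
  + by rewrite addr_ge0// ltW.
  + by move=> c cs cb cnb; apply: le_tau'; exact: bmin.
  (* A newly addable [b] owes this to [k], which therefore lies northwest of it. As [D] is closed
     towards the northwest and does not contain [k], no other box fits between [k] and [b], and [k]
     is the witness for [passage_max]. *)
  have kb : northwest k b.
    apply: contraNT nbA => kb; apply/addableP; split=> // c cs cb cnb.
    have := bmin c cs cb cnb; rewrite !inDE => /predU1P[ck|//].
    by rewrite -ck cb in kb.
  left; exists k; first by rewrite ks kb eq_sym bk.
  split; first by rewrite eq_tau.
  move=> d ds kd db dnb; have := bmin d ds db dnb; rewrite !inDE => /predU1P[//|dD].
  by have := cl _ _ dD ks kd; rewrite (negbTE kD).
- move=> b bs; rewrite /add_box !inDE negb_or => /andP[bk bD] nbA.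
  have nbA' : b \notin addable D by apply: contra nbA => /addk; exact.
  by rewrite x''E// (negbTE nbA') fresh.
Qed.

Local Notation growth_run := (run addable addable add_box).

Lemma passage_run m D x x' tau p :
  growth_invariant D x x' tau -> growth_run m D x' = Some p ->
  forall b, b \in unzip1 p ->
  passage x b = tau + \sum_(j < (index b (unzip1 p)).+1) nth 0 (unzip2 p) j.
Proof.
elim: m D x' tau p => [|m IH] D x' tau p inv /=; first by case: ifP => // _ [<-].
case: ifP => [_ [<-] //|_].
case: pickP => // k /andP[kA kf]; rewrite kA.
have := IH _ _ _ _ (growth_invariant_step inv kA kf).
case: (growth_run _ _ _) => //= q /(_ q erefl) h [<-] b.
rewrite inE [unzip1 _]/= [unzip2 _]/= /=.
have [<- _|kb] := eqVneq k b.
  by rewrite big_ord1 /= (growth_addable inv kA).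
move=> bq.
by rewrite (h b bq) [in RHS]big_ord_recl /= addrA.
Qed.

Definition corner (k : 'I_n.-1) : box := (inord (n - k.+1), inord k.+1).

Lemma val_corner (k : 'I_n.-1) : (val (corner k).1 = n - k.+1)%N /\ (val (corner k).2 = k.+1)%N.
Proof. by have := ltn_ord k; split; rewrite /= inordK//; lia. Qed.

Lemma corner_staircase (k : 'I_n.-1) : corner k \in staircase.
Proof. by rewrite staircaseP; have [-> ->] := val_corner k; have := ltn_ord k; lia. Qed.

Lemma corner_inj : injective corner.
Proof.
move=> k l e; have [_ ek] := val_corner k; have [_ el] := val_corner l.
by apply: val_inj; apply: succn_inj; rewrite -ek -el e.
Qed.

Definition lpp_last (w : seq box) (k : 'I_n.-1) : nat := (index (corner k) w).+1.

Lemma point_to_line_run m x p : growth_run m finset.set0 x = Some p -> forall k : 'I_n.-1,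
  tnth (point_to_line n (box_weight x)) k =
  \sum_(j < lpp_last (unzip1 p) k) nth 0 (unzip2 p) j.
Proof.
move=> rp k; rewrite tnth_mktuple.
have [<- <-] := val_corner k; rewrite -/(passage x (corner k)).
rewrite (passage_run (growth_invariant0 x) rp) ?add0r//.
by rewrite (complete_word_mem_box _ (run_complete rp)) corner_staircase finset.in_set0.
Qed.

Section LppLast.
Variable w : seq box.
Hypothesis cw : complete_word addable add_box finset.set0 w.

Let memw b : (b \in w) = (b \in staircase).
Proof. by rewrite (complete_word_mem_box _ cw) finset.in_set0 andbT. Qed.

Lemma lpp_last_inj : injective (lpp_last w).
Proof.
move=> k l [] e; apply: corner_inj.
have cw' j : corner j \in w by rewrite memw corner_staircase.
by rewrite -(nth_index (corner k) (cw' k)) e nth_index.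
Qed.

Lemma lpp_last_le (k : 'I_n.-1) : (lpp_last w k <= size w)%N.
Proof. by rewrite /lpp_last index_mem memw corner_staircase. Qed.

(** The last box added lies on the outer antidiagonal: otherwise its right neighbour would still be
    in the staircase and could only be added later. *)
Lemma lpp_last_max : w != [::] -> exists k : 'I_n.-1, lpp_last w k = size w.
Proof.
case/lastP E : w => [//|u e] _; rewrite -E.
have ew : e \in w by rewrite E mem_rcons inE eqxx.
have uw := complete_word_uniq cw.
have ie : (index e w).+1 = size w.
  move: uw; rewrite E rcons_uniq => /andP[eu _].
  by rewrite -cats1 index_cat (negbTE eu) /= eqxx addn0 size_cat addn1.
have es := ew; rewrite memw staircaseP in es; have /and3P[e1 e2 en] := es.
have diag : (e.1 + e.2)%N = n.
  apply/eqP; rewrite eqn_leq en /= leqNgt; apply/negP => lt.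
  pose d : box := (e.1, inord e.2.+1).
  have d2 : val d.2 = e.2.+1 by rewrite /= inordK//; lia.
  have ds : d \in staircase by rewrite staircaseP d2 /=; lia.
  have ed : e != d.
    apply/eqP => ed; have : val e.2 = val d.2 by rewrite {1}ed.
    by rewrite d2 /= => /n_Sn.
  have := complete_word_northwest cw (b := d) (c := e).
  rewrite memw ds -memw ew finset.in_set0 /northwest d2 /= leqnn leqnSn ed.
  move=> /(_ isT isT isT isT isT).
  have : (index d w < size w)%N by rewrite index_mem memw.
  by rewrite -ie ltnS => /leq_ltn_trans h /h; rewrite ltnn.
have kn : (e.2.-1 < n.-1)%N by lia.
exists (Ordinal kn); rewrite -ie /lpp_last; congr (index _ _).+1.
have [c1 c2] := val_corner (Ordinal kn).
rewrite [corner _]surjective_pairing [e in RHS]surjective_pairing.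
by congr (_, _); apply: val_inj; rewrite ?c1 ?c2 /=; lia.
Qed.

End LppLast.

End LastPassageRun.

(** * Standard tableaux as complete words *)

Section Tableaux.
Context {n : nat}.
Local Notation box := (@box n).
Implicit Types (w : seq box) (t : @filling n) (b c : box).

Let inDE := (finset.in_setD, finset.in_setU1, finset.in_set1).

Local Notation complete := (complete_word addable add_box finset.set0).

Definition tableau_of w : @filling n :=
  [ffun b => if b \in staircase then inord (index b w).+1 else ord0].

Lemma size_complete_box w : complete w -> size w = nbox n.
Proof.
by move=> cw; rewrite (size_complete_word missing_add_box missing_eq0 cw) missing0.
Qed.

Lemma mem_complete_box w b : complete w -> (b \in w) = (b \in staircase).
Proof. by move=> cw; rewrite (complete_word_mem_box _ cw) finset.in_set0 andbT. Qed.

Lemma val_tableau_of w b : complete w ->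
  tableau_of w b = (if b \in staircase then (index b w).+1 else 0%N) :> nat.
Proof.
move=> cw; rewrite ffunE; case: ifPn => // bs.
by rewrite inordK// ltnS -(size_complete_box cw) index_mem mem_complete_box.
Qed.

Lemma tableau_of_SYT w : complete w -> tableau_of w \in SYT n.
Proof.
move=> cw; have tE := val_tableau_of _ cw; rewrite finset.in_set.
have lt b c : b \in staircase -> c \in staircase -> northwest b c -> b != c ->
    (tableau_of w b < tableau_of w c)%N.
  move=> bs cs bc nbc; rewrite !tE bs cs ltnS.
  apply: (complete_word_northwest cw) => //; rewrite ?finset.in_set0//.
  by rewrite mem_complete_box.
apply/and4P; split.
- by apply/forallP => b; rewrite tE; case: ifP.
- apply/forall_inP => b bs; apply/forall_inP => c cs; apply/implyP => /eqP e.
  have := congr1 val e; rewrite /= !tE bs cs => -[ei].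
  have bw : b \in w by rewrite mem_complete_box.
  have cw' : c \in w by rewrite mem_complete_box.
  by rewrite -(nth_index b bw) ei nth_index.
- apply/forall_inP => b bs; apply/forall_inP => c cs; apply/implyP => /andP[/eqP e1 lt2].
  apply: lt => //; first by rewrite /northwest e1 leqnn ltnW.
  by apply: contraTneq lt2 => ->; rewrite ltnn.
- apply/forall_inP => b bs; apply/forall_inP => c cs; apply/implyP => /andP[/eqP e1 lt2].
  apply: lt => //; first by rewrite /northwest e1 leqnn ltnW.
  by apply: contraTneq lt2 => ->; rewrite ltnn.
Qed.

Lemma tableau_of_inj w w' : complete w -> complete w' ->
  tableau_of w = tableau_of w' -> w = w'.
Proof.
move=> cw cw' e.
have sw := size_complete_box cw; have sw' := size_complete_box cw'.
case: w cw e sw => [|b0 w0]; first by move=> _ _ sw; apply/esym/nilP; rewrite /nilp sw' -sw.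
move: (b0 :: w0) => w cw e sw.
apply: (@eq_from_nth _ b0) => [|i iw]; first by rewrite sw sw'.
have bw := mem_nth b0 iw; have bs := bw; rewrite (mem_complete_box _ cw) in bs.
have := congr1 (fun t : filling => val (t (nth b0 w i))) e.
rewrite /= !val_tableau_of// bs (index_uniq _ iw (complete_word_uniq cw)) => -[ei].
by rewrite [in RHS]ei nth_index// mem_complete_box.
Qed.

(** Row and column monotonicity are combined through the box [(b.1, c.2)], which lies in the
    staircase because its coordinates are at most those of [c]. *)
Lemma SYT_lt t b c : t \in SYT n -> b \in staircase -> c \in staircase ->
  northwest b c -> b != c -> (t b < t c)%N.
Proof.
rewrite finset.in_set => /and4P[_ _ /forall_inP row /forall_inP col] bs cs /andP[bc1 bc2] nbc.
pose d : box := (b.1, c.2).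
have ds : d \in staircase.
  move: bs cs; rewrite !finset.in_set /= => /and3P[-> _ _] /and3P[_ -> cn] /=.
  by apply: leq_trans cn; rewrite leq_add2r.
have row' := forall_inP (row b bs) d ds; have col' := forall_inP (col d ds) c cs.
rewrite /d /= eqxx /= in row'; rewrite /d /= eqxx /= in col'.
move: bc1; rewrite leq_eqVlt => /predU1P[e1|lt1].
  have e : d = c by rewrite /d [c in RHS]surjective_pairing; congr (_, _); exact: val_inj.
  move: row'; rewrite -/d e => /implyP; apply; rewrite ltn_neqAle bc2 andbT.
  apply: contraNneq nbc => e2; rewrite [b]surjective_pairing [c]surjective_pairing.
  by apply/eqP; congr (_, _); exact: val_inj.
have dc := implyP col' lt1.
move: bc2; rewrite leq_eqVlt => /predU1P[e2|lt2].
  rewrite [b]surjective_pairing (_ : b.2 = c.2)//; exact: val_inj.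
exact: ltn_trans (implyP row' lt2) dc.
Qed.

(** Sort the boxes by their entries. The entries are distinct numbers between 1 and [nbox n], as
    many as there are boxes, so each entry is one more than the index of its box in the sorted
    list. *)
Lemma SYT_word t : t \in SYT n -> exists2 w, complete w & tableau_of w = t.
Proof.
move=> tS; have lt := SYT_lt tS.
have := tS; rewrite finset.in_set => /and4P[/forallP pos /forall_inP inj _ _].
pose leT : rel box := fun b c => (t b <= t c)%N.
pose w := sort leT (enum staircase).
have mw b : (b \in w) = (b \in staircase) by rewrite mem_sort mem_enum.
have uw : uniq w by rewrite sort_uniq enum_uniq.
have sw : size w = nbox n by rewrite size_sort -cardE card_staircase.
have us : uniq [seq val (t b) | b <- w].
  rewrite map_inj_in_uniq ?uw// => b c; rewrite !mw => bs cs /val_inj/eqP e.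
  by apply/eqP; apply: (implyP (forall_inP (inj b bs) c cs)).
have vals : [seq val (t b) | b <- w] = iota 1 (nbox n).
  apply: (irr_sorted_eq ltn_trans ltnn).
  - rewrite ltn_sorted_uniq_leq us sorted_map.
    by apply: sort_sorted => b c; exact: leq_total.
  - exact: iota_ltn_sorted.
  have sub : {subset [seq val (t b) | b <- w] <= iota 1 (nbox n)}.
    move=> x /mapP[b]; rewrite mw => bs ->; rewrite mem_iota.
    by have := eqP (pos b); rewrite bs => <- /=; rewrite add1n ltn_ord.
  apply: (uniq_min_size us sub _).2.
  by rewrite size_iota size_map sw.
have tE b : b \in staircase -> (index b w).+1 = t b.
  move=> bs; have bw : b \in w by rewrite mw.
  have iw : (index b w < size w)%N by rewrite index_mem.
  have := congr1 (fun s => nth 0%N s (index b w)) vals.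
  rewrite (nth_map b)// nth_index// nth_iota; last by rewrite -sw.
  by rewrite add1n => <-.
have cw : complete w.
  apply: linear_extension_complete => //.
    by move=> b; rewrite mw finset.in_set0 andbT.
  move=> b c; rewrite mw => bs cs cb cnb _.
  by rewrite -ltnS !tE//; exact: lt.
exists w => //; apply/ffunP => b; apply: val_inj => /=.
rewrite val_tableau_of//; case: ifPn => [/tE //|bs].
by have := eqP (pos b); rewrite (negbTE bs) lt0n => /esym/negbFE/eqP.
Qed.

Lemma words_SYT :
  perm_eq [seq tableau_of w | w <- words addable add_box missing finset.set0]
          (enum (SYT n)).
Proof.
have mw := mem_words missing_add_box missing_eq0 finset.set0.
apply: uniq_perm.
- rewrite map_inj_in_uniq; first exact: words_uniq.
  by move=> w w'; rewrite !mw; exact: tableau_of_inj.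
- exact: enum_uniq.
move=> t; rewrite mem_enum; apply/mapP/idP => [[w]|/SYT_word[w cw <-]].
  by rewrite mw => cw ->; exact: tableau_of_SYT.
by exists w; rewrite ?mw.
Qed.

Lemma cor_tableau_of w k : complete w -> cor (tableau_of w) k = lpp_last w k.
Proof. by move=> cw; rewrite /cor val_tableau_of// -/(corner k) corner_staircase. Qed.

(** The first [j] boxes of a complete word contain every staircase box northwest of any of them.
    Hence adding [b] leaves a Young diagram exactly when all boxes northwest of [b], other than [b],
    are already there. *)
Lemma syt_deg_tableau_of w j : complete w ->
  syt_deg (tableau_of w) j = word_degree addable add_box finset.set0 w j.
Proof.
move=> cw; rewrite /syt_deg /word_degree; set L := foldl _ _ _.
have memL b : (b \in L) = (b \in staircase) && (index b w < j)%N.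
  rewrite foldl_add_box finset.in_set0 /=.
  have [bs|bs] := boolP (b \in staircase).
    by rewrite in_take// mem_complete_box.
  by apply/negP => /mem_take; rewrite mem_complete_box// (negbTE bs).
have -> : subdiagram (tableau_of w) j = L.
  apply/setP => b; rewrite memL; apply/finset.setIdP/andP => -[bs];
  by rewrite val_tableau_of// bs.
congr #|pred_of_set _|; apply/setP => b.
apply/finset.setIdP/addableP.
  rewrite !inDE => -[/andP[bL bs] /forall_inP h]; split=> // c cs cb cnb.
  have := h b; rewrite !inDE eqxx => /(_ isT)/and3P[_ _ /forallP/(_ c)].
  move: cb cs => /andP[-> ->]; rewrite finset.in_set => /and3P[-> -> _] /=.
  by rewrite !inDE (negbTE cnb).
move=> [bs bL h]; rewrite !inDE bL bs; split=> //.
apply/forall_inP => a aL.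
have as_ : a \in staircase.
  by move: aL; rewrite !inDE => /predU1P[->//|]; rewrite memL => /andP[].
have := as_; rewrite finset.in_set => /and3P[a1 a2 an]; rewrite a1 a2 /=.
apply/forallP => c; apply/implyP => /and4P[c1 c2 ca1 ca2].
have cs : c \in staircase.
  by rewrite finset.in_set c1 c2 /=; apply: leq_trans an; exact: leq_add.
have ca : northwest c a by rewrite /northwest ca1 ca2.
have [->//|cna] := eqVneq c a.
move: aL; rewrite !inDE => /predU1P[ab|aL].
  by rewrite (h c) ?orbT// -ab.
rewrite memL cs /=; apply/orP; right.
move: aL; rewrite memL => /andP[_]; apply: ltn_trans.
apply: (complete_word_northwest cw) => //; rewrite ?finset.in_set0//.
by rewrite mem_complete_box.
Qed.

End Tableaux.

Section LppLaplace.
Context {R : realType} {n : nat}.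
Hypothesis n2 : (2 <= n)%N.
Local Notation box := (@box n).
Local Notation S := (@config R (box * nat)%type).

Lemma measurable_last_passage d (T : measurableType d) (f : nat -> nat -> T -> R) i j :
  (forall i j, measurable_fun setT (f i j)) ->
  measurable_fun setT (fun x => last_passage (fun a b => f a b x) i j).
Proof.
move=> mf; elim: i j => [|i IH] j /=; first exact: measurable_cst.
elim: j => [|j IHj] /=; first exact: measurable_cst.
by apply: measurable_funD => //; apply: measurable_maxr.
Qed.

Lemma measurable_point_to_line d (T : measurableType d) (f : nat -> nat -> T -> R) :
  (forall i j, measurable_fun setT (f i j)) ->
  measurable_fun setT (fun x => point_to_line n (fun a b => f a b x)).
Proof.
move=> mf; apply/measurable_fun_tnthP => k; rewrite /comp.
under eq_fun do rewrite tnth_mktuple.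
exact: measurable_last_passage.
Qed.

Lemma eq_last_passage (x x' : nat -> nat -> R) i j :
  (forall a b, (a < i)%N -> (b < j)%N -> x a b = x' a b) ->
  last_passage x i j = last_passage x' i j.
Proof.
elim: i j => [|i IH] j //; elim: j => [|j IHj] // h.
rewrite !last_passageS IHj ?(IH j.+1) ?h//.
- by move=> a b ai bj; apply: h => //; exact: ltnW.
- by move=> a b ai bj; apply: h => //; exact: ltnW.
Qed.

Lemma integral_laplace_growth (M : probability S R) (iidM : iid_law M)
    (c : 'S_n.-1) (y : nat -> nat) :
  (\int[M]_x (laplace c (fun r => (y r)%:R%R) (point_to_line n (box_weight x)))%:E =
  (\sum_(t in SYT n | syt_perm t == c)
     rate_value (cor t) (syt_deg t) (fun k => y k))%:E)%E.
Proof.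
have sz w := size_complete_word (s := finset.set0) (w := w)
  (@missing_add_box n) (@missing_eq0 n).
rewrite (@integral_laplace_run R _ _ n.-1 addable addable add_box
  missing (fun s => subxx _) missing_add_box missing_eq0 finset.set0 lpp_last _ _ _ _
  (fun x => point_to_line n (box_weight x)) _ _ M iidM c y).
- congr EFin; rewrite -[RHS]big_enum_cond /= -(perm_big _ words_SYT) big_map /=.
  rewrite big_seq_cond [RHS]big_seq_cond.
  have mw : forall w : seq box, w \in words addable add_box missing finset.set0 ->
      complete_word addable add_box (finset.set0 : {set box}) w.
    by move=> w; rewrite (mem_words missing_add_box missing_eq0).
  have corE (w : seq box) : w \in words addable add_box missing finset.set0 ->
      cor (tableau_of w) = lpp_last w.
    by move=> /(mw w) cw; apply/funext => k; exact: cor_tableau_of.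
  apply: eq_big => w.
    by case: (boolP (w \in _)) => //= wW; rewrite /syt_perm corE.
  move=> /andP[wW _]; rewrite corE//; congr rate_value.
  by apply/funext => j; rewrite syt_deg_tableau_of//; exact: mw.
- by move=> w cw; exact: lpp_last_inj.
- by [].
- by move=> w k cw; rewrite -(sz _ cw); exact: lpp_last_le.
- move=> w cw; rewrite -(sz _ cw); apply: lpp_last_max => //.
  apply/eqP => w0; have := sz _ cw; rewrite w0 missing0 /= /nbox.
  by case: (n) n2 => [|[|m]] // _; rewrite mulSn /= ; lia.
- by apply: measurable_point_to_line => i j; exact: measurable_coord.
- by move=> i x p rp k; exact: (point_to_line_run rp).
Qed.

(* An injection of indices with [((i+1, j+1), 0) |-> (i, j)]; the indices
   [(b, r.+1)] receive weights that play no role. *)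
Definition box_index (p : box * nat) : nat * nat :=
  (p.2 * n.+1 + (p.1.1 + n) %% n.+1, (p.1.2 + n) %% n.+1)%N.

(** Adding [n] modulo [n.+1] is the cyclic predecessor, hence injective, and division by [n.+1]
    recovers the second component of the index. *)
Lemma box_index_inj : injective box_index.
Proof.
have inj (a b : 'I_n.+1) : ((a + n) %% n.+1 = (b + n) %% n.+1)%N -> a = b.
  by move=> /eqP; rewrite eqn_modDr !modn_small// => /eqP /val_inj.
move=> [[a1 a2] r] [[b1 b2] s] [] e1 /inj ->.
have e : r = s.
  have := congr1 (divn^~ n.+1) e1.
  by rewrite /= !divnMDl// !(@divn_small (_ %% _)) ?ltn_pmod// !addn0.
by move: e1; rewrite e => /eqP; rewrite eqn_add2l => /eqP /inj ->.
Qed.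

(** The chain needs a whole sequence of waiting times for each box. Reindexing the weights by the
    injective [box_index] produces such a family with an i.i.d. law, and it has the same weights on
    the boxes that the passage times use. *)
Lemma integral_laplace_lpp (M : probability (@config R (nat * nat)%type) R)
    (iidM : iid_law M) (c : 'S_n.-1) (y : nat -> nat) :
  (\int[M]_x (laplace c (fun r => (y r)%:R%R) (point_to_line n (fun i j => x (i, j))))%:E =
  (\sum_(t in SYT n | syt_perm t == c)
     rate_value (cor t) (syt_deg t) (fun k => y k))%:E)%E.
Proof.
pose f (x : @config R (nat * nat)%type) : S := fun p => x (box_index p).
have mf : measurable_fun setT f.
  by apply: measurable_to_config => p; exact: measurable_coord.
have iidM' : iid_law (distribution M (mfun_of mf)).
  exact: (iid_law_comp box_index_inj iidM).
have mW : measurable_fun setT (fun x : S => point_to_line n (box_weight x)).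
  by apply: measurable_point_to_line => i j; exact: measurable_coord.
apply: etrans (integral_laplace_growth iidM' c y).
rewrite (integral_laplace_pushforward M mf c mW (fun=> ler0n _ _)).
apply: eq_integral => x _; congr (laplace _ _ _)%:E.
apply: eq_from_tnth => k; rewrite !tnth_mktuple; apply: eq_last_passage => i j ik jk.
rewrite /box_weight /f /box_index /= mul0n add0n; congr (x (_, _)).
  rewrite inordK; last by have := ltn_ord k; lia.
  by rewrite addSnnS modnDr modn_small//; lia.
rewrite inordK; last by have := ltn_ord k; lia.
by rewrite addSnnS modnDr modn_small//; have := ltn_ord k; lia.
Qed.

End LppLaplace.

(** * Comparison of the two sides *)

Section WordRates.
Context {R : realType} {K : finType} {St : Type} {m : nat}.
Variables (effective : St -> {set K}) (jump : St -> K -> St) (rk : St -> nat).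
Hypothesis rk_jump : forall s k, k \in effective s -> (rk (jump s k)).+1 = rk s.
Hypothesis rk_eq0 : forall s, (rk s == 0%N) = (effective s == finset.set0).
Variables (s0 : St) (last : seq K -> 'I_m -> nat).
Hypothesis lastP : forall w, complete_word effective jump s0 w ->
  [/\ injective (last w), forall k, (last w k <= rk s0)%N
    & exists k, last w k = rk s0].

Lemma word_degree_gt0 s w j : complete_word effective jump s w ->
  (j < size w)%N -> (0 < word_degree effective jump s w j)%N.
Proof.
elim: w s j => [|k w IH] s j //= /andP[ks cw]; case: j => [|j]; last exact: IH.
by move=> _; rewrite /word_degree take0; apply/card_gt0P; exists k.
Qed.

Lemma positive_rates_word w : complete_word effective jump s0 w ->
  positive_rates (last w) (word_degree effective jump s0 w).
Proof.
move=> cw k j /andP[_ jk]; have [inj le max] := lastP cw.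
apply: word_degree_gt0 => //; rewrite (size_complete_word rk_jump rk_eq0 cw).
apply: leq_trans jk _; rewrite -[leqRHS](increasing_last inj le max).
by apply: increasing_sorted => //; rewrite ltn_ord leqnn.
Qed.

(** At y = 0 the rate values are the path probabilities of the jump chain. This supplies the mass
    hypotheses of [laplace_law_eq]. *)
Lemma sum_rate_value0 : \sum_(w <- words effective jump rk s0)
  rate_value (last w) (word_degree effective jump s0 w) (fun=> 0%N) = 1 :> R.
Proof.
rewrite -[RHS](sum_word_weight0 rk_jump rk_eq0 s0) big_seq [RHS]big_seq.
apply: eq_bigr => w; rewrite (mem_words rk_jump rk_eq0) => cw.
have [inj le max] := lastP cw.
rewrite (rate_value_stage inj le max _ (fun=> 0%N)) /word_weight.
by rewrite (size_complete_word rk_jump rk_eq0 cw).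
Qed.

End WordRates.

Section SortingNetworkRates.
Context {n : nat}.
Hypothesis n2 : (2 <= n)%N.

Lemma nbox_gt0 : (0 < nbox n)%N.
Proof. by rewrite /nbox; case: (n) n2 => [|[|m]] // _; rewrite mulSn; lia. Qed.

Lemma osp_last_spec w : complete_word swap_effective swap_jump (1%g : 'S_n) w ->
  [/\ injective (osp_last w), forall k, (osp_last w k <= swap_rank (1%g : 'S_n))%N
    & exists k, osp_last w k = swap_rank (1%g : 'S_n)].
Proof.
move=> cw; have sw := size_complete_word swap_rank_jump swap_rank_eq0 cw.
rewrite -sw; split; [exact: osp_last_inj|exact: osp_last_le|].
by apply: osp_last_max => //; rewrite -size_eq0 sw swap_rank1 -lt0n nbox_gt0.
Qed.

Lemma SN_rates (s : swap_seq) : s \in SN n ->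
  positive_rates (last_swap s) (sn_deg s).
Proof.
move=> sS; rewrite (_ : last_swap s = osp_last s); last first.
  by apply/funext => k; exact: last_swapE.
rewrite (_ : sn_deg s = word_degree swap_effective swap_jump 1%g s); last first.
  by apply/funext => j; exact: sn_degE.
apply: (positive_rates_word swap_rank_jump swap_rank_eq0 osp_last_spec).
by rewrite complete_word1 size_tuple eqxx -mem_SN.
Qed.

Lemma sum_SN_rate_value0 (R : realType) :
  \sum_(s in SN n) rate_value (last_swap s) (sn_deg s) (fun=> 0%N) = 1 :> R.
Proof.
rewrite -[RHS](sum_rate_value0 swap_rank_jump swap_rank_eq0 osp_last_spec).
rewrite (perm_big _ words_SN) big_map big_enum /=; apply: eq_bigr => s sS.
congr rate_value; apply/funext => k; first exact: last_swapE.
exact: sn_degE.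
Qed.

End SortingNetworkRates.

Section TableauRates.
Context {n : nat}.
Hypothesis n2 : (2 <= n)%N.
Local Notation box := (@box n).

Lemma lpp_last_spec (w : seq box) : complete_word addable add_box finset.set0 w ->
  [/\ injective (lpp_last w), forall k, (lpp_last w k <= missing (finset.set0 : {set box}))%N
    & exists k, lpp_last w k = missing (finset.set0 : {set box})].
Proof.
move=> cw; have sw := size_complete_word (@missing_add_box n) missing_eq0 cw.
rewrite -sw; split; [exact: lpp_last_inj|exact: lpp_last_le|].
by apply: lpp_last_max => //; rewrite -size_eq0 sw missing0 -lt0n nbox_gt0.
Qed.

Lemma cor_tableau_ofE (w : seq box) : complete_word addable add_box finset.set0 w ->
  cor (tableau_of w) = lpp_last w.
Proof. by move=> cw; apply/funext => k; exact: cor_tableau_of. Qed.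

Lemma syt_deg_tableau_ofE (w : seq box) : complete_word addable add_box finset.set0 w ->
  syt_deg (tableau_of w) = word_degree addable add_box finset.set0 w.
Proof. by move=> cw; apply/funext => j; exact: syt_deg_tableau_of. Qed.

Lemma SYT_rates (t : @filling n) : t \in SYT n -> positive_rates (cor t) (syt_deg t).
Proof.
move=> /SYT_word[w cw <-]; rewrite cor_tableau_ofE// syt_deg_tableau_ofE//.
exact: (positive_rates_word (@missing_add_box n) missing_eq0 lpp_last_spec).
Qed.

Lemma sum_SYT_rate_value0 (R : realType) :
  \sum_(t in SYT n) rate_value (cor t) (syt_deg t) (fun=> 0%N) = 1 :> R.
Proof.
rewrite -[RHS](sum_rate_value0 (@missing_add_box n) missing_eq0 lpp_last_spec).
rewrite -[LHS]big_enum /= -(perm_big _ words_SYT) big_map big_seq [RHS]big_seq.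
apply: eq_bigr => w; rewrite (mem_words (@missing_add_box n) missing_eq0) => cw.
by rewrite cor_tableau_ofE// syt_deg_tableau_ofE.
Qed.

End TableauRates.

Lemma sum_free_space_eqP (R : realType) m (I J : finType) (A : {set I}) (B : {set J})
    (f : I -> ratfun R m) (g : J -> ratfun R m) (p : I -> 'S_m) (q : J -> 'S_m) :
  \sum_(i in A) f i *: basis_vec R (p i) = \sum_(j in B) g j *: basis_vec R (q j) <->
  forall c, \sum_(i in A | p i == c) f i = \sum_(j in B | q j == c) g j.
Proof.
have coef (L : finType) (D : {set L}) (h : L -> ratfun R m) (r : L -> 'S_m) c :
    (\sum_(i in D) h i *: basis_vec R (r i) : {ffun _ -> (ratfun R m)^o}) c =
    \sum_(i in D | r i == c) h i.
  rewrite sum_ffunE [RHS]big_mkcondr /=; apply: eq_bigr => i _.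
  rewrite !ffunE eq_sym; case: eqP => _; last by rewrite scaler0.
  exact: mulr1.
split=> [e c|e]; first by rewrite -!coef e.
by apply/ffunP => c; rewrite !coef.
Qed.

Theorem mainTheorem3 (R : realType) (n : nat) (hn : (2 <= n)%N)
    (* xi (k, r): waiting time before the (r+1)-st ring of the k-th clock *)
    (dU : measure_display) (TU : measurableType dU) (P : probability TU R)
    (xi : 'I_n.-1 * nat -> {RV P >-> R}) (hxi : iid_exponential xi)
    (* X (i, j): weight of the box (i+1, j+1) *)
    (dV : measure_display) (TV : measurableType dV) (Q : probability TV R)
    (X : nat * nat -> {RV Q >-> R}) (hX : iid_exponential X) :
  eq_in_distribution P Q
    (fun w : TU => last_swap_times (fun k r => xi (k, r) w))
    (fun w : TV => point_to_line n (fun i j => X (i, j) w))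
  <->
  \sum_(t in SYT n) syt_gf R t *: basis_vec R (syt_perm t) =
  \sum_(s in SN n) sn_gf R s *: basis_vec R (sn_perm s).
Proof.
pose U (w : TU) := last_swap_times (fun k r => xi (k, r) w).
pose V (w : TV) := point_to_line n (fun i j => X (i, j) w).
have mxi := measurable_config_of xi; have mX := measurable_config_of X.
have mV0 : measurable_fun setT (fun x : @config R (nat * nat)%type =>
    point_to_line n (fun i j => x (i, j))).
  by apply: measurable_point_to_line => i j; exact: measurable_coord.
have mU : measurable_fun setT U := measurableT_comp measurable_last_swap_times mxi.
have mV : measurable_fun setT V := measurableT_comp mV0 mX.
pose mu := distribution P (mfun_of mU); pose nu := distribution Q (mfun_of mV).
have y0 (y : nat -> nat) r : 0 <= (y r)%:R :> R by exact: ler0n.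
have muE c (y : nat -> nat) : (\int[mu]_v (laplace c (fun r => (y r)%:R%R) v)%:E =
    (\sum_(s in SN n | sn_perm s == c)
       rate_value (last_swap s) (sn_deg s) (fun k => y k))%:E)%E.
  rewrite (integral_laplace_pushforward P mU c (@measurable_id _ _ setT) (y0 y)).
  rewrite -(integral_laplace_pushforward P mxi c measurable_last_swap_times (y0 y)).
  by apply: (integral_laplace_osp hn); exact: iid_law_of.
have nuE c (y : nat -> nat) : (\int[nu]_v (laplace c (fun r => (y r)%:R%R) v)%:E =
    (\sum_(t in SYT n | syt_perm t == c)
       rate_value (cor t) (syt_deg t) (fun k => y k))%:E)%E.
  rewrite (integral_laplace_pushforward Q mV c (@measurable_id _ _ setT) (y0 y)).
  rewrite -(integral_laplace_pushforward Q mX c mV0 (y0 y)).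
  by apply: (integral_laplace_lpp hn); exact: iid_law_of.
rewrite sum_free_space_eqP.
have rates c : \sum_(t in SYT n | syt_perm t == c) syt_gf R t =
      \sum_(s in SN n | sn_perm s == c) sn_gf R s <->
    forall y, \sum_(t in SYT n | syt_perm t == c) rate_value (cor t) (syt_deg t) y =
      \sum_(s in SN n | sn_perm s == c) rate_value (last_swap s) (sn_deg s) y :> R.
  by apply: sum_rate_product_eqP => [t|s] /andP[]; [move=> /(SYT_rates hn)|move=> /(SN_rates hn)].
split=> [eUV c|e].
  (* The Laplace formulas take parameters indexed by all natural numbers; [y'] extends [y] by 0. *)
  apply/rates => y; pose y' r := oapp y 0%N (insub r).
  have -> : y = (fun k => y' k) by apply/funext => k; rewrite /y' valK.
  apply: EFin_inj; rewrite -muE -nuE; apply: eq_measure_integral => B mB _.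
  by apply/esym; exact: eUV.
have mass (I : finType) (A : {set I}) (F : I -> R) (q : I -> 'S_n.-1) :
    \sum_(i in A) F i = 1 ->
    (\sum_(c : 'S_n.-1) (\sum_(i in A | q i == c) F i)%:E = 1%:E)%E.
  by move=> F1; rewrite sumEFin -(partition_big q xpredT)//= F1.
(* Writing the zero parameter as the image of the natural number 0 gives it the form to which [muE]
   and [nuE] apply. *)
have mass0 (p : probability (n.-1.-tuple R) R) (y : nat -> R) : y = (fun=> 0) ->
  (\sum_(c : 'S_n.-1) \int[p]_v (laplace c y v)%:E = 1)%E ->
  (\sum_(c : 'S_n.-1) \int[p]_v (laplace c (fun=> 0%R) v)%:E = 1)%E by move=> ->.
move=> B mB; apply: (@laplace_law_eq R n.-1 mu nu) => //.
- move=> c y; rewrite muE nuE; congr EFin; apply/esym.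
  exact: (iffLR (rates c) (e c)).
- apply: (mass0 _ (fun r => ((fun=> 0%N) r)%:R)) => //.
  under eq_bigr do rewrite muE.
  exact: mass (sum_SN_rate_value0 hn R).
- apply: (mass0 _ (fun r => ((fun=> 0%N) r)%:R)) => //.
  under eq_bigr do rewrite nuE.
  exact: mass (sum_SYT_rate_value0 hn R).
Qed.
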